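(* Let $S$ be an inverse semigroup with set of idempotents $E$, and regard $\ell^{1}(S)$ as a Banach $\ell^{1}(E)$-module with the trivial left action and the natural right action, i.e. $\delta_e.\delta_s=\delta_s$ and $\delta_s.\delta_e=\delta_{se}$ for $s\in S$, $e\in E$. Then for every $n\in\mathbb{N}$, $\ell^{1}(S)$ is $2n$-weakly module amenable as an $\ell^{1}(E)$-module; that is, $(\ell^{1}(S)/J)^{(2n)}$ is a commutative Banach $\ell^1(S)$-$\ell^1(E)$-module and every continuous module derivation $D:\ell^{1}(S)\to(\ell^{1}(S)/J)^{(2n)}$ is inner: there exists $\Phi\in(\ell^{1}(S)/J)^{(2n)}$ with $D(f)=f\Phi-\Phi f$ for all $f\in\ell^{1}(S)$.
   Context: An inverse semigroup is a semigroup $S$ such that for each $s\in S$ there is a unique $s^{*}\in S$ with $ss^{*}s=s$ and $s^{*}ss^{*}=s^{*}$; $E$ denotes its set of idempotents (every element of $E$ has the form $ss^*$, and $E$ is a commutative subsemigroup). $\ell^1(S)$ is the convolution algebra with $\delta_s*\delta_t=\delta_{st}$; $\ell^1(E)\subseteq\ell^1(S)$. The actions of $\ell^1(E)$ on $\ell^1(S)$ are the continuous bilinear extensions of $\delta_e.\delta_s=\delta_s$, $\delta_s.\delta_e=\delta_{se}$. $J$ is the closed ideal of $\ell^1(S)$ generated by elements $(a.\alpha)b-a(\alpha.b)$ ($a,b\in\ell^1(S)$, $\alpha\in\ell^1(E)$); here $J$ is the closed linear span of $\{\delta_{set}-\delta_{st}: s,t\in S, e\in E\}$. The quotient $\ell^1(S)/J$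 is a Banach algebra and an $\ell^1(E)$-bimodule via $\alpha.(a+J)=\alpha.a+J$, $(a+J).\alpha=a.\alpha+J$, and an $\ell^1(S)$-bimodule via $a(b+J)=ab+J$, $(b+J)a=ba+J$. For a Banach bimodule $X$, its dual $X^*$ carries the actions $\langle x,af\rangle=\langle xa,f\rangle$, $\langle x,fa\rangle=\langle ax,f\rangle$ (for both algebras); $X^{(0)}=X$, $X^{(n)}=(X^{(n-1)})^*$. A module $X$ over $\ell^1(E)$ is commutative if $\alpha.x=x.\alpha$ for all $\alpha,x$. A module derivation $D:\ell^1(S)\to X$ is a bounded map with $D(a\pm b)=D(a)\pm D(b)$, $D(ab)=aD(b)+D(a)b$, $D(\alpha.a)=\alpha.D(a)$, $D(a.\alpha)=D(a).\alpha$ for $a,b\in\ell^1(S)$, $\alpha\in\ell^1(E)$. $\ell^1(S)$ is called $n$-weakly module amenable if $(\ell^1(S)/J)^{(n)}$ is a commutative $\ell^1(E)$-module and every continuous module derivation $\ell^1(S)\to(\ell^1(S)/J)^{(n)}$ is inner, i.e. of the form $a\mapsto a\Phi-\Phi a$ for some $\Phi$. *)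

(* Defs.v *)
From Stdlib Require Import Reals List Classical ClassicalEpsilon.
Import ListNotations.
Open Scope R_scope.
Set Implicit Arguments.

Record Cpx := mkC { re : R ; im : R }.
Definition C0 : Cpx := mkC 0 0.
Definition C1 : Cpx := mkC 1 0.
Definition Cadd (x y : Cpx) : Cpx := mkC (re x + re y) (im x + im y).
Definition Copp (x : Cpx) : Cpx := mkC (- re x) (- im x).
Definition Csub (x y : Cpx) : Cpx := Cadd x (Copp y).
Definition Cmul (x y : Cpx) : Cpx :=
  mkC (re x * re y - im x * im y) (re x * im y + im x * re y).
Definition Cnorm (x : Cpx) : R := sqrt (re x * re x + im x * im x).

Definition sum_list (l : list R) : R := fold_right Rplus 0 l.

Definition has_sum (I : Type) (f : I -> R) (l : R) : Prop :=
  forall eps, 0 < eps -> exists F0 : list I,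
    forall F : list I, NoDup F -> incl F0 F ->
      Rabs (sum_list (map f F) - l) < eps.

Definition summable (I : Type) (f : I -> R) : Prop := exists l, has_sum f l.

Definition tsum (I : Type) (f : I -> R) : R :=
  match excluded_middle_informative (exists l, has_sum f l) with
  | left h => proj1_sig (constructive_indefinite_description _ h)
  | right _ => 0
  end.

Definition tsumC (I : Type) (f : I -> Cpx) : Cpx :=
  mkC (tsum (fun i => re (f i))) (tsum (fun i => im (f i))).

Record InvSemigroup := {
  carrier :> Type ;
  op : carrier -> carrier -> carrier ;
  op_assoc : forall x y z, op x (op y z) = op (op x y) z ;
  inv_unique : forall s, exists! t, op (op s t) s = s /\ op (op t s) t = t
}.

Section L1.
Variable S : InvSemigroup.

Definition idempotent (e : S) : Prop := op S e e = e.

Definition L := S -> Cpx.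
Definition l1 (f : L) : Prop := summable (fun s => Cnorm (f s)).
Definition norm1 (f : L) : R := tsum (fun s => Cnorm (f s)).

Definition l1E (a : L) : Prop :=
  l1 a /\ forall s, a s <> C0 -> idempotent s.

Definition Ladd (f g : L) : L := fun s => Cadd (f s) (g s).
Definition Lopp (f : L) : L := fun s => Copp (f s).
Definition Lsub (f g : L) : L := Ladd f (Lopp g).
Definition Lscal (c : Cpx) (f : L) : L := fun s => Cmul c (f s).

Definition delta (s : S) : L :=
  fun u => if excluded_middle_informative (u = s) then C1 else C0.

(* continuous bilinear extension of  delta_s , delta_t |-> delta_(m s t) *)
Definition bconv (m : S -> S -> S) (f g : L) : L :=
  fun u => tsumC (fun p : {p : S * S | m (fst p) (snd p) = u} =>
                    Cmul (f (fst (proj1_sig p))) (g (snd (proj1_sig p)))).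

Definition conv (f g : L) : L := bconv (op S) f g.
Definition actEl (alpha a : L) : L := bconv (fun e s => s) alpha a.
Definition actEr (a alpha : L) : L := bconv (op S) a alpha.

Definition Jgen (s e t : S) : L :=
  Lsub (delta (op S (op S s e) t)) (delta (op S s t)).

Definition in_span (g : L) : Prop :=
  exists l : list (Cpx * (S * S * S)),
    (forall x, In x l -> idempotent (snd (fst (snd x)))) /\
    g = fold_right (fun x acc =>
           Ladd (Lscal (fst x) (Jgen (fst (fst (snd x))) (snd (fst (snd x))) (snd (snd x)))) acc)
         (fun _ => C0) l.

Definition inJ (x : L) : Prop :=
  l1 x /\ forall eps, 0 < eps -> exists g, in_span g /\ norm1 (Lsub x g) < eps.

(* nle x r  reads  "||x|| <= r";  mem x  says x is a genuine element;
   eqv is the equality of the space. *)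
Record Lev := {
  T : Type ;
  mem : T -> Prop ;
  eqv : T -> T -> Prop ;
  add : T -> T -> T ;
  opp : T -> T ;
  scal : Cpx -> T -> T ;
  nle : T -> R -> Prop ;
  lS : L -> T -> T ;
  rS : T -> L -> T ;
  lE : L -> T -> T ;
  rE : T -> L -> T
}.

(* level 0 : l^1(S)/J, represented by l^1(S) modulo J with the quotient norm *)
Definition X0 : Lev := {|
  T := L ;
  mem := l1 ;
  eqv := fun x y => inJ (Lsub x y) ;
  add := Ladd ; opp := Lopp ; scal := Lscal ;
  nle := fun x r => forall eps, 0 < eps ->
           exists j, inJ j /\ norm1 (Lsub x j) <= r + eps ;
  lS := fun a x => conv a x ;
  rS := fun x a => conv x a ;
  lE := fun alpha x => actEl alpha x ;
  rE := fun x alpha => actEr x alpha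
|}.

Definition dual (V : Lev) : Lev := {|
  T := T V -> Cpx ;
  mem := fun F =>
    (forall x y, mem V x -> mem V y -> F (add V x y) = Cadd (F x) (F y)) /\
    (forall c x, mem V x -> F (scal V c x) = Cmul c (F x)) /\
    (exists r, forall x s, mem V x -> nle V x s -> Cnorm (F x) <= r * s) ;
  eqv := fun F G => forall x, mem V x -> F x = G x ;
  add := fun F G x => Cadd (F x) (G x) ;
  opp := fun F x => Copp (F x) ;
  scal := fun c F x => Cmul c (F x) ;
  nle := fun F r => forall x s, mem V x -> nle V x s -> Cnorm (F x) <= r * s ;
  lS := fun a F x => F (rS V x a) ;
  rS := fun F a x => F (lS V a x) ;
  lE := fun alpha F x => F (rE V x alpha) ;
  rE := fun F alpha x => F (lE V alpha x)
|}.

Fixpoint dual_iter (n : nat) : Lev :=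
  match n with
  | O => X0
  | Datatypes.S k => dual (dual_iter k)
  end.

Definition Xn (n : nat) : Lev := dual_iter n.

Definition commutative_E (X : Lev) : Prop :=
  forall alpha x, l1E alpha -> mem X x -> eqv X (lE X alpha x) (rE X x alpha).

Definition module_derivation (X : Lev) (D : L -> T X) : Prop :=
  (forall a, l1 a -> mem X (D a)) /\
  (forall a b, l1 a -> l1 b -> eqv X (D (Ladd a b)) (add X (D a) (D b))) /\
  (forall a b, l1 a -> l1 b -> eqv X (D (Lsub a b)) (add X (D a) (opp X (D b)))) /\
  (forall a b, l1 a -> l1 b ->
     eqv X (D (conv a b)) (add X (lS X a (D b)) (rS X (D a) b))) /\
  (forall alpha a, l1E alpha -> l1 a -> eqv X (D (actEl alpha a)) (lE X alpha (D a))) /\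
  (forall alpha a, l1E alpha -> l1 a -> eqv X (D (actEr a alpha)) (rE X (D a) alpha)) /\
  (exists C, forall a, l1 a -> nle X (D a) (C * norm1 a)).

Definition inner_derivation (X : Lev) (D : L -> T X) : Prop :=
  exists Phi, mem X Phi /\
    forall a, l1 a -> eqv X (D a) (add X (lS X a Phi) (opp X (rS X Phi a))).

Definition n_weakly_module_amenable (n : nat) : Prop :=
  commutative_E (Xn n) /\
  forall D : L -> T (Xn n), @module_derivation (Xn n) D -> @inner_derivation (Xn n) D.

End L1.

(* Main.v *)
(* Modulo [J] the idempotents act trivially, so a derivation [D] into the dual of [Y = (l1(S)/J)^(2n-1)] yields
   the bounded cocycle [b_s(y) = D(delta_s)(s* y)] for the action [w -> w(s* . s)], and [D] is inner iff
   [w = w(s* . s) + b_s] has a solution [w]. Level 1 consists of the bounded functions on [S] that are constant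
   modulo idempotents, and each further level is an order dual; hence [Y] is ordered by a cone with the Riesz
   refinement property and an invariant order unit, and its dual is an L-space.

   The fixed point comes from Hilbert space geometry: on an L-space [sqrt ||x - y||] is a Hilbertian metric, for
   which a finitely supported probability [mu] on [S], through the points [b_s], corresponds to the upper level
   sets [xi = mu(b > t)] and the squared distance is the energy [E(mu, nu)]. By the parallelogram law, near
   minimisers of the circumradius [sup_a E(mu, a)] are close to one another in [E]. The mean [W(mu)] of the medians
   of three independent samples is the integral of [3 xi^2 - 2 xi^3], whence
   [|W(mu) - W(nu)| <= eps (E(mu, a) + E(nu, a)) + (9 / 2 eps) E(mu, nu)].
   So [W] converges in norm along near minimisers, and its limit, being canonical, is the fixed point. *)

From Stdlib Require Import Reals List Classical ClassicalEpsilon.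
From Stdlib Require Import Lra Lia FunctionalExtensionality ProofIrrelevance Sorted.
Require Import Defs.
Import ListNotations.
Open Scope R_scope.

(** * Energy and medians of finitely supported measures on the line *)


(** Neither the Hilbert space nor the L-space is built. The inequalities between medians and
    energies are proved for real numbers, with a finite quadrature instead of an integral over
    levels, and then transferred to functionals on the cone: an expression in sums, multiples and
    maxima of functionals is pointwise a difference of two sublinear functions, to each of which a
    supremum over decompositions ([env]) assigns a functional. Riesz refinement makes this
    assignment additive, and it is monotone. Parity enters through the order unit. The bounded
    invariant functions have the constant 1. Over a level with a unit, a positive functional has its
    value at the unit as norm; hence evaluation at the unit is a unit two levels up, and a minimal
    energy can be measured by one number. Modulo idempotents [star s] inverts [s], so the cocycle is
    that of a group action. Complex functionals are split into real and imaginary parts; the factors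
    2 and 4 in norm bounds come from this and from positive and negative parts, and only boundedness
    matters. A derivation is merely additive by definition: its homogeneity is extracted from the
    left action of multiples of [delta_e]. *)

Definition wsum {G : Type} (m : list (R * G)) (f : G -> R) : R :=
  sum_list (map (fun p => fst p * f (snd p)) m).

Definition prob {G : Type} (m : list (R * G)) : Prop :=
  (forall p, In p m -> 0 <= fst p) /\ wsum m (fun _ => 1) = 1.

Lemma wsum_ext_in {G} (m : list (R * G)) f g :
  (forall p, In p m -> f (snd p) = g (snd p)) -> wsum m f = wsum m g.
Proof.
  unfold wsum; induction m as [|p m IH]; simpl; intros H; auto.
  rewrite (H p), IH; auto.
Qed.

Lemma wsum_ext {G} (m : list (R * G)) f g :
  (forall i, f i = g i) -> wsum m f = wsum m g.
Proof. intros H; apply wsum_ext_in; auto. Qed.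

Lemma wsum_add {G} (m : list (R * G)) f g :
  wsum m (fun i => f i + g i) = wsum m f + wsum m g.
Proof. unfold wsum; induction m as [|p m IH]; simpl; [ring | rewrite IH; ring]. Qed.

Lemma wsum_scal {G} (m : list (R * G)) c f :
  wsum m (fun i => c * f i) = c * wsum m f.
Proof. unfold wsum; induction m as [|p m IH]; simpl; [ring | rewrite IH; ring]. Qed.

Lemma wsum_app {G} (m n : list (R * G)) f : wsum (m ++ n) f = wsum m f + wsum n f.
Proof. unfold wsum; induction m as [|p m IH]; simpl; [ring | rewrite IH; ring]. Qed.

Lemma wsum_rescale {G} (m : list (R * G)) c f :
  wsum (map (fun p => (c * fst p, snd p)) m) f = c * wsum m f.
Proof. unfold wsum; induction m as [|p m IH]; simpl; [ring | rewrite IH; ring]. Qed.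

Lemma wsum_map {G H} (m : list (R * G)) (h : G -> H) f :
  wsum (map (fun p => (fst p, h (snd p))) m) f = wsum m (fun i => f (h i)).
Proof. unfold wsum; induction m as [|p m IH]; simpl; [ring | rewrite IH; ring]. Qed.

Lemma wsum_swap {G H} (m : list (R * G)) (n : list (R * H)) f :
  wsum m (fun i => wsum n (fun j => f i j)) = wsum n (fun j => wsum m (fun i => f i j)).
Proof.
  induction m as [|p m IH].
  - rewrite (wsum_ext n (fun j => wsum [] (fun i => f i j)) (fun j => 0 * 0)).
    + rewrite wsum_scal; unfold wsum; simpl; ring.
    + intros; unfold wsum; simpl; ring.
  - change (p :: m) with ([p] ++ m); rewrite wsum_app, IH.
    rewrite (wsum_ext n (fun j => wsum ([p] ++ m) (fun i => f i j))
      (fun j => fst p * f (snd p) j + wsum m (fun i => f i j))).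
    + rewrite wsum_add, wsum_scal. f_equal. unfold wsum; simpl; ring.
    + intros; rewrite wsum_app; unfold wsum at 1; simpl; ring.
Qed.

Lemma wsum_le {G} (m : list (R * G)) f g :
  (forall p, In p m -> 0 <= fst p) -> (forall i, f i <= g i) -> wsum m f <= wsum m g.
Proof.
  unfold wsum; induction m as [|p m IH]; simpl; intros H1 H2; [lra|].
  assert (fst p * f (snd p) <= fst p * g (snd p)) by (apply Rmult_le_compat_l; auto).
  assert (sum_list (map (fun p => fst p * f (snd p)) m) <=
          sum_list (map (fun p => fst p * g (snd p)) m)) by auto.
  lra.
Qed.

Lemma wsum_const {G} (m : list (R * G)) c : prob m -> wsum m (fun _ => c) = c.
Proof.
  intros [_ H]. rewrite (wsum_ext m _ (fun _ => c * 1)) by (intros; ring).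
  rewrite wsum_scal, H; ring.
Qed.

Lemma prob_single {G} (a : G) : prob [(1, a)].
Proof.
  split; [|unfold wsum; simpl; ring].
  intros p [<-|[]]; simpl; lra.
Qed.

Lemma wsum_single {G} (a : G) f : wsum [(1, a)] f = f a.
Proof. unfold wsum; simpl; ring. Qed.

Definition mixture {G : Type} (m n : list (R * G)) : list (R * G) :=
  map (fun p => (1/2 * fst p, snd p)) m ++ map (fun p => (1/2 * fst p, snd p)) n.

Lemma wsum_mixture {G} (m n : list (R * G)) f :
  wsum (mixture m n) f = 1/2 * wsum m f + 1/2 * wsum n f.
Proof. unfold mixture; rewrite wsum_app, !wsum_rescale; reflexivity. Qed.

Lemma prob_mixture {G} (m n : list (R * G)) : prob m -> prob n -> prob (mixture m n).
Proof.
  intros [H1 H2] [H3 H4]; split.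
  - intros p Hp; apply in_app_or in Hp.
    destruct Hp as [Hp|Hp]; apply in_map_iff in Hp; destruct Hp as [q [<- Hq]]; simpl;
      [specialize (H1 q Hq) | specialize (H3 q Hq)]; lra.
  - rewrite wsum_mixture, H2, H4; field.
Qed.

Lemma prob_map {G H} (m : list (R * G)) (h : G -> H) :
  prob m -> prob (map (fun p => (fst p, h (snd p))) m).
Proof.
  intros [H1 H2]; split.
  - intros p Hp; apply in_map_iff in Hp; destruct Hp as [q [<- Hq]]; simpl; auto.
  - rewrite wsum_map; auto.
Qed.

Definition ind (t x : R) : R := if Rlt_dec t x then 1 else 0.

Lemma ind_01 t x : ind t x = 0 \/ ind t x = 1.
Proof. unfold ind; destruct (Rlt_dec t x); auto. Qed.

Lemma sorted_superlist (l : list R) :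
  exists l', StronglySorted Rle l' /\ forall x, In x l -> In x l'.
Proof.
  assert (ins : forall x l, StronglySorted Rle l -> exists l',
     StronglySorted Rle l' /\ forall y, In y l' <-> y = x \/ In y l).
  { intros x l0 Hs; induction Hs as [|a l0 Hs IH Ha].
    - exists [x]; split; [repeat constructor|]. simpl; intuition.
    - destruct IH as [l' [H1 H2]].
      destruct (Rle_dec x a).
      + exists (x :: a :: l0); split.
        * constructor; [constructor; auto|].
          constructor; auto. eapply Forall_impl; [|exact Ha]. simpl; intros; lra.
        * simpl; intuition.
      + exists (a :: l'); split.
        * constructor; auto. apply Forall_forall; intros y Hy.
          apply H2 in Hy; destruct Hy as [->|Hy]; [lra|].
          rewrite Forall_forall in Ha; auto.
        * intros y; simpl; rewrite H2; intuition. }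
  induction l as [|a l [l' [H1 H2]]].
  - exists []; split; [constructor | auto].
  - destruct (ins a l' H1) as [l'' [H3 H4]]; exists l''; split; auto.
    intros x [<-|Hx]; apply H4; auto.
Qed.

(* A discrete stand-in for Lebesgue measure on a half-line: for [x] in [l] the interval [[t0, x)]
   has its true length [x - t0]. *)
Lemma interval_quadrature (l : list R) : exists (t0 : R) (N : list (R * R)),
  (forall p, In p N -> 0 <= fst p) /\
  forall x, In x l -> wsum N (fun t => ind t x) = x - t0.
Proof.
  destruct (sorted_superlist l) as [l' [Hs Hl]].
  (* The induction needs [t0] to be the head of the sorted list and all nodes to lie at or above it,
     so that prepending a point adds just one interval. *)
  enough (exists (t0 : R) (N : list (R * R)),
    (forall p, In p N -> 0 <= fst p /\ t0 <= snd p) /\ (forall x, In x l' -> t0 <= x) /\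
    (forall a l0, l' = a :: l0 -> t0 = a) /\
    forall x, In x l' -> wsum N (fun t => ind t x) = x - t0) as [t0 [N [H1 [_ [_ H2]]]]].
  { exists t0, N; split; [intros p Hp; apply (H1 p Hp) | auto]. }
  clear Hl l; induction Hs as [|a l' Hs IH Ha].
  - exists 0, []; simpl; repeat split; intros; try contradiction; discriminate.
  - destruct IH as [t0 [N [H1 [H2 [H3 H4]]]]].
    destruct l' as [|b l'].
    + exists a, []; simpl; split; [contradiction|]; split; [intuition lra|]; split.
      * intros ? ? E; injection E; auto.
      * intros x [<-|[]]; unfold wsum; simpl; ring.
    + assert (t0 = b) by (apply (H3 b l'); auto); subst t0.
      rewrite Forall_forall in Ha.
      assert (Hab : a <= b) by (apply Ha; left; auto).
      (* The interval from [a] to [b] becomes one node at its left end. As [ind] compares strictly,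
         the node counts for every point beyond [a] but not for [a]. *)
      exists a, ((b - a, a) :: N); split; [|split; [|split]].
      * intros p [<-|Hp]; simpl; [lra|]. destruct (H1 p Hp); lra.
      * intros x [<-|Hx]; [lra | auto].
      * intros ? ? E; injection E; auto.
      * intros x Hx.
        change ((b - a, a) :: N) with ([(b - a, a)] ++ N); rewrite wsum_app.
        assert (E : wsum [(b - a, a)] (fun t => ind t x) = (b - a) * ind a x)
          by (unfold wsum; simpl; ring).
        rewrite E; clear E.
        destruct (classic (In x (b :: l'))) as [Hx'|Hx'].
        -- rewrite H4 by auto. specialize (H2 x Hx').
           unfold ind; destruct (Rlt_dec a x); [ring | assert (a = b) by lra; subst; ring].
        -- destruct Hx as [<-|Hx]; [|contradiction].
           unfold ind at 1; destruct (Rlt_dec a a); [lra|].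
           rewrite (wsum_ext_in N _ (fun _ => 0 * 0)).
           ++ rewrite wsum_scal; ring.
           ++ intros p Hp; destruct (H1 p Hp) as [_ Hp'].
              unfold ind; destruct (Rlt_dec (snd p) a); [lra | ring].
Qed.

(** The three pairwise maxima are the middle value once and the largest twice, so this is the
    median. Only maxima and linear operations occur, which are those that [Ext] carries over to
    functionals. *)
Definition med (x y z : R) : R :=
  Rmax x y + Rmax y z + Rmax x z - 2 * Rmax (Rmax x y) z.

Definition mean_med {G} (m : list (R * G)) (x : G -> R) : R :=
  wsum m (fun i => wsum m (fun j => wsum m (fun k => med (x i) (x j) (x k)))).

Definition mean_dist {G} (m n : list (R * G)) (x : G -> R) : R :=
  wsum m (fun i => wsum n (fun j => Rabs (x i - x j))).

(* The squared distance of the two measures when [R] is embedded isometrically,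
   for the metric [sqrt |x - y|], into a Hilbert space. *)
Definition energy {G} (m n : list (R * G)) (x : G -> R) : R :=
  mean_dist m n x - 1/2 * mean_dist m m x - 1/2 * mean_dist n n x.

(** * Medians and distances as sums over level sets *)

Section Quadrature.
Context {G : Type} (x : G -> R) (N : list (R * R)) (t0 : R) (P : G -> Prop).
Hypothesis HN : forall i, P i -> wsum N (fun t => ind t (x i)) = x i - t0.

Lemma quadrature_Rmax i j : P i -> P j ->
  Rmax (x i) (x j) - t0 =
  wsum N (fun t => ind t (x i) + ind t (x j) + (-1) * (ind t (x i) * ind t (x j))).
Proof.
  intros Hi Hj.
  unfold Rmax; destruct (Rle_dec (x i) (x j));
    [rewrite <- (HN _ Hj) | rewrite <- (HN _ Hi)]; apply wsum_ext; intros t;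
    unfold ind; destruct (Rlt_dec t (x i)), (Rlt_dec t (x j)); lra.
Qed.

Lemma quadrature_dist i j : P i -> P j ->
  Rabs (x i - x j) = wsum N (fun t => (ind t (x i) - ind t (x j)) * (ind t (x i) - ind t (x j))).
Proof.
  intros Hi Hj.
  destruct (Rle_dec (x i) (x j)).
  - rewrite Rabs_left1 by lra.
    replace (- (x i - x j)) with ((x j - t0) + (-1) * (x i - t0)) by ring.
    rewrite <- (HN _ Hj), <- (HN _ Hi), <- wsum_scal, <- wsum_add; apply wsum_ext; intros t.
    unfold ind; destruct (Rlt_dec t (x i)), (Rlt_dec t (x j)); lra.
  - rewrite Rabs_right by lra.
    replace (x i - x j) with ((x i - t0) + (-1) * (x j - t0)) by ring.
    rewrite <- (HN _ Hj), <- (HN _ Hi), <- wsum_scal, <- wsum_add; apply wsum_ext; intros t.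
    unfold ind; destruct (Rlt_dec t (x i)), (Rlt_dec t (x j)); lra.
Qed.

(** The median exceeds a level exactly when at least two of the three values do. *)
Lemma quadrature_med i j k : P i -> P j -> P k ->
  med (x i) (x j) (x k) - t0 =
  wsum N (fun t => ind t (x i) * ind t (x j) + ind t (x j) * ind t (x k) + ind t (x i) * ind t (x k)
     - 2 * (ind t (x i) * ind t (x j) * ind t (x k))).
Proof.
  intros Hi Hj Hk.
  (* The largest value exceeds [t] unless all three fail to, whence the product of complements. *)
  assert (E : Rmax (Rmax (x i) (x j)) (x k) - t0 =
    wsum N (fun t => 1 + (-1) * ((1 - ind t (x i)) * (1 - ind t (x j)) * (1 - ind t (x k))))).
  { unfold Rmax at 2; destruct (Rle_dec (x i) (x j)); rewrite quadrature_Rmax by auto;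
      apply wsum_ext; intros t; unfold ind;
      destruct (Rlt_dec t (x i)), (Rlt_dec t (x j)), (Rlt_dec t (x k)); lra. }
  replace (med (x i) (x j) (x k) - t0) with
    ((Rmax (x i) (x j) - t0) + (Rmax (x j) (x k) - t0) + (Rmax (x i) (x k) - t0)
      + (-2) * (Rmax (Rmax (x i) (x j)) (x k) - t0)) by (unfold med; ring).
  rewrite E, !quadrature_Rmax, <- wsum_scal, <- !wsum_add by auto.
  apply wsum_ext; intros t; ring.
Qed.

Definition tail (m : list (R * G)) (t : R) : R := wsum m (fun i => ind t (x i)).

Lemma tail_bounds m t : prob m -> 0 <= tail m t <= 1.
Proof.
  intros Hm; rewrite <- (wsum_const m 0 Hm), <- (wsum_const m 1 Hm) at 1.
  destruct Hm; split; apply wsum_le; auto; intros i; destruct (ind_01 t (x i)); lra.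
Qed.

Lemma quadrature_mean_med m : prob m -> (forall p, In p m -> P (snd p)) ->
  mean_med m x - t0 = wsum N (fun t => 3 * (tail m t * tail m t) - 2 * (tail m t * tail m t * tail m t)).
Proof.
  intros Hm HP.
  transitivity (wsum m (fun i => wsum m (fun j => wsum m (fun k => med (x i) (x j) (x k) - t0)))).
  { assert (E : forall f, wsum m f - t0 = wsum m (fun i => f i - t0)).
    { intros f; unfold Rminus at 2; rewrite wsum_add, wsum_const by auto; reflexivity. }
    unfold mean_med; rewrite E; apply wsum_ext; intros i.
    rewrite E; apply wsum_ext; intros j; apply E. }
  set (g := fun i j k t => ind t (x i) * ind t (x j) + ind t (x j) * ind t (x k)
     + ind t (x i) * ind t (x k) - 2 * (ind t (x i) * ind t (x j) * ind t (x k))).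
  transitivity (wsum m (fun i => wsum m (fun j => wsum m (fun k => wsum N (g i j k))))).
  { apply wsum_ext_in; intros p1 H1; apply wsum_ext_in; intros p2 H2;
    apply wsum_ext_in; intros p3 H3; apply quadrature_med; auto. }
  transitivity (wsum N (fun t => wsum m (fun i => wsum m (fun j => wsum m (fun k => g i j k t))))).
  { etransitivity; [|apply wsum_swap]; apply wsum_ext; intros i.
    etransitivity; [|apply wsum_swap]; apply wsum_ext; intros j. apply wsum_swap. }
  apply wsum_ext; intros t; unfold g.
  set (T := tail m t).
  (* Each [transitivity] names what is left of the integrand once the later samples are averaged
     out, their indicators being replaced by [T]. *)
  transitivity (wsum m (fun i => (2 * T - 2 * T * T) * ind t (x i) + T * T)).
  2:{ rewrite wsum_add, wsum_scal, wsum_const by auto. fold (tail m t); fold T; ring. }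
  apply wsum_ext; intros i.
  transitivity (wsum m (fun j => (ind t (x i) + T - 2 * T * ind t (x i)) * ind t (x j) + T * ind t (x i))).
  2:{ rewrite wsum_add, wsum_scal, wsum_const by auto. fold (tail m t); fold T; ring. }
  apply wsum_ext; intros j.
  transitivity (wsum m (fun k => (ind t (x j) + ind t (x i) - 2 * ind t (x i) * ind t (x j)) * ind t (x k)
      + ind t (x i) * ind t (x j))).
  { apply wsum_ext; intros; ring. }
  rewrite wsum_add, wsum_scal, wsum_const by auto. fold (tail m t); fold T; ring.
Qed.

Lemma quadrature_mean_dist m n : prob m -> prob n ->
  (forall p, In p m -> P (snd p)) -> (forall p, In p n -> P (snd p)) ->
  mean_dist m n x = wsum N (fun t => tail m t + tail n t - 2 * (tail m t * tail n t)).
Proof.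
  intros Hm Hn HP HQ.
  set (g := fun i j t => (ind t (x i) - ind t (x j)) * (ind t (x i) - ind t (x j))).
  transitivity (wsum m (fun i => wsum n (fun j => wsum N (g i j)))).
  { apply wsum_ext_in; intros p1 H1; apply wsum_ext_in; intros p2 H2; apply quadrature_dist; auto. }
  transitivity (wsum N (fun t => wsum m (fun i => wsum n (fun j => g i j t)))).
  { etransitivity; [|apply wsum_swap]; apply wsum_ext; intros i. apply wsum_swap. }
  apply wsum_ext; intros t; unfold g.
  transitivity (wsum m (fun i => (1 - 2 * tail n t) * ind t (x i) + tail n t)).
  2:{ rewrite wsum_add, wsum_scal, wsum_const by auto. fold (tail m t); ring. }
  apply wsum_ext; intros i.
  transitivity (wsum n (fun j => (1 - 2 * ind t (x i)) * ind t (x j) + ind t (x i))).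
  2:{ rewrite wsum_add, wsum_scal, wsum_const by auto. fold (tail n t); ring. }
  apply wsum_ext; intros j.
  destruct (ind_01 t (x i)) as [-> | ->], (ind_01 t (x j)) as [-> | ->]; ring.
Qed.

(** The terms linear in the tails cancel against the halved self-distances and a perfect square
    remains: the energy is the squared L2 distance of the tail functions. *)
Lemma quadrature_energy m n : prob m -> prob n ->
  (forall p, In p m -> P (snd p)) -> (forall p, In p n -> P (snd p)) ->
  energy m n x = wsum N (fun t => (tail m t - tail n t) * (tail m t - tail n t)).
Proof.
  intros Hm Hn HP HQ; unfold energy.
  rewrite !quadrature_mean_dist by auto.
  set (A := wsum N _); set (B := wsum N _); set (D := wsum N _).
  replace (A - 1/2 * B - 1/2 * D) with (A + ((-1/2) * B + (-1/2) * D)) by field.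
  unfold A, B, D; rewrite <- !wsum_scal, <- !wsum_add.
  apply wsum_ext; intros t; field.
Qed.

End Quadrature.

Lemma quadrature_for {G} (x : G -> R) (l : list G) : exists (t0 : R) (N : list (R * R)),
  (forall p, In p N -> 0 <= fst p) /\
  forall i, In i l -> wsum N (fun t => ind t (x i)) = x i - t0.
Proof.
  destruct (interval_quadrature (map x l)) as [t0 [N [H1 H2]]].
  exists t0, N; split; auto. intros i Hi; apply H2, in_map, Hi.
Qed.

Lemma energy_nonneg {G} (m n : list (R * G)) x : prob m -> prob n -> 0 <= energy m n x.
Proof.
  intros Hm Hn.
  destruct (quadrature_for x (map snd m ++ map snd n)) as [t0 [N [H1 H2]]].
  rewrite (quadrature_energy x N t0 (fun i => In i (map snd m ++ map snd n))); auto;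
    try (intros; apply in_or_app; auto using in_map).
  apply Rle_trans with (wsum N (fun _ => 0 * 0)); [rewrite wsum_scal; lra|].
  apply wsum_le; auto. intros t.
  pose proof (Rle_0_sqr (tail x m t - tail x n t)) as Hsq; unfold Rsqr in Hsq; lra.
Qed.

(* [3 s^2 - 2 s^3] is the probability that the majority of three coins of bias [s] shows heads;
   its derivative vanishes at [0] and [1], whence the factor [|s - o| + |r - o|]. *)
Lemma majority_polynomial_bound s r o eps : 0 <= s <= 1 -> 0 <= r <= 1 -> o = 0 \/ o = 1 -> 0 < eps ->
  Rabs (3 * (s * s) - 2 * (s * s * s) - (3 * (r * r) - 2 * (r * r * r))) <=
  eps * ((s - o) * (s - o) + (r - o) * (r - o)) + 9 / 2 / eps * ((s - r) * (s - r)).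
Proof.
  intros Hs Hr Ho He.
  set (p := Rabs (s - o)); set (q := Rabs (r - o)); set (d := Rabs (s - r)).
  assert (Hp : (s - o) * (s - o) = p * p) by apply (Rsqr_abs (s - o)).
  assert (Hq : (r - o) * (r - o) = q * q) by apply (Rsqr_abs (r - o)).
  assert (Hd : (s - r) * (s - r) = d * d) by apply (Rsqr_abs (s - r)).
  assert (Hp0 : 0 <= p) by apply Rabs_pos.
  assert (Hq0 : 0 <= q) by apply Rabs_pos.
  assert (Hd0 : 0 <= d) by apply Rabs_pos.
  set (F := 3 * (s + r) - 2 * (s * s + s * r + r * r)).
  replace (3 * (s * s) - 2 * (s * s * s) - (3 * (r * r) - 2 * (r * r * r))) with ((s - r) * F)
    by (unfold F; ring).
  rewrite Rabs_mult; fold d.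
  assert (HF : Rabs F <= 3 * (p + q)).
  { assert (0 <= F) by (unfold F; nra). rewrite Rabs_right by lra.
    unfold p, q, F; destruct Ho; subst o.
    - rewrite !Rabs_right by lra; nra.
    - rewrite !Rabs_left1 by lra. nra. }
  rewrite Hp, Hq, Hd.
  apply Rle_trans with (d * (3 * (p + q))); [apply Rmult_le_compat_l; auto|].
  (* This is the square of [eps * a - 3 / 2 * d] being nonnegative. Using it for [p] and for [q]
     doubles [9 / 4] to [9 / 2]. *)
  assert (A : forall a, 0 <= a -> 3 * d * a <= eps * (a * a) + 9 / 4 / eps * (d * d)).
  { intros a Ha.
    apply Rmult_le_reg_l with eps; auto.
    replace (eps * (eps * (a * a) + 9 / 4 / eps * (d * d))) with (eps * eps * (a * a) + 9 / 4 * (d * d))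
      by (field; lra).
    pose proof (Rle_0_sqr (eps * a - 3 / 2 * d)) as Hsq; unfold Rsqr in Hsq; nra. }
  pose proof (A p Hp0); pose proof (A q Hq0).
  replace (9 / 2 / eps * (d * d)) with (9 / 4 / eps * (d * d) + 9 / 4 / eps * (d * d)) by (field; lra).
  lra.
Qed.

(** [majority_polynomial_bound] is summed over the levels, with one quadrature for all points
    involved. The reference point [a] supplies [o], since the tail of a point mass is 0 or 1 at
    every level. *)
Lemma mean_med_close {G} (m n : list (R * G)) (a : G) (x : G -> R) eps :
  prob m -> prob n -> 0 < eps ->
  Rabs (mean_med m x - mean_med n x) <=
  eps * (energy m [(1, a)] x + energy n [(1, a)] x) + 9 / 2 / eps * energy m n x.
Proof.
  intros Hm Hn He.
  set (l := a :: map snd m ++ map snd n).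
  destruct (quadrature_for x l) as [t0 [N [H1 H2]]].
  assert (Pm : forall p, In p m -> In (snd p) l)
    by (intros; right; apply in_or_app; auto using in_map).
  assert (Pn : forall p, In p n -> In (snd p) l)
    by (intros; right; apply in_or_app; auto using in_map).
  assert (Pa : forall p, In p [(1, a)] -> In (snd p) l) by (intros p [<-|[]]; left; auto).
  pose proof (prob_single a) as Ha.
  rewrite !(quadrature_energy x N t0 (fun i => In i l)) by auto.
  replace (mean_med m x - mean_med n x) with ((mean_med m x - t0) + (-1) * (mean_med n x - t0)) by ring.
  rewrite !(quadrature_mean_med x N t0 (fun i => In i l)) by auto.
  rewrite <- !wsum_add, <- !wsum_scal, <- !wsum_add.
  apply Rle_trans with (wsum N (fun t => Rabs (3 * (tail x m t * tail x m t)
     - 2 * (tail x m t * tail x m t * tail x m t) + -1 * (3 * (tail x n t * tail x n t)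
     - 2 * (tail x n t * tail x n t * tail x n t))))).
  - apply Rabs_le; split.
    + apply Ropp_le_cancel; rewrite Ropp_involutive.
      match goal with |- - wsum ?N ?f <= _ => replace (- wsum N f) with ((-1) * wsum N f) by ring end.
      rewrite <- wsum_scal; apply wsum_le; auto. intros t.
      match goal with |- _ <= Rabs ?u => pose proof (Rle_abs (- u)); rewrite Rabs_Ropp in *; lra end.
    + apply wsum_le; auto. intros t; apply Rle_abs.
  - apply wsum_le; auto. intros t.
    assert (Ho : tail x [(1, a)] t = 0 \/ tail x [(1, a)] t = 1)
      by (unfold tail; rewrite wsum_single; apply ind_01).
    pose proof (majority_polynomial_bound (tail x m t) (tail x n t) (tail x [(1, a)] t) eps
      (tail_bounds x m t Hm) (tail_bounds x n t Hn) Ho He) as B.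
    eapply Rle_trans; [|exact B]. right; f_equal; ring.
Qed.

(** * Sublinear functions on a cone with the Riesz refinement property *)


(* [sc c] is only meaningful for [0 <= c]; [bd x c] reads [||x|| <= c]. *)
Record cone := {
  pt : Type ;
  zero : pt ;
  plus : pt -> pt -> pt ;
  sc : R -> pt -> pt ;
  bd : pt -> R -> Prop ;
  plusC : forall x y, plus x y = plus y x ;
  plusA : forall x y z, plus x (plus y z) = plus (plus x y) z ;
  plus0 : forall x, plus zero x = x ;
  rdp : forall a b c d, plus a b = plus c d -> exists e f g h,
    a = plus e f /\ b = plus g h /\ c = plus e g /\ d = plus f h ;
  sc_plus : forall c x y, sc c (plus x y) = plus (sc c x) (sc c y) ;
  sc_sc : forall c d x, 0 <= c -> 0 <= d -> sc c (sc d x) = sc (c * d) x ;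
  sc_1 : forall x, sc 1 x = x ;
  sc_0 : forall x, sc 0 x = zero ;
  bd_mono : forall x y c, bd (plus x y) c -> bd x c ;
  bd_ge0 : forall x c, bd x c -> 0 <= c ;
  bd_ex : forall x, exists c, bd x c
}.
Arguments zero {_}. Arguments plus {_}. Arguments sc {_}. Arguments bd {_}.

Section Cone.
Context {K : cone}.
Implicit Types (x y z : pt K) (l : list (pt K)) (q a f g : pt K -> R).

Definition ksum l : pt K := fold_right plus zero l.
Definition qsum q l : R := sum_list (map q l).

Definition lin_bd a (C : R) : Prop :=
  (forall x y, a (plus x y) = a x + a y) /\
  (forall c x, 0 <= c -> a (sc c x) = c * a x) /\
  0 <= C /\ forall x c, bd x c -> Rabs (a x) <= C * c.

Definition lin a : Prop := exists C, lin_bd a C.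

(** [sub_up] bounds the total over every decomposition of a point and not just the value there; this
    keeps the supremum in [env] finite. [sub_low] is used to bound [env] from below. *)
Record sub q : Prop := {
  sub_plus : forall x y, q (plus x y) <= q x + q y ;
  sub_sc : forall c x, 0 <= c -> q (sc c x) = c * q x ;
  sub_up : exists C, 0 <= C /\ forall l c, bd (ksum l) c -> qsum q l <= C * c ;
  sub_low : exists C, 0 <= C /\ forall x c, bd x c -> - (C * c) <= q x
}.

Lemma sub_zero q : sub q -> q zero = 0.
Proof. intros H; rewrite <- (sc_0 _ zero), (sub_sc q H) by lra; ring. Qed.

Lemma lin_zero a : lin a -> a zero = 0.
Proof. intros [C [_ [H _]]]; rewrite <- (sc_0 _ zero), H by lra; ring. Qed.

Lemma ksum_app l1 l2 : ksum (l1 ++ l2) = plus (ksum l1) (ksum l2).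
Proof.
  induction l1 as [|x l1 IH]; simpl; [rewrite plus0; auto|].
  fold (ksum (l1 ++ l2)); fold (ksum l1); rewrite IH, plusA; auto.
Qed.

Lemma qsum_app q l1 l2 : qsum q (l1 ++ l2) = qsum q l1 + qsum q l2.
Proof. unfold qsum; induction l1 as [|x l1 IH]; simpl; [ring | rewrite IH; ring]. Qed.

Lemma qsum_lin a l : lin a -> qsum a l = a (ksum l).
Proof.
  intros Ha; induction l as [|x l IH]; unfold qsum in *; simpl; [rewrite lin_zero; auto|].
  rewrite IH; destruct Ha as [C [H _]]; rewrite H; auto.
Qed.

Lemma sub_ksum q l : sub q -> q (ksum l) <= qsum q l.
Proof.
  intros Hq; induction l as [|x l IH]; unfold qsum in *; simpl; [rewrite sub_zero; auto; lra|].
  pose proof (sub_plus q Hq x (ksum l)); fold (ksum l); lra.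
Qed.

Lemma qsum_add q q' l : qsum (fun y => q y + q' y) l = qsum q l + qsum q' l.
Proof. unfold qsum; induction l as [|x l IH]; simpl; [ring | rewrite IH; ring]. Qed.

Lemma qsum_scal k q l : qsum (fun y => k * q y) l = k * qsum q l.
Proof. unfold qsum; induction l as [|x l IH]; simpl; [ring | rewrite IH; ring]. Qed.

Lemma qsum_le q q' l : (forall y, q y <= q' y) -> qsum q l <= qsum q' l.
Proof.
  unfold qsum; intros H; induction l as [|x l IH]; simpl; [lra | specialize (H x); lra].
Qed.

Lemma sc_zero c : 0 <= c -> sc c zero = (zero : pt K).
Proof. intros Hc; rewrite <- (sc_0 _ zero), sc_sc by lra; rewrite Rmult_0_r; auto. Qed.

Lemma ksum_sc c l : 0 <= c -> ksum (map (sc c) l) = sc c (ksum l).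
Proof.
  intros Hc; induction l as [|x l IH]; simpl; [rewrite sc_zero; auto|].
  fold (ksum (map (sc c) l)); rewrite IH, sc_plus; auto.
Qed.

Lemma qsum_sc q c l : sub q -> 0 <= c -> qsum q (map (sc c) l) = c * qsum q l.
Proof.
  intros Hq Hc; unfold qsum; induction l as [|x l IH]; simpl; [ring|].
  rewrite IH, sub_sc by auto; ring.
Qed.

(** Riesz refinement cuts each entry of [l] into a part below [y] and a part below [z];
    subadditivity lets the totals only grow. The cut does not depend on [q], which
    [common_refinement] exploits. *)
Lemma split_sum l y z : ksum l = plus y z -> exists l1 l2,
  ksum l1 = y /\ ksum l2 = z /\ forall q, sub q -> qsum q l <= qsum q l1 + qsum q l2.
Proof.
  revert y z; induction l as [|x l IH]; simpl; intros y z E.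
  - exists [y], [z]; simpl; rewrite !(plusC _ _ zero), !plus0; split; [|split]; auto.
    intros q Hq; unfold qsum; simpl.
    pose proof (sub_plus q Hq y z) as H; rewrite <- E, sub_zero in H; auto; lra.
  - fold (ksum l) in E.
    destruct (rdp K _ _ _ _ E) as [e [f [g [h [-> [E2 [-> ->]]]]]]].
    destruct (IH _ _ E2) as [l1 [l2 [<- [<- Hq]]]].
    exists (e :: l1), (f :: l2); split; [|split]; auto.
    intros q Hs; specialize (Hq q Hs); pose proof (sub_plus q Hs e f).
    unfold qsum in *; simpl; lra.
Qed.

(** Cutting [l] along the successive entries of [l'] gives pieces that refine both lists, again for
    all [q] at once. *)
Lemma common_refinement l l' : ksum l = ksum l' -> exists l'', ksum l'' = ksum l /\
  forall q, sub q -> qsum q l <= qsum q l'' /\ qsum q l' <= qsum q l''.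
Proof.
  revert l; induction l' as [|x l' IH]; simpl; intros l E.
  - exists l; split; auto. intros q Hq; split; [lra|].
    pose proof (sub_ksum q l Hq) as H; rewrite E, sub_zero in H; auto.
  - fold (ksum l') in E.
    destruct (split_sum _ _ _ E) as [l1 [l2 [E1 [E2 H]]]].
    destruct (IH l2 E2) as [m [Em Hm]].
    exists (l1 ++ m); split; [rewrite ksum_app, E1, Em, E2; auto|].
    intros q Hq; rewrite qsum_app.
    specialize (H q Hq); destruct (Hm q Hq).
    pose proof (sub_ksum q l1 Hq) as H3; rewrite E1 in H3.
    split; [lra|]. unfold qsum at 1; simpl; fold (qsum q l'); lra.
Qed.

(** The Riesz-Kantorovich supremum over all decompositions of [y]: the least additive function above
    [q]. If [q] is a maximum of functionals, this is their join in the dual lattice. *)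
Definition env q y : R :=
  epsilon (inhabits 0) (is_lub (fun r => exists l, ksum l = y /\ r = qsum q l)).

Lemma env_lub q y : sub q -> is_lub (fun r => exists l, ksum l = y /\ r = qsum q l) (env q y).
Proof.
  intros Hq; unfold env; apply epsilon_spec.
  destruct (sub_up q Hq) as [C [_ HC]]; destruct (bd_ex K y) as [c Hc].
  edestruct (completeness (fun r => exists l, ksum l = y /\ r = qsum q l)) as [m Hm].
  - exists (C * c); intros r [l [<- ->]]; auto.
  - exists (qsum q [y]), [y]; split; auto. simpl; rewrite plusC, plus0; auto.
  - exists m; auto.
Qed.

Lemma env_ge q l : sub q -> qsum q l <= env q (ksum l).
Proof. intros Hq; apply (env_lub q (ksum l) Hq); exists l; auto. Qed.

Lemma env_le q y M : sub q -> (forall l, ksum l = y -> qsum q l <= M) -> env q y <= M.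
Proof. intros Hq H; apply (env_lub q y Hq); intros r [l [E ->]]; auto. Qed.

Lemma env_approx q y eps : sub q -> 0 < eps -> exists l, ksum l = y /\ env q y - eps < qsum q l.
Proof.
  intros Hq He; apply NNPP; intros H.
  assert (env q y <= env q y - eps); [|lra].
  apply env_le; auto. intros l E; apply Rnot_lt_le; intros H'; apply H; exists l; auto.
Qed.

Lemma env_plus q x y : sub q -> env q (plus x y) = env q x + env q y.
Proof.
  intros Hq; apply Rle_antisym.
  - apply env_le; auto. intros l E; destruct (split_sum _ _ _ E) as [l1 [l2 [<- [<- H]]]].
    specialize (H q Hq); pose proof (env_ge q l1 Hq); pose proof (env_ge q l2 Hq); lra.
  - apply le_epsilon; intros eps He.
    destruct (env_approx q x (eps / 2) Hq) as [l1 [<- H1]]; [lra|].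
    destruct (env_approx q y (eps / 2) Hq) as [l2 [<- H2]]; [lra|].
    rewrite <- ksum_app; pose proof (env_ge q (l1 ++ l2) Hq) as H; rewrite qsum_app in H; lra.
Qed.

(** For the lower bound, nearly optimal decompositions for [q] and for [q'] are replaced by a common
    refinement, good for both. This is where additivity of the functional calculus comes from. *)
Lemma env_add q q' y : sub q -> sub q' -> sub (fun y => q y + q' y) ->
  env (fun y => q y + q' y) y = env q y + env q' y.
Proof.
  intros Hq Hq' Hs; apply Rle_antisym.
  - apply env_le; auto. intros l <-; rewrite qsum_add.
    pose proof (env_ge q l Hq); pose proof (env_ge q' l Hq'); lra.
  - apply le_epsilon; intros eps He.
    destruct (env_approx q y (eps / 2) Hq) as [l1 [E1 H1]]; [lra|].
    destruct (env_approx q' y (eps / 2) Hq') as [l2 [E2 H2]]; [lra|].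
    destruct (common_refinement l1 l2) as [l [E H]]; [congruence|].
    rewrite <- E1, <- E in *; pose proof (env_ge _ l Hs) as H3; rewrite qsum_add in H3.
    pose proof (H q Hq); pose proof (H q' Hq'); lra.
Qed.

Lemma env_mono q q' y : sub q -> sub q' -> (forall y, q y <= q' y) -> env q y <= env q' y.
Proof.
  intros Hq Hq' H; apply env_le; auto. intros l <-.
  eapply Rle_trans; [apply qsum_le, H | apply env_ge; auto].
Qed.

Lemma env_scal k q y : 0 <= k -> sub q -> sub (fun y => k * q y) ->
  env (fun y => k * q y) y = k * env q y.
Proof.
  intros Hk Hq Hs; apply Rle_antisym.
  - apply env_le; auto; intros l <-; rewrite qsum_scal.
    apply Rmult_le_compat_l; auto using env_ge.
  - destruct (Req_dec k 0) as [->|Hk0].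
    + rewrite Rmult_0_l. pose proof (env_ge _ [y] Hs) as H.
      unfold qsum in H; simpl in H; rewrite plusC, plus0 in H; lra.
    + assert (Hk1 : 0 < k) by lra.
      apply Rmult_le_reg_l with (/ k); [apply Rinv_0_lt_compat; auto|].
      rewrite <- Rmult_assoc, Rinv_l, Rmult_1_l by auto.
      apply env_le; auto; intros l <-.
      pose proof (env_ge _ l Hs) as H; rewrite qsum_scal in H.
      apply Rmult_le_reg_l with k; auto. rewrite <- Rmult_assoc, Rinv_r, Rmult_1_l; auto.
Qed.

Lemma env_sc q c y : sub q -> 0 <= c -> env q (sc c y) = c * env q y.
Proof.
  intros Hq Hc.
  assert (G : forall k x, 0 < k -> k * env q x <= env q (sc k x)).
  { intros k x Hk.
    apply Rmult_le_reg_l with (/ k); [apply Rinv_0_lt_compat; auto|].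
    rewrite <- Rmult_assoc, Rinv_l, Rmult_1_l by lra.
    apply env_le; auto; intros l <-.
    pose proof (env_ge q (map (sc k) l) Hq) as H; rewrite ksum_sc, qsum_sc in H by (auto; lra).
    apply Rmult_le_reg_l with k; auto. rewrite <- Rmult_assoc, Rinv_r, Rmult_1_l by lra; auto. }
  destruct (Req_dec c 0) as [->|Hc0].
  - rewrite sc_0, Rmult_0_l.
    pose proof (env_plus q zero zero Hq) as H; rewrite plus0 in H; lra.
  - apply Rle_antisym; [|apply G; lra].
    pose proof (G (/ c) (sc c y)) as H.
    rewrite sc_sc, Rinv_l, sc_1 in H by (auto; left; apply Rinv_0_lt_compat; lra).
    specialize (H (Rinv_0_lt_compat c ltac:(lra))).
    apply Rmult_le_reg_l with (/ c); [apply Rinv_0_lt_compat; lra|].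
    rewrite <- Rmult_assoc, Rinv_l, Rmult_1_l by auto; auto.
Qed.

Lemma lin_env q : sub q -> lin (env q).
Proof.
  intros Hq.
  destruct (sub_up q Hq) as [C [HC0 HC]]; destruct (sub_low q Hq) as [D [HD0 HD]].
  exists (C + D); repeat split.
  - intros; apply env_plus; auto.
  - intros; apply env_sc; auto.
  - lra.
  - intros x c Hc; pose proof (bd_ge0 K x c Hc).
    assert (env q x <= C * c) by (apply env_le; auto; intros l <-; auto).
    pose proof (env_ge q [x] Hq) as H1; unfold qsum in H1; simpl in H1; rewrite plusC, plus0 in H1.
    specialize (HD x c Hc). apply Rabs_le; split; nra.
Qed.

Lemma lin_opp a : lin a -> lin (fun y => - a y).
Proof.
  intros [C [H1 [H2 [H3 H4]]]]; exists C; repeat split; auto.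
  - intros; rewrite H1; ring.
  - intros; rewrite H2 by auto; ring.
  - intros; rewrite Rabs_Ropp; auto.
Qed.

Lemma lin_sub a : lin a -> sub a.
Proof.
  intros Ha; pose proof Ha as [C [H1 [H2 [H3 H4]]]]; split.
  - intros; rewrite H1; lra.
  - auto.
  - exists C; split; auto. intros l c Hc; rewrite qsum_lin by auto.
    eapply Rle_trans; [apply Rle_abs | auto].
  - exists C; split; auto. intros x c Hc; specialize (H4 x c Hc).
    pose proof (Rle_abs (- a x)); rewrite Rabs_Ropp in *; lra.
Qed.

Lemma env_lin a y : lin a -> env a y = a y.
Proof.
  intros Ha; pose proof (lin_sub a Ha) as Hs; apply Rle_antisym.
  - apply env_le; auto; intros l <-; rewrite qsum_lin; auto; lra.
  - pose proof (env_ge a [y] Hs) as H; unfold qsum in H; simpl in H; rewrite plusC, plus0 in H; lra.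
Qed.

Lemma sub_add q q' : sub q -> sub q' -> sub (fun y => q y + q' y).
Proof.
  intros H H'; split.
  - intros x y; pose proof (sub_plus q H x y); pose proof (sub_plus q' H' x y); lra.
  - intros c x Hc; rewrite (sub_sc q), (sub_sc q') by auto; ring.
  - destruct (sub_up q H) as [C [H1 H2]]; destruct (sub_up q' H') as [D [H3 H4]].
    exists (C + D); split; [lra|]. intros l c Hc; rewrite qsum_add.
    specialize (H2 l c Hc); specialize (H4 l c Hc); lra.
  - destruct (sub_low q H) as [C [H1 H2]]; destruct (sub_low q' H') as [D [H3 H4]].
    exists (C + D); split; [lra|]. intros x c Hc.
    specialize (H2 x c Hc); specialize (H4 x c Hc); lra.
Qed.

Lemma sub_scal k q : 0 <= k -> sub q -> sub (fun y => k * q y).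
Proof.
  intros Hk H; split.
  - intros x y; rewrite <- Rmult_plus_distr_l; apply Rmult_le_compat_l; auto using sub_plus.
  - intros c x Hc; rewrite (sub_sc q) by auto; ring.
  - destruct (sub_up q H) as [C [H1 H2]]; exists (k * C); split; [nra|].
    intros l c Hc; rewrite qsum_scal, Rmult_assoc; apply Rmult_le_compat_l; auto.
  - destruct (sub_low q H) as [C [H1 H2]]; exists (k * C); split; [nra|].
    intros x c Hc; specialize (H2 x c Hc); nra.
Qed.

(* Separate the pieces on which each of the two functions is the larger. *)
Lemma qsum_max_split q q' l : exists l1 l2, ksum l = plus (ksum l1) (ksum l2) /\
  qsum (fun y => Rmax (q y) (q' y)) l = qsum q l1 + qsum q' l2.
Proof.
  induction l as [|x l [l1 [l2 [E1 E2]]]].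
  - exists [], []; split; simpl; [rewrite plus0; auto | unfold qsum; simpl; ring].
  - change (qsum (fun y => Rmax (q y) (q' y)) (x :: l))
      with (Rmax (q x) (q' x) + qsum (fun y => Rmax (q y) (q' y)) l).
    change (ksum (x :: l)) with (plus x (ksum l)).
    rewrite E1, E2; unfold Rmax; destruct (Rle_dec (q x) (q' x)).
    + exists l1, (x :: l2); split; [|unfold qsum; simpl; ring].
      simpl; fold (ksum l2). rewrite (plusA _ x), (plusC _ x), <- plusA; auto.
    + exists (x :: l1), l2; split; [|unfold qsum; simpl; ring].
      simpl; fold (ksum l1); rewrite plusA; auto.
Qed.

(** Only the bound over decompositions needs an argument: the pieces where [q] wins and those where
    [q'] wins each sum to something below the whole, so [bd_mono] applies to both. *)
Lemma sub_max q q' : sub q -> sub q' -> sub (fun y => Rmax (q y) (q' y)).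
Proof.
  intros H H'; split.
  - intros x y; pose proof (sub_plus q H x y); pose proof (sub_plus q' H' x y).
    pose proof (Rmax_l (q x) (q' x)); pose proof (Rmax_r (q x) (q' x)).
    pose proof (Rmax_l (q y) (q' y)); pose proof (Rmax_r (q y) (q' y)).
    apply Rmax_lub; lra.
  - intros c x Hc; rewrite (sub_sc q), (sub_sc q') by auto. rewrite RmaxRmult; auto.
  - destruct (sub_up q H) as [C [H1 H2]]; destruct (sub_up q' H') as [D [H3 H4]].
    exists (C + D); split; [lra|]. intros l c Hc.
    destruct (qsum_max_split q q' l) as [l1 [l2 [E1 ->]]]; rewrite E1 in Hc.
    assert (qsum q l1 <= C * c) by (apply H2; eapply bd_mono; eauto).
    assert (qsum q' l2 <= D * c) by (apply H4; rewrite plusC in Hc; eapply bd_mono; eauto).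
    lra.
  - destruct (sub_low q H) as [C [H1 H2]]; exists C; split; auto.
    intros x c Hc; eapply Rle_trans; [apply (H2 x c Hc) | apply Rmax_l].
Qed.

(* Lattice expressions in functionals: if [f y] is such an expression in the values [a1 y, .., an y], then
   [g] is the same expression evaluated in the vector lattice of functionals. *)
Definition Ext f g : Prop := exists q1 q2, sub q1 /\ sub q2 /\
  (forall y, f y = q1 y - q2 y) /\ forall y, g y = env q1 y - env q2 y.

(** The transfer principle: an inequality checked on real values holds between functionals. Moving
    the subtracted terms across turns it into one between sums of sublinear functions, where [env]
    is monotone and additive. *)
Lemma Ext_mono f g f' g' : Ext f g -> Ext f' g' -> (forall y, f y <= f' y) -> forall y, g y <= g' y.
Proof.
  intros [q1 [q2 [H1 [H2 [H3 H4]]]]] [r1 [r2 [I1 [I2 [I3 I4]]]]] H y.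
  rewrite H4, I4.
  pose proof (env_mono _ _ y (sub_add _ _ H1 I2) (sub_add _ _ I1 H2)) as M.
  rewrite !env_add in M by auto using sub_add.
  enough (env q1 y + env r2 y <= env r1 y + env q2 y) by lra.
  apply M; intros z; specialize (H z); rewrite H3, I3 in H; lra.
Qed.

Lemma Ext_unique f g f' g' : Ext f g -> Ext f' g' -> (forall y, f y = f' y) -> forall y, g y = g' y.
Proof.
  intros H H' E y; apply Rle_antisym; eapply Ext_mono; eauto; intros; rewrite E; lra.
Qed.

Lemma Ext_add f g f' g' : Ext f g -> Ext f' g' -> Ext (fun y => f y + f' y) (fun y => g y + g' y).
Proof.
  intros [q1 [q2 [H1 [H2 [H3 H4]]]]] [r1 [r2 [I1 [I2 [I3 I4]]]]].
  exists (fun y => q1 y + r1 y), (fun y => q2 y + r2 y).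
  split; [|split; [|split]]; auto using sub_add; intros y.
  - rewrite H3, I3; ring.
  - rewrite !env_add, H4, I4 by auto using sub_add; ring.
Qed.

Lemma Ext_scal c f g : Ext f g -> Ext (fun y => c * f y) (fun y => c * g y).
Proof.
  intros [q1 [q2 [H1 [H2 [H3 H4]]]]]; destruct (Rle_dec 0 c) as [Hc|Hc].
  - exists (fun y => c * q1 y), (fun y => c * q2 y).
    split; [|split; [|split]]; auto using sub_scal; intros y.
    + rewrite H3; ring.
    + rewrite !env_scal, H4 by auto using sub_scal; ring.
  - assert (Hc' : 0 <= - c) by lra.
    exists (fun y => (- c) * q2 y), (fun y => (- c) * q1 y).
    split; [|split; [|split]]; auto using sub_scal; intros y.
    + rewrite H3; ring.
    + rewrite !env_scal, H4 by auto using sub_scal; ring.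
Qed.

Lemma lin_0 : lin (fun _ => 0).
Proof.
  exists 0; repeat split; intros; try ring; try lra.
  rewrite Rabs_R0; lra.
Qed.

Lemma Ext_lin a : lin a -> Ext a a.
Proof.
  intros Ha; exists a, (fun _ => 0); split; [|split; [|split]]; auto using lin_sub, lin_0.
  - intros; ring.
  - intros; rewrite !env_lin by auto using lin_0; ring.
Qed.

(** Bringing both differences to the common subtrahend [q2 + r2] leaves a maximum of sublinear
    functions, so differences of sublinear functions are closed under maxima. *)
Lemma Ext_max f g f' g' : Ext f g -> Ext f' g' -> exists h, Ext (fun y => Rmax (f y) (f' y)) h.
Proof.
  intros [q1 [q2 [H1 [H2 [H3 H4]]]]] [r1 [r2 [I1 [I2 [I3 I4]]]]].
  eexists; exists (fun y => Rmax (q1 y + r2 y) (r1 y + q2 y)), (fun y => q2 y + r2 y).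
  split; [|split; [|split; [|reflexivity]]]; auto using sub_add, sub_max; intros y.
  rewrite H3, I3; unfold Rmax.
  destruct (Rle_dec (q1 y - q2 y) (r1 y - r2 y)), (Rle_dec (q1 y + r2 y) (r1 y + q2 y)); lra.
Qed.

Lemma lin_add a a' : lin a -> lin a' -> lin (fun y => a y + a' y).
Proof.
  intros [C [H1 [H2 [H3 H4]]]] [D [I1 [I2 [I3 I4]]]]; exists (C + D); repeat split.
  - intros; rewrite H1, I1; ring.
  - intros; rewrite H2, I2 by auto; ring.
  - lra.
  - intros x c Hc; specialize (H4 x c Hc); specialize (I4 x c Hc).
    eapply Rle_trans; [apply Rabs_triang | lra].
Qed.

Lemma lin_scal k a : lin a -> lin (fun y => k * a y).
Proof.
  intros [C [H1 [H2 [H3 H4]]]]; exists (Rabs k * C); repeat split.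
  - intros; rewrite H1; ring.
  - intros; rewrite H2 by auto; ring.
  - pose proof (Rabs_pos k); nra.
  - intros x c Hc; rewrite Rabs_mult, Rmult_assoc; apply Rmult_le_compat_l; auto using Rabs_pos.
Qed.

Lemma lin_ext a a' : lin a -> (forall y, a y = a' y) -> lin a'.
Proof. intros H E; assert (a = a') as <- by (apply functional_extensionality; auto); auto. Qed.

Lemma Ext_is_lin f g : Ext f g -> lin g.
Proof.
  intros [q1 [q2 [H1 [H2 [_ H4]]]]].
  apply (lin_ext (fun y => env q1 y + - env q2 y)); [|intros; rewrite H4; ring].
  apply lin_add; [|apply lin_opp]; apply lin_env; auto.
Qed.

(** Differences of sublinear functions, a homogeneous form of differences of convex functions; [ext]
    is the resulting lattice functional calculus. *)
Definition dc f : Prop := exists g, Ext f g.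
Definition ext f : pt K -> R := epsilon (inhabits (fun _ => 0)) (Ext f).

Lemma ext_spec f : dc f -> Ext f (ext f).
Proof. intros [g H]; unfold ext; apply epsilon_spec; exists g; auto. Qed.

Lemma ext_eq f g y : Ext f g -> ext f y = g y.
Proof. intros H; eapply Ext_unique; [apply ext_spec; exists g | apply H |]; auto. Qed.

Lemma ext_le f g y : dc f -> dc g -> (forall y, f y <= g y) -> ext f y <= ext g y.
Proof. intros Hf Hg H; eapply Ext_mono; [apply ext_spec, Hf | apply ext_spec, Hg | auto]. Qed.

Lemma dc_lin a : lin a -> dc a.
Proof. intros H; exists a; apply Ext_lin; auto. Qed.

Lemma ext_lin a y : lin a -> ext a y = a y.
Proof. intros H; apply ext_eq, Ext_lin, H. Qed.

Lemma dc_add f g : dc f -> dc g -> dc (fun y => f y + g y).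
Proof. intros [f' Hf] [g' Hg]; eexists; apply Ext_add; eauto. Qed.

Lemma ext_add f g y : dc f -> dc g -> ext (fun y => f y + g y) y = ext f y + ext g y.
Proof. intros Hf Hg; apply (ext_eq _ (fun y => ext f y + ext g y)), Ext_add; apply ext_spec; auto. Qed.

Lemma dc_scal c f : dc f -> dc (fun y => c * f y).
Proof. intros [g H]; eexists; apply Ext_scal; eauto. Qed.

Lemma ext_scal c f y : dc f -> ext (fun y => c * f y) y = c * ext f y.
Proof. intros Hf; apply (ext_eq _ (fun y => c * ext f y)), Ext_scal, ext_spec, Hf. Qed.

Lemma dc_max f g : dc f -> dc g -> dc (fun y => Rmax (f y) (g y)).
Proof. intros [f' Hf] [g' Hg]; eapply Ext_max; eauto. Qed.

Lemma dc_ext f g : dc f -> (forall y, f y = g y) -> dc g.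
Proof. intros H E; assert (f = g) as <- by (apply functional_extensionality; auto); auto. Qed.

Lemma dc_abs f : dc f -> dc (fun y => Rabs (f y)).
Proof.
  intros Hf; apply (dc_ext (fun y => Rmax (f y) (-1 * f y))); [apply dc_max; auto using dc_scal|].
  intros y; unfold Rmax, Rabs; destruct (Rle_dec (f y) (-1 * f y)), (Rcase_abs (f y)); lra.
Qed.

Lemma dc_wsum {G} (m : list (R * G)) (F : G -> pt K -> R) :
  (forall i, dc (F i)) -> dc (fun y => wsum m (fun i => F i y)).
Proof.
  intros H; induction m as [|p m IH]; [apply dc_lin, lin_0|].
  apply (dc_add (fun y => fst p * F (snd p) y)); auto using dc_scal.
Qed.

Definition kmap (phi : pt K -> pt K) : Prop :=
  (forall x y, phi (plus x y) = plus (phi x) (phi y)) /\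
  (forall c x, phi (sc c x) = sc c (phi x)) /\
  (forall x c, bd x c -> bd (phi x) c).

Lemma ksum_map phi l : kmap phi -> ksum (map phi l) = phi (ksum l).
Proof.
  intros [H1 [H2 _]]; induction l as [|x l IH]; simpl.
  - transitivity (phi (sc 0 zero)); [rewrite H2|]; rewrite sc_0; auto.
  - fold (ksum (map phi l)); rewrite IH, H1; auto.
Qed.

Lemma qsum_map q phi l : qsum q (map phi l) = qsum (fun y => q (phi y)) l.
Proof. unfold qsum; rewrite map_map; auto. Qed.

Lemma sub_comp q phi : sub q -> kmap phi -> sub (fun y => q (phi y)).
Proof.
  intros H Hphi; pose proof Hphi as [P1 [P2 P3]]; split.
  - intros; rewrite P1; apply sub_plus; auto.
  - intros; rewrite P2; apply sub_sc; auto.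
  - destruct (sub_up q H) as [C [H1 H2]]; exists C; split; auto.
    intros l c Hc; rewrite <- qsum_map; apply H2; rewrite ksum_map by auto; auto.
  - destruct (sub_low q H) as [C [H1 H2]]; exists C; split; auto.
Qed.

(** An automorphism of the cone matches the decompositions of [y] with those of [phi y]; the inverse
    [psi] carries the latter back. *)
Lemma env_comp q phi psi y : sub q -> kmap phi -> kmap psi ->
  (forall y, phi (psi y) = y) -> (forall y, psi (phi y) = y) ->
  env (fun y => q (phi y)) y = env q (phi y).
Proof.
  intros Hq Hphi Hpsi E1 E2; pose proof (sub_comp q phi Hq Hphi) as Hs; apply Rle_antisym.
  - apply env_le; auto; intros l <-; rewrite <- qsum_map, <- ksum_map by auto; apply env_ge; auto.
  - apply env_le; auto; intros l E.
    pose proof (env_ge _ (map psi l) Hs) as H.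
    rewrite ksum_map, E, E2, qsum_map in H by auto.
    eapply Rle_trans; [|exact H]. apply qsum_le; intros; rewrite E1; lra.
Qed.

Lemma Ext_comp f g phi psi : Ext f g -> kmap phi -> kmap psi ->
  (forall y, phi (psi y) = y) -> (forall y, psi (phi y) = y) ->
  Ext (fun y => f (phi y)) (fun y => g (phi y)).
Proof.
  intros [q1 [q2 [H1 [H2 [H3 H4]]]]] Hphi Hpsi E1 E2.
  exists (fun y => q1 (phi y)), (fun y => q2 (phi y)).
  split; [|split; [|split]]; auto using sub_comp. intros y.
  rewrite !(env_comp _ phi psi) by auto; auto.
Qed.

End Cone.

(** * Bounded cocycles have a fixed point *)


Lemma med_shift a b c t : med (a + t) (b + t) (c + t) = med a b c + t.
Proof. unfold med, Rmax; repeat destruct Rle_dec; lra. Qed.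

Lemma mean_med_shift {G} (m : list (R * G)) x t : prob m ->
  mean_med m (fun i => x i + t) = mean_med m x + t.
Proof.
  intros Hm; unfold mean_med.
  assert (E : forall f, wsum m f + t = wsum m (fun i => f i + t))
    by (intros f; rewrite wsum_add, wsum_const by auto; reflexivity).
  rewrite E; apply wsum_ext; intros i; rewrite E; apply wsum_ext; intros j.
  rewrite E; apply wsum_ext; intros k; apply med_shift.
Qed.

Lemma mean_dist_shift {G} (m n : list (R * G)) x t :
  mean_dist m n (fun i => x i + t) = mean_dist m n x.
Proof.
  unfold mean_dist; apply wsum_ext; intros i; apply wsum_ext; intros j; f_equal; ring.
Qed.

Definition push {G H : Type} (h : G -> H) (m : list (R * G)) : list (R * H) :=
  map (fun p => (fst p, h (snd p))) m.

Lemma mean_med_push {G H} (h : G -> H) m x : mean_med (push h m) x = mean_med m (fun i => x (h i)).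
Proof.
  unfold mean_med, push; rewrite wsum_map; apply wsum_ext; intros i.
  rewrite wsum_map; apply wsum_ext; intros j.
  exact (wsum_map m h (fun k => med (x (h i)) (x (h j)) (x k))).
Qed.

Lemma mean_dist_push {G H} (h : G -> H) m n x :
  mean_dist (push h m) (push h n) x = mean_dist m n (fun i => x (h i)).
Proof.
  unfold mean_dist, push; rewrite wsum_map; apply wsum_ext; intros i.
  exact (wsum_map n h (fun j => Rabs (x (h i) - x j))).
Qed.

Lemma mean_dist_mixture_l {G} (m n p : list (R * G)) x :
  mean_dist (mixture m n) p x = 1/2 * mean_dist m p x + 1/2 * mean_dist n p x.
Proof. apply wsum_mixture. Qed.

Lemma mean_dist_sym {G} (m n : list (R * G)) x : mean_dist m n x = mean_dist n m x.
Proof.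
  unfold mean_dist; rewrite wsum_swap; apply wsum_ext; intros i; apply wsum_ext; intros j.
  apply Rabs_minus_sym.
Qed.

(** The mixture is the midpoint of [m] and [n] in the Hilbert picture. Here the identity is plain
    algebra, because [mean_dist] is symmetric and respects mixtures in each argument. *)
Lemma energy_parallelogram {G} (m n p : list (R * G)) x :
  energy (mixture m n) p x = 1/2 * energy m p x + 1/2 * energy n p x - 1/4 * energy m n x.
Proof.
  unfold energy; rewrite !mean_dist_mixture_l, !(mean_dist_sym _ (mixture m n)),
    !mean_dist_mixture_l, (mean_dist_sym n m); field.
Qed.

Lemma energy_single {G} (g a : G) x : energy [(1, g)] [(1, a)] x = Rabs (x g - x a).
Proof.
  unfold energy, mean_dist; rewrite !wsum_single, !Rminus_diag, Rabs_R0; ring.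
Qed.

Lemma eq_of_close x y : (forall eta, 0 < eta -> Rabs (x - y) <= eta) -> x = y.
Proof.
  intros H; apply NNPP; intros Hn.
  assert (0 < Rabs (x - y)) by (apply Rabs_pos_lt; lra).
  specialize (H (Rabs (x - y) / 2)); lra.
Qed.

Section FixedPoint.
Context {K : cone} {G : Type} (gop : G -> G -> G) (b : G -> pt K -> R)
  (al al' : G -> pt K -> pt K) (u : pt K) (C : R) (g0 : G).
Hypothesis b_bd : forall g, lin_bd (b g) C.
Hypothesis al_kmap : forall g, kmap (al g).
Hypothesis al'_kmap : forall g, kmap (al' g).
Hypothesis alK : forall g y, al g (al' g y) = y.
Hypothesis al'K : forall g y, al' g (al g y) = y.
Hypothesis al_unit : forall g, al g u = u.
Hypothesis b_cocycle : forall g s y, b (gop g s) y = b s (al g y) + b g y.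
Hypothesis b_onto : forall g a, exists a', forall y, b a y = b (gop g a') y.
Hypothesis unit_bd : bd u 1.
Hypothesis order_unit : forall y c, bd y c -> exists z, plus y z = sc c u.

Let b_lin g : lin (b g).
Proof. exists C; auto. Qed.

Definition medians (m : list (R * G)) (y : pt K) : R := mean_med m (fun s => b s y).
Definition energies (m n : list (R * G)) (y : pt K) : R := energy m n (fun s => b s y).
Definition center (m : list (R * G)) : pt K -> R := ext (medians m).
(** The functional [ext (energies m n)] is positive for probabilities, so its value at the order
    unit is its norm: one number that controls it on the whole cone. *)
Definition dist2 (m n : list (R * G)) : R := ext (energies m n) u.

Lemma dc_medians m : dc (medians m).
Proof.
  unfold medians, mean_med.
  apply (dc_wsum m (fun i y => wsum m (fun j => wsum m (fun k => med (b i y) (b j y) (b k y))))); intros i.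
  apply (dc_wsum m (fun j y => wsum m (fun k => med (b i y) (b j y) (b k y)))); intros j.
  apply (dc_wsum m (fun k y => med (b i y) (b j y) (b k y))); intros k.
  apply (dc_ext (fun y => Rmax (b i y) (b j y) + Rmax (b j y) (b k y) + Rmax (b i y) (b k y)
    + (-2) * Rmax (Rmax (b i y) (b j y)) (b k y))).
  - repeat apply dc_add; try apply (dc_scal (-2)); repeat apply dc_max; auto using dc_lin.
  - intros y; unfold med; ring.
Qed.

Lemma dc_mean_dist m n : dc (fun y => mean_dist m n (fun s => b s y)).
Proof.
  apply (dc_wsum m (fun i y => wsum n (fun j => Rabs (b i y - b j y)))); intros i.
  apply (dc_wsum n (fun j y => Rabs (b i y - b j y))); intros j.
  apply dc_abs; apply (dc_ext (fun y => b i y + (-1) * b j y)); [|intros; ring].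
  apply dc_add; [|apply dc_scal]; auto using dc_lin.
Qed.

Lemma dc_energies m n : dc (energies m n).
Proof.
  apply (dc_ext (fun y => mean_dist m n (fun s => b s y) + ((-1/2) * mean_dist m m (fun s => b s y)
    + (-1/2) * mean_dist n n (fun s => b s y)))).
  - repeat apply dc_add; try apply dc_scal; apply dc_mean_dist.
  - intros y; unfold energies, energy; field.
Qed.

(** Complete [y] to [c] times the unit; the positive functional [ext f] loses nothing on the
    complement. *)
Lemma ext_unit_le f y c : dc f -> (forall y, 0 <= f y) -> bd y c -> ext f y <= c * ext f u.
Proof.
  intros Hf H0 Hy; destruct (order_unit y c Hy) as [z Hz].
  destruct (Ext_is_lin _ _ (ext_spec f Hf)) as [D [H1 [H2 _]]].
  rewrite <- H2, <- Hz, H1 by (eapply bd_ge0; eauto).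
  assert (0 <= ext f z); [|lra].
  rewrite <- (ext_lin (fun _ => 0) z) by apply lin_0.
  apply ext_le; auto using dc_lin, lin_0.
Qed.

Lemma dist2_nonneg m n : prob m -> prob n -> 0 <= dist2 m n.
Proof.
  intros Hm Hn; unfold dist2; rewrite <- (ext_lin (fun _ => 0) u) at 1 by apply lin_0.
  apply ext_le; auto using dc_lin, lin_0, dc_energies.
  intros y; apply energy_nonneg; auto.
Qed.

(** [mean_med_close] holds for the numbers [b s z] at every [z]; [ext_le] lifts it to functionals,
    and [ext_unit_le] replaces the right side by its value at the unit. *)
Lemma center_close m n a y c eps : prob m -> prob n -> 0 < eps -> bd y c ->
  Rabs (center m y - center n y) <=
  c * (eps * (dist2 m [(1, a)] + dist2 n [(1, a)]) + 9 / 2 / eps * dist2 m n).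
Proof.
  intros Hm Hn He Hy; pose proof (prob_single a) as Ha.
  set (f := fun y => eps * (energies m [(1, a)] y + energies n [(1, a)] y) + 9 / 2 / eps * energies m n y).
  assert (He' : 0 <= 9 / 2 / eps) by (apply Rlt_le, Rdiv_lt_0_compat; lra).
  assert (Hsum : dc (fun y => energies m [(1, a)] y + energies n [(1, a)] y))
    by (apply dc_add; apply dc_energies).
  assert (H1 : dc (fun y => eps * (energies m [(1, a)] y + energies n [(1, a)] y)))
    by (apply (dc_scal eps); auto).
  assert (H2 : dc (fun y => 9 / 2 / eps * energies m n y)) by (apply dc_scal, dc_energies).
  assert (Hf : dc f) by (apply (dc_add _ _ H1 H2)).
  assert (E : ext f u = eps * (dist2 m [(1, a)] + dist2 n [(1, a)]) + 9 / 2 / eps * dist2 m n).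
  { unfold f, dist2; rewrite (ext_add _ _ u H1 H2), (ext_scal eps _ u Hsum),
      (ext_scal (9 / 2 / eps)), ext_add by apply dc_energies; auto. }
  rewrite <- E.
  apply Rle_trans with (ext f y).
  - assert (P : forall z, Rabs (medians m z - medians n z) <= f z)
      by (intros z; exact (mean_med_close m n a (fun s => b s z) eps Hm Hn He)).
    assert (Q : forall m n, dc (fun y => medians m y + -1 * medians n y))
      by (intros; apply dc_add; [|apply dc_scal]; apply dc_medians).
    assert (Q' : forall m n, ext (fun y => medians m y + -1 * medians n y) y = center m y - center n y).
    { intros; rewrite ext_add, ext_scal by (try apply dc_scal; apply dc_medians).
      unfold center; ring. }
    apply Rabs_le; split.
    + apply Ropp_le_cancel; rewrite Ropp_involutive.
      replace (- (center m y - center n y)) with (center n y - center m y) by ring.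
      rewrite <- Q'; apply ext_le; auto. intros z; specialize (P z).
      pose proof (Rle_abs (- (medians m z - medians n z))); rewrite Rabs_Ropp in *; lra.
    + rewrite <- Q'; apply ext_le; auto. intros z; specialize (P z).
      pose proof (Rle_abs (medians m z - medians n z)); lra.
  - apply ext_unit_le; auto. intros z; unfold f.
    pose proof (energy_nonneg m [(1, a)] (fun s => b s z) Hm Ha).
    pose proof (energy_nonneg n [(1, a)] (fun s => b s z) Hn Ha).
    pose proof (energy_nonneg m n (fun s => b s z) Hm Hn).
    fold (energies m [(1, a)] z) in *; fold (energies n [(1, a)] z) in *; fold (energies m n z) in *.
    assert (0 <= eps * (energies m [(1, a)] z + energies n [(1, a)] z)) by (apply Rmult_le_pos; lra).
    assert (0 <= 9 / 2 / eps * energies m n z) by (apply Rmult_le_pos; lra). lra.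
Qed.

(** The energy of two point masses is the modulus of [b g0 - b a], a functional of norm at most
    [2 * C]. A decomposition of the unit splits into pieces where it is positive and where it is
    negative, and each group adds up to a point of norm at most 1. *)
Lemma dist2_single_bound a : dist2 [(1, g0)] [(1, a)] <= 4 * C.
Proof.
  set (q := fun y => b g0 y + (-1) * b a y).
  assert (Hq : lin q) by (apply lin_add; [|apply lin_scal]; auto).
  assert (Hq' : lin (fun y => -1 * q y)) by (apply lin_scal; auto).
  assert (Hs : sub (fun y => Rmax (q y) (-1 * q y))) by (apply sub_max; apply lin_sub; auto).
  assert (HC : 0 <= C) by apply (b_bd g0).
  assert (Hb : forall x, bd x 1 -> Rabs (q x) <= 2 * C).
  { intros x Hx; unfold q; eapply Rle_trans; [apply Rabs_triang|].
    rewrite Rabs_mult, (Rabs_left (-1)) by lra.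
    pose proof (proj2 (proj2 (proj2 (b_bd g0))) x 1 Hx).
    pose proof (proj2 (proj2 (proj2 (b_bd a))) x 1 Hx). lra. }
  unfold dist2; rewrite (ext_eq _ (env (fun y => Rmax (q y) (-1 * q y)))).
  - apply env_le; auto. intros l El.
    destruct (qsum_max_split q (fun y => -1 * q y) l) as [l1 [l2 [E1 ->]]].
    rewrite El in E1; rewrite qsum_lin, qsum_lin by auto.
    assert (B1 : bd (ksum l1) 1) by (apply (bd_mono K _ (ksum l2)); rewrite <- E1; auto).
    assert (B2 : bd (ksum l2) 1) by (apply (bd_mono K _ (ksum l1)); rewrite plusC, <- E1; auto).
    pose proof (Hb _ B1); pose proof (Hb _ B2).
    pose proof (Rle_abs (q (ksum l1))); pose proof (Rle_abs (- q (ksum l2))).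
    rewrite Rabs_Ropp in *; lra.
  - exists (fun y => Rmax (q y) (-1 * q y)), (fun _ => 0).
    split; [|split; [|split]]; auto using lin_sub, lin_0.
    + intros y; unfold energies; rewrite energy_single.
      unfold q, Rmax, Rabs.
      destruct (Rle_dec (b g0 y + -1 * b a y) (-1 * (b g0 y + -1 * b a y))),
        (Rcase_abs (b g0 y - b a y)); lra.
    + intros y; rewrite (env_lin (fun _ => 0)) by apply lin_0; ring.
Qed.

Lemma dist2_mixture m n a :
  dist2 (mixture m n) [(1, a)] =
  1/2 * dist2 m [(1, a)] + 1/2 * dist2 n [(1, a)] - 1/4 * dist2 m n.
Proof.
  unfold dist2.
  assert (E : energies (mixture m n) [(1, a)] = fun y => 1/2 * energies m [(1, a)] y +
    (1/2 * energies n [(1, a)] y + (-1/4) * energies m n y)).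
  { apply functional_extensionality; intros y; unfold energies; rewrite energy_parallelogram; field. }
  rewrite E, !ext_add, !ext_scal by (repeat first [apply dc_energies | apply dc_add | apply dc_scal]); field.
Qed.

Definition near_center (rho : R) (m : list (R * G)) : Prop :=
  prob m /\ forall a, dist2 m [(1, a)] <= rho.

(** [r] is the infimum of the squared radii, obtained as a supremum of their negatives. The point
    mass at [g0] shows that some radius is finite. *)
Lemma circumradius : exists r, 0 <= r /\
  (forall delta, 0 < delta -> exists m, near_center (r + delta) m) /\
  forall rho m, near_center rho m -> r <= rho.
Proof.
  destruct (completeness (fun x => exists m, near_center (- x) m)) as [s [Hs1 Hs2]].
  - exists 0; intros x [m [Hm H]].
    specialize (H g0); pose proof (dist2_nonneg m [(1, g0)] Hm (prob_single g0)); lra.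
  - exists (- (4 * C)), [(1, g0)]; split; [apply prob_single|].
    intros a; pose proof (dist2_single_bound a); lra.
  - exists (- s); split; [|split].
    + assert (s <= 0); [|lra]. apply Hs2; intros x [m [Hm H]].
      specialize (H g0); pose proof (dist2_nonneg m [(1, g0)] Hm (prob_single g0)); lra.
    + intros delta Hd; apply NNPP; intros Hn.
      assert (s <= s - delta); [|lra].
      apply Hs2; intros x Hx; apply Rnot_lt_le; intros Hlt; apply Hn.
      destruct Hx as [m [Hm H]]; exists m; split; auto.
      intros a; specialize (H a); lra.
    + intros rho m H; assert (- rho <= s); [|lra].
      apply Hs1; exists m; rewrite Ropp_involutive; auto.
Qed.

(** If the two were further apart than [8 * delta], the midpoint would gain more than a quarter of
    that, [2 * delta], and have squared radius below [r - delta]. *)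
Lemma near_centers_close r m n delta :
  (forall rho p, near_center rho p -> r <= rho) -> 0 < delta ->
  near_center (r + delta) m -> near_center (r + delta) n -> dist2 m n <= 8 * delta.
Proof.
  intros Hr Hd [Hm H1] [Hn H2]; apply Rnot_lt_le; intros Hlt.
  assert (r <= r - delta); [|lra].
  apply (Hr _ (mixture m n)); split; [apply prob_mixture; auto|].
  intros a; rewrite dist2_mixture; specialize (H1 a); specialize (H2 a); lra.
Qed.

Lemma centers_cauchy : exists r, (forall delta, 0 < delta -> exists m, near_center (r + delta) m) /\
  forall eta, 0 < eta -> exists delta, 0 < delta /\ forall m n y c,
    near_center (r + delta) m -> near_center (r + delta) n -> bd y c ->
    Rabs (center m y - center n y) <= c * eta.
Proof.
  destruct circumradius as [r [Hr0 [Hr1 Hr2]]]; exists r; split; auto.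
  intros eta Heta.
  (* The distances to [g0] are at most [r + delta <= r + 1], so this [eps] makes the first term of
     [center_close] at most [eta / 2]. *)
  set (eps := eta / (4 * (r + 1))).
  assert (Heps : 0 < eps) by (apply Rdiv_lt_0_compat; lra).
  (* With [dist2 m n <= 8 * delta] the second term is at most [36 * delta / eps], hence at most
     [eta / 2]. *)
  set (delta := Rmin 1 (eps * eta / 72)).
  assert (Hd : 0 < delta).
  { apply Rmin_glb_lt; [lra|]. apply Rdiv_lt_0_compat; [apply Rmult_lt_0_compat; auto | lra]. }
  exists delta; split; auto. intros m n y c Hm Hn Hy.
  eapply Rle_trans; [apply (center_close m n g0 y c eps); auto; [apply Hm | apply Hn]|].
  apply Rmult_le_compat_l; [eapply bd_ge0; eauto|].
  assert (D : dist2 m n <= 8 * delta) by (eapply near_centers_close; eauto).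
  pose proof (Rmin_l 1 (eps * eta / 72)) as D1; fold delta in D1.
  pose proof (Rmin_r 1 (eps * eta / 72)) as D2; fold delta in D2.
  assert (A1 : eps * (dist2 m [(1, g0)] + dist2 n [(1, g0)]) <= eta / 2).
  { apply Rle_trans with (eps * (2 * (r + 1))).
    - apply Rmult_le_compat_l; [lra|].
      pose proof (proj2 Hm g0); pose proof (proj2 Hn g0); lra.
    - right; unfold eps; field; lra. }
  assert (A2 : 9 / 2 / eps * dist2 m n <= eta / 2).
  { apply Rle_trans with (9 / 2 / eps * (eps * eta / 9)).
    - apply Rmult_le_compat_l; [apply Rlt_le, Rdiv_lt_0_compat; lra | lra].
    - right; field; lra. }
  lra.
Qed.

(** The limit is taken along one chosen sequence of near minimisers, but the estimate holds against
    all of them. So [w] does not depend on the sequence, which is what makes it invariant. *)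
Lemma center_limit : exists (r : R) (w : pt K -> R),
  (forall delta, 0 < delta -> exists m, near_center (r + delta) m) /\
  forall eta, 0 < eta -> exists delta, 0 < delta /\ forall m y c,
    near_center (r + delta) m -> bd y c -> Rabs (center m y - w y) <= c * eta.
Proof.
  destruct centers_cauchy as [r [Hr HC]]; exists r.
  assert (Hpos : forall k, 0 < / (INR k + 1)) by (intros k; pose proof (pos_INR k); apply Rinv_0_lt_compat; lra).
  pose (m := fun k => proj1_sig (constructive_indefinite_description _ (Hr _ (Hpos k)))).
  assert (Hm : forall k, near_center (r + / (INR k + 1)) (m k))
    by (intros k; unfold m; apply proj2_sig).
  assert (Hev : forall delta, 0 < delta -> exists N, forall k, (k >= N)%nat -> near_center (r + delta) (m k)).
  { intros delta Hd; destruct (archimed_cor1 delta Hd) as [N [HN HN0]]; exists N; intros k Hk.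
    destruct (Hm k) as [H1 H2]; split; auto. intros a; eapply Rle_trans; [apply H2|].
    assert (/ (INR k + 1) <= / INR N); [|lra].
    assert (INR N <= INR k) by (apply le_INR; lia).
    apply Rinv_le_contravar; [apply lt_0_INR; lia | lra]. }
  assert (Hlim : forall y, exists v, Un_cv (fun k => center (m k) y) v).
  { intros y; destruct (bd_ex K y) as [c Hc]; pose proof (bd_ge0 K y c Hc).
    destruct (R_complete (fun k => center (m k) y)) as [v Hv]; [|exists v; auto].
    intros eps He.
    destruct (HC (eps / 2 / (c + 1))) as [delta [Hd HD]]; [repeat apply Rdiv_lt_0_compat; lra|].
    destruct (Hev delta Hd) as [N HN]; exists N; intros i j Hi Hj.
    unfold Rdist; eapply Rle_lt_trans; [apply (HD _ _ y c); auto|].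
    apply Rle_lt_trans with (eps / 2); [|lra].
    replace (eps / 2) with ((c + 1) * (eps / 2 / (c + 1))) at 2 by (field; lra).
    apply Rmult_le_compat_r; [|lra]. apply Rlt_le; repeat apply Rdiv_lt_0_compat; lra. }
  pose (w := fun y => proj1_sig (constructive_indefinite_description _ (Hlim y))).
  exists w; split; auto.
  intros eta Heta; destruct (HC eta Heta) as [delta [Hd HD]]; exists delta; split; auto.
  intros n y c Hn Hy; apply le_epsilon; intros eps He.
  assert (Hw : Un_cv (fun k => center (m k) y) (w y)) by (unfold w; apply proj2_sig).
  destruct (Hw eps He) as [N1 HN1]; destruct (Hev delta Hd) as [N2 HN2].
  set (k := max N1 N2).
  specialize (HN1 k ltac:(unfold k; lia)); specialize (HN2 k ltac:(unfold k; lia)).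
  replace (center n y - w y) with ((center n y - center (m k) y) + (center (m k) y - w y)) by ring.
  eapply Rle_trans; [apply Rabs_triang|].
  apply Rplus_le_compat; [apply HD; auto | unfold Rdist in HN1; lra].
Qed.

Lemma center_lin m : lin (center m).
Proof. eapply Ext_is_lin, ext_spec, dc_medians. Qed.

(** By the cocycle identity, translating the samples composes all values with [al g] and shifts them
    by [b g]; the median commutes with shifts, and [ext] with automorphisms. *)
Lemma center_push m g y : prob m -> center (push (gop g) m) y = center m (al g y) + b g y.
Proof.
  intros Hm; unfold center.
  apply (ext_eq _ (fun y => ext (medians m) (al g y) + b g y)).
  assert (E : medians (push (gop g) m) = fun y => medians m (al g y) + b g y).
  { apply functional_extensionality; intros z; unfold medians; rewrite mean_med_push.
    rewrite <- mean_med_shift by auto. f_equal; apply functional_extensionality; intros s; auto. }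
  rewrite E; apply Ext_add; [|apply Ext_lin; auto].
  apply (Ext_comp (medians m) (ext (medians m)) (al g) (al' g)); auto.
  apply ext_spec, dc_medians.
Qed.

(** Every [b a] is also some [b (gop g a')] by [b_onto], so both measures are translates by [g]. The
    common shift drops out of the energy, and [al g] fixes the unit. *)
Lemma near_center_push rho m g : near_center rho m -> near_center rho (push (gop g) m).
Proof.
  intros [Hm H]; split; [apply prob_map; auto|].
  intros a; destruct (b_onto g a) as [a' Ha'].
  eapply Rle_trans; [|apply (H a')]; right; unfold dist2.
  rewrite <- (al_unit g) at 2.
  apply (ext_eq _ (fun y => ext (energies m [(1, a')]) (al g y))).
  assert (E : energies (push (gop g) m) [(1, a)] = fun y => energies m [(1, a')] (al g y)).
  { apply functional_extensionality; intros z; unfold energies.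
    transitivity (energy (push (gop g) m) (push (gop g) [(1, a')]) (fun s => b s z)).
    - change (push (gop g) [(1, a')]) with [(1, gop g a')].
      assert (D : forall p, mean_dist p [(1, a)] (fun s => b s z) =
        mean_dist p [(1, gop g a')] (fun s => b s z)).
      { intros p; unfold mean_dist; apply wsum_ext; intros i; rewrite !wsum_single, Ha'; auto. }
      unfold energy; rewrite !D, (mean_dist_sym [(1, a)]), !D; auto.
    - unfold energy; rewrite !mean_dist_push.
      assert (Eb : (fun i => b (gop g i) z) = fun i => b i (al g z) + b g z)
        by (apply functional_extensionality; auto).
      rewrite Eb, !mean_dist_shift; auto. }
  rewrite E; apply (Ext_comp (energies m [(1, a')]) _ (al g) (al' g)); auto.
  apply ext_spec, dc_energies.
Qed.

(** A near minimiser [m] and its translate both have centers close to [w], so [center_push] passes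
    to the limit as the fixed point equation. Linearity passes from [center m] to [w] in the same
    way. *)
Theorem bounded_cocycle_trivial : exists w, lin w /\ forall g y, w y = w (al g y) + b g y.
Proof.
  destruct center_limit as [r [w [Hr Hw]]].
  assert (approx : forall eta, 0 < eta -> exists m, near_center (r + eta) m /\
     (forall y c, bd y c -> Rabs (center m y - w y) <= c * eta) /\
     (forall g y c, bd y c -> Rabs (center (push (gop g) m) y - w y) <= c * eta)).
  { intros eta Heta; destruct (Hw eta Heta) as [delta [Hd HD]].
    destruct (Hr (Rmin delta eta)) as [m Hm]; [apply Rmin_glb_lt; auto|].
    pose proof (Rmin_l delta eta); pose proof (Rmin_r delta eta).
    assert (Hm' : forall x, Rmin delta eta <= x -> near_center (r + x) m)
      by (intros x Hx; destruct Hm as [H1 H2]; split; auto; intros a; specialize (H2 a); lra).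
    exists m; split; [|split]; auto. intros; apply HD; auto using near_center_push. }
  exists w; split.
  - destruct (approx 1 Rlt_0_1) as [m1 [_ [H1 _]]].
    destruct (center_lin m1) as [D [_ [_ [HD0 HD]]]].
    exists (D + 1); split; [|split; [|split]].
    + intros x y; apply eq_of_close; intros eta Heta.
      destruct (bd_ex K (plus x y)) as [c Hc]; pose proof (bd_ge0 K _ _ Hc).
      destruct (approx (eta / 3 / (c + 1))) as [m [_ [Hm _]]]; [repeat apply Rdiv_lt_0_compat; lra|].
      destruct (center_lin m) as [E [HE _]].
      assert (A : c * (eta / 3 / (c + 1)) <= eta / 3).
      { apply Rle_trans with ((c + 1) * (eta / 3 / (c + 1))); [|right; field; lra].
        apply Rmult_le_compat_r; [|lra]. apply Rlt_le; repeat apply Rdiv_lt_0_compat; lra. }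
      pose proof (Hm _ _ Hc) as M1.
      pose proof (Hm x c (bd_mono K x y c Hc)) as M2.
      pose proof (Hm y c (bd_mono K y x c ltac:(rewrite plusC; auto))) as M3.
      rewrite HE in M1.
      revert M1 M2 M3; unfold Rabs; repeat destruct Rcase_abs; lra.
    + intros k x Hk; apply eq_of_close; intros eta Heta.
      destruct (bd_ex K (sc k x)) as [c Hc]; pose proof (bd_ge0 K _ _ Hc).
      destruct (bd_ex K x) as [d Hd]; pose proof (bd_ge0 K _ _ Hd).
      assert (P : 0 <= k * d) by (apply Rmult_le_pos; auto).
      destruct (approx (eta / (c + k * d + 1))) as [m [_ [Hm _]]]; [apply Rdiv_lt_0_compat; lra|].
      destruct (center_lin m) as [E [_ [HE _]]].
      assert (A : (c + k * d) * (eta / (c + k * d + 1)) <= eta).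
      { apply Rle_trans with ((c + k * d + 1) * (eta / (c + k * d + 1))); [|right; field; lra].
        apply Rmult_le_compat_r; [|lra]. apply Rlt_le, Rdiv_lt_0_compat; lra. }
      pose proof (Hm _ _ Hc) as M1; pose proof (Hm _ _ Hd) as M2.
      rewrite HE in M1 by auto.
      replace (w (sc k x) - k * w x) with
        (- (k * center m x - w (sc k x)) + k * (center m x - w x)) by ring.
      eapply Rle_trans; [apply Rabs_triang|].
      rewrite Rabs_Ropp, Rabs_mult, (Rabs_right k) by lra.
      assert (k * Rabs (center m x - w x) <= k * (d * (eta / (c + k * d + 1))))
        by (apply Rmult_le_compat_l; auto).
      lra.
    + lra.
    + intros x c Hc; specialize (H1 x c Hc); specialize (HD x c Hc).
      replace (w x) with (center m1 x + - (center m1 x - w x)) by ring.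
      eapply Rle_trans; [apply Rabs_triang|]; rewrite Rabs_Ropp; lra.
  - intros g y; apply eq_of_close; intros eta Heta.
    destruct (bd_ex K y) as [c Hc]; pose proof (bd_ge0 K _ _ Hc).
    destruct (approx (eta / 2 / (c + 1))) as [m [Hn [Hm Hm']]]; [repeat apply Rdiv_lt_0_compat; lra|].
    assert (A : c * (eta / 2 / (c + 1)) <= eta / 2).
    { apply Rle_trans with ((c + 1) * (eta / 2 / (c + 1))); [|right; field; lra].
      apply Rmult_le_compat_r; [|lra]. apply Rlt_le; repeat apply Rdiv_lt_0_compat; lra. }
    pose proof (Hm' g y c Hc) as M1.
    pose proof (Hm (al g y) c (proj2 (proj2 (al_kmap g)) y c Hc)) as M2.
    rewrite center_push in M1 by apply Hn.
    replace (w y - (w (al g y) + b g y)) with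
      (- (center m (al g y) + b g y - w y) + (center m (al g y) - w (al g y))) by ring.
    eapply Rle_trans; [apply Rabs_triang|]; rewrite Rabs_Ropp; lra.
Qed.

End FixedPoint.

(** * Inverse semigroups and the tower of function spaces *)


Section InverseSemigroup.
Context (S : InvSemigroup).
Local Notation "x ** y" := (op S x y) (at level 40, left associativity).
Implicit Types s t e f : S.

Definition star s : S := proj1_sig (constructive_indefinite_description _ (inv_unique S s)).

Lemma star_spec s : s ** star s ** s = s /\ star s ** s ** star s = star s.
Proof. unfold star; destruct constructive_indefinite_description as [t [H H']]; exact H. Qed.

Lemma star_unique s t : s ** t ** s = s -> t ** s ** t = t -> t = star s.
Proof.
  intros H1 H2; destruct (inv_unique S s) as [x [_ Hx]].
  rewrite <- (Hx t), <- (Hx (star s)); auto using star_spec.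
Qed.

Lemma idempotent_ss s : idempotent S (s ** star s).
Proof. unfold idempotent; rewrite op_assoc, (proj1 (star_spec s)); auto. Qed.

Lemma idempotent_s's s : idempotent S (star s ** s).
Proof. unfold idempotent; rewrite op_assoc, (proj2 (star_spec s)); auto. Qed.

Lemma star_idempotent e : idempotent S e -> star e = e.
Proof. unfold idempotent; intros H; symmetry; apply star_unique; rewrite !H; auto. Qed.

Lemma star_star s : star (star s) = s.
Proof. symmetry; apply star_unique; apply star_spec. Qed.

(** With [x] the inverse of [e ** f], the element [f ** x ** e] is an inverse too, hence equals [x].
    That makes [x] idempotent, so its own inverse, and [e ** f = x]. *)
Lemma idempotent_op e f : idempotent S e -> idempotent S f -> idempotent S (e ** f).
Proof.
  unfold idempotent; intros He Hf.
  destruct (star_spec (e ** f)) as [H1 H2].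
  set (x := star (e ** f)) in *.
  assert (A1 : e ** (f ** (x ** (e ** f))) = e ** f) by (rewrite !op_assoc in *; auto).
  assert (A2 : x ** (e ** (f ** x)) = x) by (rewrite !op_assoc in *; auto).
  assert (E : f ** x ** e = x).
  { apply star_unique.
    - transitivity (e ** ((f ** f) ** (x ** ((e ** e) ** f)))); [rewrite !op_assoc; auto|].
      rewrite He, Hf; auto.
    - transitivity (f ** ((x ** ((e ** e) ** ((f ** f) ** x))) ** e)); [rewrite !op_assoc; auto|].
      rewrite He, Hf, A2, op_assoc; auto. }
  assert (Hx : x ** x = x).
  { rewrite <- E.
    transitivity (f ** ((x ** (e ** (f ** x))) ** e)); [rewrite !op_assoc; auto|].
    rewrite A2, op_assoc; auto. }
  assert (Ex : e ** f = x).
  { transitivity (star x); [unfold x; rewrite star_star; auto | apply star_idempotent; auto]. }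
  rewrite Ex; auto.
Qed.

(** Both sides are inverses of the idempotent [e ** f]. *)
Lemma idempotent_comm e f : idempotent S e -> idempotent S f -> e ** f = f ** e.
Proof.
  intros He Hf.
  pose proof (idempotent_op e f He Hf) as Hef; pose proof (idempotent_op f e Hf He) as Hfe.
  rewrite <- (star_idempotent (e ** f)) by auto; symmetry; apply star_unique;
    unfold idempotent in *.
  - transitivity (e ** ((f ** f) ** ((e ** e) ** f))); [rewrite !op_assoc; auto|].
    rewrite He, Hf. transitivity ((e ** f) ** (e ** f)); [rewrite !op_assoc; auto | auto].
  - transitivity (f ** ((e ** e) ** ((f ** f) ** e))); [rewrite !op_assoc; auto|].
    rewrite He, Hf. transitivity ((f ** e) ** (f ** e)); [rewrite !op_assoc; auto | auto].
Qed.

Lemma star_op s t : star (s ** t) = star t ** star s.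
Proof.
  symmetry; apply star_unique.
  - transitivity (s ** (((t ** star t) ** (star s ** s)) ** t)); [rewrite !op_assoc; auto|].
    rewrite (idempotent_comm (t ** star t)) by (apply idempotent_ss || apply idempotent_s's).
    transitivity ((s ** star s ** s) ** (t ** star t ** t)); [rewrite !op_assoc; auto|].
    rewrite (proj1 (star_spec s)), (proj1 (star_spec t)); auto.
  - transitivity (star t ** (((star s ** s) ** (t ** star t)) ** star s)); [rewrite !op_assoc; auto|].
    rewrite (idempotent_comm (star s ** s)) by (apply idempotent_ss || apply idempotent_s's).
    transitivity ((star t ** t ** star t) ** (star s ** s ** star s)); [rewrite !op_assoc; auto|].
    rewrite (proj2 (star_spec s)), (proj2 (star_spec t)); auto.
Qed.

(** Equivalently, [h] factors through the maximal group image of [S]. For bounded functionals on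
    [l1(S)], read off on the point masses, this is vanishing on [J]. *)
Definition invariant {X : Type} (h : S -> X) : Prop :=
  forall s e t, idempotent S e -> h (s ** e ** t) = h (s ** t).

(** Invariance removes an idempotent only from between two factors, so [star t ** t] is split off
    from [t] and commuted past [e] to stand on its right. *)
Lemma invariant_r {X} (h : S -> X) t e : invariant h -> idempotent S e -> h (t ** e) = h t.
Proof.
  intros Hh He.
  transitivity (h (t ** e ** (star t ** t))).
  - f_equal. transitivity (t ** ((star t ** t) ** e)).
    + rewrite !op_assoc, (proj1 (star_spec t)); auto.
    + rewrite (idempotent_comm (star t ** t)), op_assoc by (auto using idempotent_s's); auto.
  - rewrite Hh, op_assoc, (proj1 (star_spec t)) by auto; auto.
Qed.

Lemma invariant_l {X} (h : S -> X) t e : invariant h -> idempotent S e -> h (e ** t) = h t.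
Proof.
  intros Hh He.
  transitivity (h ((t ** star t) ** e ** t)).
  - f_equal. rewrite (idempotent_comm (t ** star t)) by (auto using idempotent_ss).
    rewrite <- !op_assoc; f_equal; rewrite op_assoc, (proj1 (star_spec t)); auto.
  - rewrite Hh, (proj1 (star_spec t)) by auto; auto.
Qed.

End InverseSemigroup.

(* A normed lattice of functions on the index set [ix], presented by the relation [nb a r], i.e. [||a|| <= r];
   [la] and [ra] model the left and right actions of [S] on a predual. *)
Record fspace (S : InvSemigroup) := {
  ix : Type ;
  nb : (ix -> R) -> R -> Prop ;
  la : S -> ix -> ix ;
  ra : S -> ix -> ix ;
  nb_ge0 : forall a r, nb a r -> 0 <= r ;
  nb_0 : nb (fun _ => 0) 0 ;
  nb_add : forall a b r s, nb a r -> nb b s -> nb (fun i => a i + b i) (r + s) ;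
  nb_scal : forall k a r, nb a r -> nb (fun i => k * a i) (Rabs k * r) ;
  nb_mono : forall a b r s, nb a r -> nb b s -> (forall i, 0 <= b i <= a i) -> nb b r ;
  nb_parts : forall a r, nb a r -> exists p q, nb p r /\ nb q r /\
    (forall i, 0 <= p i) /\ (forall i, 0 <= q i) /\ forall i, a i = p i - q i ;
  nb_refine : forall a b c d r s t u, nb a r -> nb b s -> nb c t -> nb d u ->
    (forall i, 0 <= a i) -> (forall i, 0 <= b i) -> (forall i, 0 <= c i) -> (forall i, 0 <= d i) ->
    (forall i, a i + b i = c i + d i) ->
    exists e v, nb e v /\ forall i, 0 <= e i /\ e i <= a i /\ e i <= c i /\ 0 <= b i - c i + e i ;
  nb_la : forall s a r, nb a r -> nb (fun i => a (la s i)) r ;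
  nb_ra : forall s a r, nb a r -> nb (fun i => a (ra s i)) r ;
  la_la : forall a r s t i, nb a r -> a (la s (la t i)) = a (la (op S s t) i) ;
  ra_ra : forall a r s t i, nb a r -> a (ra t (ra s i)) = a (ra (op S s t) i) ;
  la_ra : forall a r s t i, nb a r -> a (la s (ra t i)) = a (ra t (la s i)) ;
  la_idem : forall a r e i, nb a r -> idempotent S e -> a (la e i) = a i ;
  ra_idem : forall a r e i, nb a r -> idempotent S e -> a (ra e i) = a i
}.
Arguments ix {_}. Arguments nb {_}. Arguments la {_}. Arguments ra {_}.

(** * The positive cone of a function space *)

Section PositiveCone.
Context {S : InvSemigroup} (A : fspace S).

Definition pos : Type := {a : ix A -> R | (exists r, nb A a r) /\ forall i, 0 <= a i}.
Definition val (p : pos) : ix A -> R := proj1_sig p.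

Lemma val_nb p : exists r, nb A (val p) r.
Proof. destruct p as [a [H H']]; auto. Qed.

Lemma val_ge0 p i : 0 <= val p i.
Proof. destruct p as [a [H H']]; apply H'. Qed.

Lemma val_inj p q : (forall i, val p i = val q i) -> p = q.
Proof.
  intros H; destruct p as [a Ha], q as [b Hb]; simpl in H.
  assert (a = b) as -> by (apply functional_extensionality; auto).
  f_equal; apply proof_irrelevance.
Qed.

Definition mkpos (a : ix A -> R) (H : (exists r, nb A a r) /\ forall i, 0 <= a i) : pos := exist _ a H.

Program Definition pos_zero : pos := mkpos (fun _ => 0) _.
Next Obligation. split; [exists 0; apply nb_0 | intros; lra]. Qed.

Program Definition pos_plus (p q : pos) : pos := mkpos (fun i => val p i + val q i) _.
Next Obligation.
  split.
  - destruct (val_nb p), (val_nb q); eexists; apply nb_add; eauto.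
  - intros i; pose proof (val_ge0 p i); pose proof (val_ge0 q i); lra.
Qed.

(** The absolute value makes scaling total on positive functions; for [0 <= c] it is the ordinary
    one. *)
Program Definition pos_sc (c : R) (p : pos) : pos := mkpos (fun i => Rabs c * val p i) _.
Next Obligation.
  split.
  - destruct (val_nb p); eexists; apply nb_scal; eauto.
  - intros i; apply Rmult_le_pos; [apply Rabs_pos | apply val_ge0].
Qed.

Lemma pos_diff (p q : pos) : (forall i, val q i <= val p i) -> exists r, pos_plus q r = p.
Proof.
  intros H.
  assert (Hd : (exists r, nb A (fun i => val p i + (-1) * val q i) r) /\
    forall i, 0 <= val p i + (-1) * val q i).
  { split.
    - destruct (val_nb p), (val_nb q); eexists; apply nb_add; [|apply nb_scal]; eauto.
    - intros i; specialize (H i); lra. }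
  exists (mkpos _ Hd); apply val_inj; intros i; simpl; ring.
Qed.

(** [nb_refine] gives one corner [e] of the two by two refinement; the other three are differences,
    and its last inequality makes the corner [h] positive. *)
Lemma pos_rdp a b c d : pos_plus a b = pos_plus c d -> exists e f g h,
  a = pos_plus e f /\ b = pos_plus g h /\ c = pos_plus e g /\ d = pos_plus f h.
Proof.
  intros E.
  assert (E' : forall i, val a i + val b i = val c i + val d i)
    by (intros i; apply (f_equal (fun p => val p i) E)).
  destruct (val_nb a) as [ra' Ha], (val_nb b) as [rb Hb], (val_nb c) as [rc Hc], (val_nb d) as [rd Hd].
  destruct (nb_refine S A _ _ _ _ _ _ _ _ Ha Hb Hc Hd) as [e [v [He H]]]; auto using val_ge0.
  assert (He' : (exists r, nb A e r) /\ forall i, 0 <= e i) by (split; [exists v; auto | intros; apply H]).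
  set (pe := mkpos e He').
  destruct (pos_diff a pe) as [f Hf]; [intros i; apply H|].
  destruct (pos_diff c pe) as [g Hg]; [intros i; apply H|].
  assert (Hv : forall i, val c i = e i + val g i) by (intros i; rewrite <- Hg; auto).
  destruct (pos_diff b g) as [h Hh].
  { intros i; specialize (Hv i); destruct (H i) as [_ [_ [_ H4]]]; lra. }
  exists pe, f, g, h; split; [|split; [|split]]; auto.
  apply val_inj; intros i; simpl.
  assert (F1 : val a i = e i + val f i) by (rewrite <- Hf; auto).
  assert (F2 : val b i = val g i + val h i) by (rewrite <- Hh; auto).
  specialize (Hv i); specialize (E' i); lra.
Qed.

Definition poscone : cone.
Proof.
  refine {| pt := pos ; zero := pos_zero ; plus := pos_plus ; sc := pos_sc ;
            bd := fun p c => nb A (val p) c |}.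
  - intros; apply val_inj; intros; simpl; ring.
  - intros; apply val_inj; intros; simpl; ring.
  - intros; apply val_inj; intros; simpl; ring.
  - apply pos_rdp.
  - intros; apply val_inj; intros; simpl; ring.
  - intros c d x Hc Hd; apply val_inj; intros; simpl; rewrite Rabs_mult; ring.
  - intros; apply val_inj; intros; simpl; rewrite Rabs_R1; ring.
  - intros; apply val_inj; intros; simpl; rewrite Rabs_R0; ring.
  - intros x y c H; destruct (val_nb x) as [r Hr].
    eapply (nb_mono S A); [exact H | exact Hr |].
    intros i; simpl; pose proof (val_ge0 x i); pose proof (val_ge0 y i); lra.
  - intros x c; apply nb_ge0.
  - apply val_nb.
Defined.

(** Left and right are exchanged, as for the module actions on a dual. *)
Program Definition pos_la (s : S) (p : pos) : pos := mkpos (fun i => val p (ra A s i)) _.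
Next Obligation.
  split; [|intros; apply val_ge0].
  destruct (val_nb p) as [r Hr]; exists r; apply (nb_ra S A s _ r Hr).
Qed.

Program Definition pos_ra (s : S) (p : pos) : pos := mkpos (fun i => val p (la A s i)) _.
Next Obligation.
  split; [|intros; apply val_ge0].
  destruct (val_nb p) as [r Hr]; exists r; apply (nb_la S A s _ r Hr).
Qed.

Lemma kmap_la s : kmap (K := poscone) (pos_la s).
Proof.
  split; [|split].
  - intros; apply val_inj; reflexivity.
  - intros; apply val_inj; reflexivity.
  - intros x c; apply nb_ra.
Qed.

Lemma kmap_ra s : kmap (K := poscone) (pos_ra s).
Proof.
  split; [|split].
  - intros; apply val_inj; reflexivity.
  - intros; apply val_inj; reflexivity.
  - intros x c; apply nb_la.
Qed.

Lemma pos_la_la s t p : pos_la s (pos_la t p) = pos_la (op S s t) p.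
Proof. destruct (val_nb p) as [r Hr]; apply val_inj; intros i; eapply ra_ra; exact Hr. Qed.

Lemma pos_ra_ra s t p : pos_ra t (pos_ra s p) = pos_ra (op S s t) p.
Proof. destruct (val_nb p) as [r Hr]; apply val_inj; intros i; eapply la_la; exact Hr. Qed.

Lemma pos_la_ra s t p : pos_la s (pos_ra t p) = pos_ra t (pos_la s p).
Proof. destruct (val_nb p) as [r Hr]; apply val_inj; intros i; eapply la_ra; exact Hr. Qed.

Lemma pos_la_idem e p : idempotent S e -> pos_la e p = p.
Proof. intros He; destruct (val_nb p) as [r Hr]; apply val_inj; intros i; eapply ra_idem; eauto. Qed.

Lemma pos_ra_idem e p : idempotent S e -> pos_ra e p = p.
Proof. intros He; destruct (val_nb p) as [r Hr]; apply val_inj; intros i; eapply la_idem; eauto. Qed.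

End PositiveCone.

(** * The functionals on a cone as a function space *)

Section Dual.
Context {K : cone}.
Implicit Types (a : pt K -> R) (y : pt K).

Definition pospart (a : pt K -> R) : pt K -> R := env (fun y => Rmax (a y) 0).

Lemma sub_pospart a : lin a -> sub (fun y => Rmax (a y) 0).
Proof. intros Ha; apply (sub_max a (fun _ => 0)); apply lin_sub; auto using lin_0. Qed.

Lemma pospart_ge a y : lin a -> a y <= pospart a y /\ 0 <= pospart a y.
Proof.
  intros Ha; pose proof (env_ge _ [y] (sub_pospart a Ha)) as H.
  unfold qsum in H; simpl in H; rewrite plusC, plus0 in H; fold (pospart a) in H.
  pose proof (Rmax_l (a y) 0); pose proof (Rmax_r (a y) 0); lra.
Qed.

Lemma pospart_le a (c : pt K -> R) y : lin a -> lin c -> (forall y, a y <= c y) -> (forall y, 0 <= c y) ->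
  pospart a y <= c y.
Proof.
  intros Ha Hc H1 H2; apply env_le; auto using sub_pospart.
  intros l <-; rewrite <- qsum_lin by auto. apply qsum_le; intros; apply Rmax_lub; auto.
Qed.

(** In a decomposition only the pieces with positive value count. They add up to a point below [y],
    so one application of the bound on [a] suffices and the constant is kept. *)
Lemma pospart_bd a r : lin_bd a r -> lin_bd (pospart a) r.
Proof.
  intros Hr; assert (Ha : lin a) by (exists r; auto).
  destruct (lin_env _ (sub_pospart a Ha)) as [C [H1 [H2 _]]].
  destruct Hr as [_ [_ [Hr0 Hr]]].
  split; [exact H1|]; split; [exact H2|]; split; auto.
  intros y c Hc; rewrite Rabs_right by (apply Rle_ge, pospart_ge; auto).
  apply env_le; auto using sub_pospart. intros l <-.
  destruct (qsum_max_split a (fun _ => 0) l) as [l1 [l2 [E ->]]].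
  rewrite (qsum_lin (fun _ => 0)), qsum_lin by auto using lin_0.
  rewrite Rplus_0_r; eapply Rle_trans; [apply Rle_abs|].
  apply Hr; rewrite E in Hc; eapply bd_mono; eauto.
Qed.

Lemma pospart_diff a y : lin a -> a y = pospart a y - pospart (fun y => - a y) y.
Proof.
  intros Ha; apply (Ext_unique a a (fun y => Rmax (a y) 0 - Rmax (- a y) 0)
    (fun y => pospart a y - pospart (fun y => - a y) y) (Ext_lin a Ha)).
  - exists (fun y => Rmax (a y) 0), (fun y => Rmax (- a y) 0).
    split; [|split; [|split]]; auto using sub_pospart, lin_opp.
  - intros z; unfold Rmax; destruct (Rle_dec (a z) 0), (Rle_dec (- a z) 0); lra.
Qed.

Lemma lin_bd_opp a r : lin_bd a r -> lin_bd (fun y : pt K => - a y) r.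
Proof.
  intros [H1 [H2 [H3 H4]]]; repeat split; auto.
  - intros; rewrite H1; ring.
  - intros; rewrite H2 by auto; ring.
  - intros; rewrite Rabs_Ropp; auto.
Qed.

Context {S : InvSemigroup} (lK rK : S -> pt K -> pt K).
Hypothesis lK_kmap : forall s, kmap (lK s).
Hypothesis rK_kmap : forall s, kmap (rK s).
Hypothesis lK_lK : forall s t p, lK s (lK t p) = lK (op S s t) p.
Hypothesis rK_rK : forall s t p, rK t (rK s p) = rK (op S s t) p.
Hypothesis lK_rK : forall s t p, lK s (rK t p) = rK t (lK s p).
Hypothesis lK_idem : forall e p, idempotent S e -> lK e p = p.
Hypothesis rK_idem : forall e p, idempotent S e -> rK e p = p.

Lemma lin_bd_comp a r phi : lin_bd a r -> kmap phi -> lin_bd (fun y : pt K => a (phi y)) r.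
Proof.
  intros [H1 [H2 [H3 H4]]] [P1 [P2 P3]]; repeat split; auto.
  - intros; rewrite P1, H1; auto.
  - intros; rewrite P2, H2; auto.
Qed.

Definition dualspace : fspace S.
Proof.
  refine {| ix := pt K ; nb := lin_bd ; la := lK ; ra := rK |}.
  - intros a r H; apply H.
  - repeat split; intros; try ring; try lra. rewrite Rabs_R0; lra.
  - intros a b r s [H1 [H2 [H3 H4]]] [I1 [I2 [I3 I4]]]; repeat split.
    + intros; rewrite H1, I1; ring.
    + intros; rewrite H2, I2 by auto; ring.
    + lra.
    + intros x c Hc; specialize (H4 x c Hc); specialize (I4 x c Hc).
      eapply Rle_trans; [apply Rabs_triang | lra].
  - intros k a r [H1 [H2 [H3 H4]]]; repeat split.
    + intros; rewrite H1; ring.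
    + intros; rewrite H2 by auto; ring.
    + apply Rmult_le_pos; auto using Rabs_pos.
    + intros x c Hc; rewrite Rabs_mult, Rmult_assoc; apply Rmult_le_compat_l; auto using Rabs_pos.
  - intros a b r s [H1 [H2 [H3 H4]]] [I1 [I2 [I3 I4]]] H; repeat split; auto.
    intros x c Hc; specialize (H4 x c Hc); specialize (H x).
    rewrite Rabs_right in * by lra; lra.
  - intros a r Hr; assert (Ha : lin a) by (exists r; auto).
    exists (pospart a), (pospart (fun y => - a y)).
    split; [|split; [|split; [|split]]]; auto using pospart_bd, lin_bd_opp.
    + intros; apply pospart_ge; auto.
    + intros; apply pospart_ge, lin_opp; auto.
    + intros; apply pospart_diff; auto.
  - intros a b c d r s t u Ha Hb Hc Hd Pa Pb Pc Pd E.
    assert (La : lin a) by (exists r; auto). assert (Lc : lin c) by (exists t; auto).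
    assert (Ld : lin d) by (exists u; auto).
    assert (Lac : lin (fun y => a y + (-1) * c y)) by (apply lin_add; [|apply lin_scal]; auto).
    (* The corner of the refinement is the meet of [a] and [c], written as [a] minus the positive
       part of [a - c]. Since [a - c = d - b] lies below [d], so does that positive part, which
       gives the last inequality. *)
    assert (Le : lin (fun y => a y + (-1) * pospart (fun y => a y + (-1) * c y) y)).
    { apply lin_add; auto. apply lin_scal. apply lin_env, sub_pospart; auto. }
    destruct Le as [v Hv]; exists (fun y => a y + (-1) * pospart (fun y => a y + (-1) * c y) y), v.
    split; auto. intros i.
    pose proof (pospart_ge _ i Lac) as [G1 G2].
    assert (pospart (fun y => a y + (-1) * c y) i <= a i)
      by (apply pospart_le; auto; intros z; specialize (Pc z); lra).
    assert (pospart (fun y => a y + (-1) * c y) i <= d i)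
      by (apply pospart_le; auto; intros z; specialize (Pb z); specialize (E z); lra).
    specialize (E i); repeat split; lra.
  - intros; apply lin_bd_comp; auto.
  - intros; apply lin_bd_comp; auto.
  - intros; f_equal; auto.
  - intros; f_equal; auto.
  - intros; f_equal; auto.
  - intros; f_equal; auto.
  - intros; f_equal; auto.
Defined.

End Dual.

Definition next {S : InvSemigroup} (A : fspace S) : fspace S :=
  dualspace (K := poscone A) (pos_la A) (pos_ra A) (kmap_la A) (kmap_ra A) (pos_la_la A) (pos_ra_ra A)
    (pos_la_ra A) (pos_la_idem A) (pos_ra_idem A).

(** The real part of the dual of [l1(S)/J]. Here the lattice operations are pointwise, so the
    refinement is a pointwise minimum. *)
Definition base (S : InvSemigroup) : fspace S.
Proof.
  refine {| ix := S ; nb := fun h r => 0 <= r /\ (forall s, Rabs (h s) <= r) /\ invariant S h ;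
            la := fun s v => op S s v ; ra := fun s v => op S v s |}.
  - intros a r H; apply H.
  - split; [lra|]; split; [intros; rewrite Rabs_R0; lra | intros ? ? ? ?; auto].
  - intros a b r s [H1 [H2 H3]] [I1 [I2 I3]]; split; [lra|]; split.
    + intros x; specialize (H2 x); specialize (I2 x).
      eapply Rle_trans; [apply Rabs_triang | lra].
    + intros x e y He; rewrite (H3 x e y He), (I3 x e y He); auto.
  - intros k a r [H1 [H2 H3]]; split; [|split].
    + apply Rmult_le_pos; auto using Rabs_pos.
    + intros x; rewrite Rabs_mult; apply Rmult_le_compat_l; auto using Rabs_pos.
    + intros x e y He; rewrite (H3 x e y He); auto.
  - intros a b r s [H1 [H2 H3]] [I1 [I2 I3]] H; split; [|split]; auto.
    intros x; specialize (H2 x); specialize (H x). rewrite Rabs_right in * by lra; lra.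
  - intros a r [H1 [H2 H3]].
    exists (fun i => Rmax (a i) 0), (fun i => Rmax (- a i) 0).
    split; [|split; [|split; [|split]]].
    + split; [|split]; auto.
      * intros x; specialize (H2 x); rewrite Rabs_right by (apply Rle_ge, Rmax_r).
        pose proof (Rle_abs (a x)); apply Rmax_lub; lra.
      * intros x e y He; rewrite (H3 x e y He); auto.
    + split; [|split]; auto.
      * intros x; specialize (H2 x); rewrite Rabs_right by (apply Rle_ge, Rmax_r).
        pose proof (Rle_abs (- a x)); rewrite Rabs_Ropp in *; apply Rmax_lub; lra.
      * intros x e y He; rewrite (H3 x e y He); auto.
    + intros; apply Rmax_r.
    + intros; apply Rmax_r.
    + intros z; unfold Rmax; destruct (Rle_dec (a z) 0), (Rle_dec (- a z) 0); lra.
  - intros a b c d r s t u [H1 [H2 H3]] _ [I1 [I2 I3]] _ Pa Pb Pc Pd E.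
    exists (fun i => Rmin (a i) (c i)), r; split; [split; [|split]; auto|].
    + intros x; specialize (H2 x); pose proof (Rmin_l (a x) (c x)).
      assert (0 <= Rmin (a x) (c x)) by (apply Rmin_glb; auto).
      specialize (Pa x); rewrite Rabs_right in * by lra; lra.
    + intros x e y He; rewrite (H3 x e y He), (I3 x e y He); auto.
    + intros i; specialize (Pa i); specialize (Pb i); specialize (Pc i); specialize (Pd i);
        specialize (E i); unfold Rmin; destruct (Rle_dec (a i) (c i)); lra.
  - intros s a r [H1 [H2 H3]]; split; [|split]; auto.
    intros x e y He; rewrite !op_assoc, (H3 (op S s x) e y He); auto.
  - intros s a r [H1 [H2 H3]]; split; [|split]; auto.
    intros x e y He; rewrite <- (op_assoc S _ y s), (H3 x e (op S y s) He), op_assoc; auto.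
  - intros; rewrite op_assoc; auto.
  - intros; rewrite op_assoc; auto.
  - intros; rewrite op_assoc; auto.
  - intros a r e i [H1 [H2 H3]] He; apply invariant_l; auto.
  - intros a r e i [H1 [H2 H3]] He; apply invariant_r; auto.
Defined.

Definition is_unit {S : InvSemigroup} (A : fspace S) (u : pt (poscone A)) : Prop :=
  bd u 1 /\ (forall p c, bd p c -> exists z, plus p z = sc c u) /\
  forall s, pos_la A s u = u /\ pos_ra A s u = u.

Lemma base_unit S : exists u, is_unit (base S) u.
Proof.
  assert (H : (exists r, nb (base S) (fun _ => 1) r) /\ forall i : ix (base S), 0 <= 1).
  { split; [|intros; lra]. exists 1; split; [lra|]; split.
    - intros; rewrite Rabs_R1; lra.
    - intros ? ? ? ?; auto. }
  exists (mkpos (base S) _ H); split; [|split].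
  - split; [lra|]; split; [intros; simpl; rewrite Rabs_R1; lra | intros ? ? ? ?; auto].
  - intros p c [H1 [H2 _]]; apply pos_diff; intros i; simpl.
    specialize (H2 i); pose proof (Rle_abs (val (base S) p i)).
    rewrite (Rabs_right c) by lra. lra.
  - intros s; split; apply val_inj; auto.
Qed.

(** The new unit is evaluation at [u]. A positive functional [F] has norm at most [F u], by
    completing points to multiples of [u]; hence a functional on such [F] bounded by [c] lies below
    [c] times the evaluation. *)
Lemma next_next_unit S (A : fspace S) u : is_unit A u -> exists u'', is_unit (next (next A)) u''.
Proof.
  intros [U1 [U2 U3]].
  assert (B : forall F : pt (poscone (next A)), bd F (val (next A) F u)).
  { intros F; destruct (val_nb _ F) as [r Hr]; pose proof Hr as [F1 [F2 _]].
    split; [auto|]; split; [auto|]; split; [apply val_ge0|].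
    intros p c Hc; rewrite Rabs_right by (apply Rle_ge, val_ge0).
    destruct (U2 p c Hc) as [z Hz].
    pose proof (F1 p z) as E; rewrite Hz, F2 in E by (eapply bd_ge0; eauto).
    pose proof (val_ge0 (next A) F z); lra. }
  assert (H1 : nb (next (next A)) (fun F => val (next A) F u) 1).
  { split; [|split; [|split]].
    - reflexivity.
    - intros c x Hc; simpl; rewrite Rabs_right by lra; auto.
    - lra.
    - intros F c Hc; destruct Hc as [_ [_ [_ Hc]]]; specialize (Hc u 1 U1); lra. }
  assert (H : (exists r, nb (next (next A)) (fun F => val (next A) F u) r) /\
    forall F : ix (next (next A)), 0 <= val (next A) F u)
    by (split; [exists 1; exact H1 | intros; apply val_ge0]).
  exists (mkpos (next (next A)) _ H); split; [|split].
  - exact H1.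
  - intros p c Hp; apply pos_diff; intros F; simpl.
    pose proof Hp as [_ [_ [Hc0 Hp']]]; specialize (Hp' F _ (B F)).
    rewrite (Rabs_right c) by lra. eapply Rle_trans; [apply Rle_abs | exact Hp'].
  - intros s; split; apply val_inj; intros F; simpl; f_equal; apply (U3 s).
Qed.

(** * Absolutely summable families *)


Definition sumL {I : Type} (f : I -> R) (F : list I) : R := sum_list (map f F).

Section Sums.
Context {I : Type}.
Implicit Types (f g : I -> R) (F : list I).

Lemma sumL_app f F G : sumL f (F ++ G) = sumL f F + sumL f G.
Proof. unfold sumL; induction F as [|x F IH]; simpl; [ring | rewrite IH; ring]. Qed.

Lemma sumL_add f g F : sumL (fun i => f i + g i) F = sumL f F + sumL g F.
Proof. unfold sumL; induction F as [|x F IH]; simpl; [ring | rewrite IH; ring]. Qed.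

Lemma sumL_scal c f F : sumL (fun i => c * f i) F = c * sumL f F.
Proof. unfold sumL; induction F as [|x F IH]; simpl; [ring | rewrite IH; ring]. Qed.

Lemma sumL_le f g F : (forall i, In i F -> f i <= g i) -> sumL f F <= sumL g F.
Proof.
  unfold sumL; induction F as [|x F IH]; simpl; intros H; [lra|].
  pose proof (H x (or_introl eq_refl)).
  assert (sum_list (map f F) <= sum_list (map g F)) by (apply IH; auto). lra.
Qed.

Lemma sumL_nonneg f F : (forall i, 0 <= f i) -> 0 <= sumL f F.
Proof.
  intros H; unfold sumL; induction F as [|x F IH]; simpl; [lra | specialize (H x); lra].
Qed.

Lemma sumL_incl f F G : (forall i, 0 <= f i) -> NoDup F -> incl F G -> sumL f F <= sumL f G.
Proof.
  intros Hf HF; revert G; induction HF as [|x F Hx HF IH]; intros G HG.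
  - apply sumL_nonneg; auto.
  - destruct (in_split x G) as [G1 [G2 ->]]; [apply HG; left; auto|].
    assert (HI : incl F (G1 ++ G2)).
    { intros y Hy. assert (Hy' : In y (G1 ++ x :: G2)) by (apply HG; right; auto).
      apply in_app_or in Hy'; apply in_or_app; destruct Hy' as [Hy'|[->|Hy']]; auto; contradiction. }
    specialize (IH _ HI); rewrite sumL_app in *; unfold sumL in *; simpl in *; lra.
Qed.

Definition dedup F : list I := nodup (fun x y => excluded_middle_informative (x = y)) F.

Lemma dedup_NoDup F : NoDup (dedup F).
Proof. apply NoDup_nodup. Qed.

Lemma dedup_In F x : In x (dedup F) <-> In x F.
Proof. apply nodup_In. Qed.

Lemma has_sum_close f g l l' : has_sum f l -> has_sum g l' -> forall eps, 0 < eps ->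
  exists F0, forall F, NoDup F -> incl F0 F ->
    Rabs (sumL f F - l) < eps /\ Rabs (sumL g F - l') < eps.
Proof.
  intros Hf Hg eps He; destruct (Hf eps He) as [F0 H0]; destruct (Hg eps He) as [F1 H1].
  exists (F0 ++ F1); intros F HF Hi; apply incl_app_inv in Hi; destruct Hi; split; [apply H0 | apply H1]; auto.
Qed.

Lemma has_sum_le f g l l' : has_sum f l -> has_sum g l' -> (forall i, f i <= g i) -> l <= l'.
Proof.
  intros Hf Hg H; apply le_epsilon; intros eps He.
  destruct (has_sum_close f g l l' Hf Hg (eps / 2)) as [F0 H0]; [lra|].
  destruct (H0 (dedup F0)) as [H1 H2];
    [apply dedup_NoDup | intros x Hx; apply dedup_In; auto |].
  assert (sumL f (dedup F0) <= sumL g (dedup F0)) by (apply sumL_le; auto).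
  apply Rabs_def2 in H1; apply Rabs_def2 in H2; lra.
Qed.

Lemma has_sum_unique f l l' : has_sum f l -> has_sum f l' -> l = l'.
Proof. intros H H'; apply Rle_antisym; eapply has_sum_le; eauto; intros; lra. Qed.

Lemma tsum_eq f l : has_sum f l -> tsum f = l.
Proof.
  intros H; unfold tsum; destruct excluded_middle_informative as [h|n].
  - destruct constructive_indefinite_description as [x Hx]; simpl; eapply has_sum_unique; eauto.
  - exfalso; apply n; exists l; auto.
Qed.

Lemma summable_tsum f : summable f -> has_sum f (tsum f).
Proof. intros [l H]; rewrite (tsum_eq f l); auto. Qed.

Lemma has_sum_add f g l l' : has_sum f l -> has_sum g l' -> has_sum (fun i => f i + g i) (l + l').
Proof.
  intros Hf Hg eps He; destruct (has_sum_close f g l l' Hf Hg (eps / 2)) as [F0 H0]; [lra|].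
  exists F0; intros F HF Hi; destruct (H0 F HF Hi) as [H1 H2].
  change (sum_list (map (fun i => f i + g i) F)) with (sumL (fun i => f i + g i) F).
  rewrite sumL_add; replace (sumL f F + sumL g F - (l + l')) with ((sumL f F - l) + (sumL g F - l')) by ring.
  eapply Rle_lt_trans; [apply Rabs_triang | lra].
Qed.

Lemma has_sum_scal c f l : has_sum f l -> has_sum (fun i => c * f i) (c * l).
Proof.
  intros Hf eps He; pose proof (Rabs_pos c) as Hc.
  destruct (Hf (eps / (Rabs c + 1))) as [F0 H0]; [apply Rdiv_lt_0_compat; lra|].
  exists F0; intros F HF Hi; specialize (H0 F HF Hi).
  change (sum_list (map (fun i => c * f i) F)) with (sumL (fun i => c * f i) F).
  change (sum_list (map f F)) with (sumL f F) in H0.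
  rewrite sumL_scal; replace (c * sumL f F - c * l) with (c * (sumL f F - l)) by ring.
  rewrite Rabs_mult; apply Rle_lt_trans with (Rabs c * (eps / (Rabs c + 1))).
  - apply Rmult_le_compat_l; lra.
  - apply Rlt_le_trans with ((Rabs c + 1) * (eps / (Rabs c + 1))); [|right; field; lra].
    apply Rmult_lt_compat_r; [apply Rdiv_lt_0_compat; lra | lra].
Qed.

Lemma has_sum_partial f l F : (forall i, 0 <= f i) -> has_sum f l -> NoDup F -> sumL f F <= l.
Proof.
  intros Hf Hl HF; apply le_epsilon; intros eps He; destruct (Hl eps He) as [F0 H0].
  specialize (H0 (dedup (F0 ++ F)) (dedup_NoDup _)).
  assert (Hi : incl F0 (dedup (F0 ++ F)))
    by (intros x Hx; apply dedup_In, in_or_app; auto).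
  specialize (H0 Hi); apply Rabs_def2 in H0.
  change (sum_list (map f (dedup (F0 ++ F)))) with (sumL f (dedup (F0 ++ F))) in H0.
  assert (sumL f F <= sumL f (dedup (F0 ++ F))); [|lra].
  apply sumL_incl; auto; intros x Hx; apply dedup_In, in_or_app; auto.
Qed.

Lemma nonneg_has_sum f M : (forall i, 0 <= f i) -> (forall F, NoDup F -> sumL f F <= M) ->
  exists l, has_sum f l /\ l <= M.
Proof.
  intros Hf HM.
  destruct (completeness (fun r => exists F, NoDup F /\ r = sumL f F)) as [l [Hl1 Hl2]].
  - exists M; intros r [F [HF ->]]; auto.
  - exists 0, []; split; [constructor | reflexivity].
  - exists l; split; [|apply Hl2; intros r [F [HF ->]]; auto].
    intros eps He.
    assert (HF : exists F0, NoDup F0 /\ l - eps < sumL f F0).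
    { apply NNPP; intros Hn; assert (l <= l - eps); [|lra].
      apply Hl2; intros r [F [HF ->]]; apply Rnot_lt_le; intros H; apply Hn; exists F; auto. }
    destruct HF as [F0 [HF0 H0]]; exists F0; intros F HF Hi.
    change (sum_list (map f F)) with (sumL f F).
    assert (sumL f F0 <= sumL f F) by (apply sumL_incl; auto).
    assert (sumL f F <= l) by (apply Hl1; exists F; auto).
    apply Rabs_def1; lra.
Qed.

Lemma has_sum_ext f g l : has_sum f l -> (forall i, f i = g i) -> has_sum g l.
Proof. intros H E; assert (f = g) as <- by (apply functional_extensionality; auto); auto. Qed.

Lemma dominated_has_sum f g : summable g -> (forall i, Rabs (f i) <= g i) ->
  has_sum f (tsum f) /\ Rabs (tsum f) <= tsum g.
Proof.
  intros Hg H; pose proof (summable_tsum g Hg) as Hg'.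
  assert (Hb : forall i, - g i <= f i <= g i).
  { intros i; specialize (H i); pose proof (Rle_abs (f i)); pose proof (Rle_abs (- f i)).
    rewrite Rabs_Ropp in *; lra. }
  (* Adding the dominating family makes the terms nonnegative; it is subtracted again afterwards. *)
  destruct (nonneg_has_sum (fun i => f i + g i) (2 * tsum g)) as [l [Hl _]].
  - intros i; specialize (Hb i); lra.
  - intros F HF; apply Rle_trans with (sumL (fun i => 2 * g i) F).
    + apply sumL_le; intros i _; specialize (Hb i); lra.
    + rewrite sumL_scal; apply Rmult_le_compat_l; [lra|].
      apply has_sum_partial; auto. intros i; specialize (Hb i); lra.
  - assert (Hf : has_sum f (l + (-1) * tsum g)).
    { eapply has_sum_ext; [apply has_sum_add; [exact Hl | apply has_sum_scal; exact Hg']|].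
      intros i; simpl; ring. }
    rewrite (tsum_eq _ _ Hf); split; auto.
    apply Rabs_le; split.
    + replace (- tsum g) with ((-1) * tsum g) by ring.
      eapply has_sum_le; [apply has_sum_scal; exact Hg' | exact Hf |].
      intros i; specialize (Hb i); simpl; lra.
    + eapply has_sum_le; [exact Hf | exact Hg' |]; intros i; apply Hb.
Qed.

Lemma has_sum_single f a : (forall i, i <> a -> f i = 0) -> has_sum f (f a).
Proof.
  intros H eps He; exists [a]; intros F HF Hi.
  destruct (in_split a F) as [F1 [F2 ->]]; [apply Hi; left; auto|].
  apply NoDup_remove_2 in HF.
  assert (Z : forall G, ~ In a G -> sumL f G = 0).
  { intros G; induction G as [|x G IH]; intros Hn; unfold sumL in *; simpl; auto.
    rewrite (H x), IH; [ring | |]; simpl in Hn; intuition. }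
  change (sum_list (map f (F1 ++ a :: F2))) with (sumL f (F1 ++ a :: F2)).
  rewrite sumL_app; change (sumL f (a :: F2)) with (f a + sumL f F2).
  rewrite !Z by (intros Hn; apply HF, in_or_app; auto).
  replace (0 + (f a + 0) - f a) with 0 by ring. rewrite Rabs_R0; auto.
Qed.

End Sums.

Lemma Cpx_eq x y : re x = re y -> im x = im y -> x = y.
Proof. destruct x, y; simpl; intros; subst; auto. Qed.

Ltac cring := apply Cpx_eq; simpl; ring.

Lemma Cnorm_ge0 x : 0 <= Cnorm x.
Proof. apply sqrt_pos. Qed.

Lemma Cnorm_sq x : Cnorm x * Cnorm x = re x * re x + im x * im x.
Proof. apply sqrt_sqrt; nra. Qed.

Lemma Rabs_le_of_sq a b : 0 <= b -> a * a <= b * b -> Rabs a <= b.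
Proof. intros Hb H; apply Rabs_le; split; nra. Qed.

Lemma re_le_Cnorm x : Rabs (re x) <= Cnorm x.
Proof. apply Rabs_le_of_sq; [apply Cnorm_ge0 | rewrite Cnorm_sq; nra]. Qed.

Lemma im_le_Cnorm x : Rabs (im x) <= Cnorm x.
Proof. apply Rabs_le_of_sq; [apply Cnorm_ge0 | rewrite Cnorm_sq; nra]. Qed.

Lemma Cnorm_le_sum x : Cnorm x <= Rabs (re x) + Rabs (im x).
Proof.
  pose proof (Rabs_pos (re x)); pose proof (Rabs_pos (im x)); pose proof (Cnorm_ge0 x).
  pose proof (Cnorm_sq x) as E.
  assert (E1 : re x * re x = Rabs (re x) * Rabs (re x)) by apply (Rsqr_abs (re x)).
  assert (E2 : im x * im x = Rabs (im x) * Rabs (im x)) by apply (Rsqr_abs (im x)).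
  nra.
Qed.

Lemma Cnorm_mul x y : Cnorm (Cmul x y) = Cnorm x * Cnorm y.
Proof.
  unfold Cnorm; rewrite <- sqrt_mult by nra; f_equal; simpl; ring.
Qed.

Lemma Cnorm_add x y : Cnorm (Cadd x y) <= Cnorm x + Cnorm y.
Proof.
  pose proof (Cnorm_ge0 x) as Hx; pose proof (Cnorm_ge0 y) as Hy.
  pose proof (Cnorm_ge0 (Cadd x y)) as Hxy.
  pose proof (Cnorm_sq x) as Ex; pose proof (Cnorm_sq y) as Ey.
  pose proof (Cnorm_sq (Cadd x y)) as Exy; simpl in Exy.
  assert (CS : re x * re y + im x * im y <= Cnorm x * Cnorm y).
  { eapply Rle_trans; [apply Rle_abs|]. apply Rabs_le_of_sq; [nra|].
    replace (Cnorm x * Cnorm y * (Cnorm x * Cnorm y))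
      with ((Cnorm x * Cnorm x) * (Cnorm y * Cnorm y)) by ring.
    rewrite Ex, Ey. pose proof (Rle_0_sqr (re x * im y - im x * re y)) as Q; unfold Rsqr in Q. nra. }
  nra.
Qed.

Lemma Cnorm_C0 : Cnorm C0 = 0.
Proof. unfold Cnorm; simpl; replace (0 * 0 + 0 * 0) with 0 by ring; apply sqrt_0. Qed.

Lemma Cnorm_C1 : Cnorm C1 = 1.
Proof. unfold Cnorm; simpl; replace (1 * 1 + 0 * 0) with 1 by ring; apply sqrt_1. Qed.

Lemma Cnorm_eq0 x : Cnorm x <= 0 -> x = C0.
Proof.
  intros H; pose proof (Cnorm_ge0 x); pose proof (Cnorm_sq x).
  apply Cpx_eq; simpl; nra.
Qed.

Lemma Cnorm_opp x : Cnorm (Copp x) = Cnorm x.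
Proof. unfold Cnorm; simpl; f_equal; ring. Qed.

Section ComplexSums.
Context {I : Type}.
Implicit Types (f g : I -> Cpx).

Definition abs_summable f : Prop := summable (fun i => Cnorm (f i)).

Lemma abs_summable_re f : abs_summable f -> has_sum (fun i => re (f i)) (re (tsumC f)).
Proof.
  intros H; apply (dominated_has_sum _ _ H); intros; apply re_le_Cnorm.
Qed.

Lemma abs_summable_im f : abs_summable f -> has_sum (fun i => im (f i)) (im (tsumC f)).
Proof.
  intros H; apply (dominated_has_sum _ _ H); intros; apply im_le_Cnorm.
Qed.

Lemma tsumC_add f g : abs_summable f -> abs_summable g ->
  tsumC (fun i => Cadd (f i) (g i)) = Cadd (tsumC f) (tsumC g).
Proof.
  intros Hf Hg; apply Cpx_eq; simpl; apply tsum_eq.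
  - exact (has_sum_add _ _ _ _ (abs_summable_re f Hf) (abs_summable_re g Hg)).
  - exact (has_sum_add _ _ _ _ (abs_summable_im f Hf) (abs_summable_im g Hg)).
Qed.

Lemma tsumC_scal c f : abs_summable f ->
  tsumC (fun i => Cmul c (f i)) = Cmul c (tsumC f).
Proof.
  intros Hf; pose proof (abs_summable_re f Hf) as H1; pose proof (abs_summable_im f Hf) as H2.
  apply Cpx_eq; simpl; apply tsum_eq.
  - replace (re c * tsum (fun i => re (f i)) - im c * tsum (fun i => im (f i))) with
      (re c * re (tsumC f) + - im c * im (tsumC f)) by (simpl; ring).
    eapply has_sum_ext; [apply (has_sum_add _ _ _ _ (has_sum_scal (re c) _ _ H1)
      (has_sum_scal (- im c) _ _ H2))|]; intros; simpl; ring.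
  - eapply has_sum_ext; [apply (has_sum_add _ _ _ _ (has_sum_scal (re c) _ _ H2)
      (has_sum_scal (im c) _ _ H1))|]; intros; simpl; ring.
Qed.

(** Real and imaginary sums are estimated separately, which costs the factor 2. *)
Lemma Cnorm_tsumC f (g : I -> R) : summable g -> (forall i, Cnorm (f i) <= g i) -> Cnorm (tsumC f) <= 2 * tsum g.
Proof.
  intros Hg H; eapply Rle_trans; [apply Cnorm_le_sum|]; simpl.
  destruct (dominated_has_sum (fun i => re (f i)) g Hg) as [_ H1];
    [intros; eapply Rle_trans; [apply re_le_Cnorm | auto]|].
  destruct (dominated_has_sum (fun i => im (f i)) g Hg) as [_ H2];
    [intros; eapply Rle_trans; [apply im_le_Cnorm | auto]|].
  lra.
Qed.

Lemma tsumC_single f a : (forall i, i <> a -> f i = C0) -> tsumC f = f a.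
Proof.
  intros H; apply Cpx_eq; simpl; apply tsum_eq.
  - apply (has_sum_single (fun i => re (f i))); intros i Hi; rewrite H; auto.
  - apply (has_sum_single (fun i => im (f i))); intros i Hi; rewrite H; auto.
Qed.

Lemma dominated_summable (f g : I -> R) : summable g -> (forall i, 0 <= f i <= g i) -> summable f.
Proof.
  intros Hg H; exists (tsum f); apply (dominated_has_sum f g Hg).
  intros i; rewrite Rabs_right; [apply H | apply Rle_ge, H].
Qed.

End ComplexSums.

Section L1Space.
Context {S : InvSemigroup}.
Implicit Types (f g : L S).

Lemma l1_add f g : l1 f -> l1 g -> l1 (Ladd f g).
Proof.
  intros Hf Hg; apply (dominated_summable _ (fun s => Cnorm (f s) + Cnorm (g s))).
  - eexists; apply has_sum_add; apply summable_tsum; assumption.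
  - intros s; split; [apply Cnorm_ge0 | apply Cnorm_add].
Qed.

Lemma l1_scal c f : l1 f -> l1 (Lscal c f).
Proof.
  intros Hf; exists (Cnorm c * norm1 f).
  eapply has_sum_ext; [apply has_sum_scal, (summable_tsum _ Hf)|].
  intros s; unfold Lscal; rewrite Cnorm_mul; auto.
Qed.

Lemma norm1_ge0 f : l1 f -> 0 <= norm1 f.
Proof.
  intros Hf; pose proof (has_sum_partial (fun s => Cnorm (f s)) (norm1 f) [] (fun s => Cnorm_ge0 _)
    (summable_tsum _ Hf) (NoDup_nil _)) as H; exact H.
Qed.

Lemma norm1_scal c f : l1 f -> norm1 (Lscal c f) = Cnorm c * norm1 f.
Proof.
  intros Hf; apply tsum_eq.
  eapply has_sum_ext; [apply has_sum_scal, (summable_tsum _ Hf)|].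
  intros s; unfold Lscal; rewrite Cnorm_mul; auto.
Qed.

Lemma delta_same (s : S) : delta S s s = C1.
Proof. unfold delta; destruct excluded_middle_informative; [auto | contradiction]. Qed.

Lemma delta_other (s u : S) : u <> s -> delta S s u = C0.
Proof. unfold delta; destruct excluded_middle_informative; [contradiction | auto]. Qed.

Lemma l1_delta (s : S) : l1 (delta S s).
Proof.
  eexists; apply (has_sum_single (fun u => Cnorm (delta S s u)) s).
  intros u Hu; rewrite delta_other, Cnorm_C0; auto.
Qed.

Definition l1_bounded (T : L S -> Cpx) (M : R) : Prop :=
  (forall f g, l1 f -> l1 g -> T (Ladd f g) = Cadd (T f) (T g)) /\
  (forall c f, l1 f -> T (Lscal c f) = Cmul c (T f)) /\
  (forall f, l1 f -> Cnorm (T f) <= M * norm1 f).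

Definition restrict f (F : list S) : L S :=
  fun s => if excluded_middle_informative (In s F) then f s else C0.

Lemma l1_dominated f g : l1 g -> (forall s, Cnorm (f s) <= Cnorm (g s)) -> l1 f.
Proof.
  intros Hg H; apply (dominated_summable _ _ Hg); intros s; split; [apply Cnorm_ge0 | apply H].
Qed.

Lemma l1_restrict f F : l1 f -> l1 (restrict f F).
Proof.
  intros Hf; apply (l1_dominated _ f Hf); intros s; unfold restrict.
  destruct excluded_middle_informative; [lra | rewrite Cnorm_C0; apply Cnorm_ge0].
Qed.

Lemma restrict_cons f x F : ~ In x F ->
  restrict f (x :: F) = Ladd (Lscal (f x) (delta S x)) (restrict f F).
Proof.
  intros Hx; apply functional_extensionality; intros s; unfold restrict, Ladd, Lscal.
  destruct (classic (s = x)) as [->|Hs].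
  - rewrite delta_same; destruct excluded_middle_informative as [_|n]; [|simpl in n; tauto].
    destruct excluded_middle_informative as [|_]; [contradiction|]. cring.
  - rewrite delta_other by auto.
    destruct (excluded_middle_informative (In s (x :: F))) as [i|n],
      (excluded_middle_informative (In s F)) as [i'|n']; simpl in *; try cring.
    + exfalso; intuition.
    + exfalso; intuition.
Qed.

(** Finite truncations are killed by linearity and the tail is small in norm. Testing only on the
    support of [f] matters for elements of [l1(E)], where just the idempotents are available. *)
Lemma l1_functional_zero T M f : l1_bounded T M -> l1 f ->
  (forall s, f s <> C0 -> T (delta S s) = C0) -> T f = C0.
Proof.
  intros [T1 [T2 T3]] Hf H.
  assert (T0 : forall F, NoDup F -> T (restrict f F) = C0).
  { intros F HF; induction HF as [|x F Hx HF IH].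
    - assert (E : restrict f [] = Lscal C0 f).
      { apply functional_extensionality; intros s; unfold restrict, Lscal.
        destruct excluded_middle_informative as [i|_]; [destruct i|]. cring. }
      rewrite E, T2 by auto; cring.
    - rewrite restrict_cons, T1, T2, IH by auto using l1_scal, l1_delta, l1_restrict.
      destruct (classic (f x = C0)) as [E|E]; [rewrite E | rewrite (H x E)]; cring. }
  apply Cnorm_eq0, le_epsilon; intros eps He.
  assert (He' : 0 < eps / (Rabs M + 1)) by (pose proof (Rabs_pos M); apply Rdiv_lt_0_compat; lra).
  destruct (summable_tsum _ Hf _ He') as [F0 H0].
  set (F := dedup F0).
  assert (HF : NoDup F) by apply dedup_NoDup.
  specialize (H0 F HF ltac:(intros x Hx; apply dedup_In; auto)).
  set (tl := Lsub f (restrict f F)).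
  assert (Htl : forall s, Cnorm (f s) = Cnorm (restrict f F s) + Cnorm (tl s)).
  { intros s; unfold tl, Lsub, Ladd, Lopp, restrict.
    destruct excluded_middle_informative.
    - replace (Cadd (f s) (Copp (f s))) with C0 by cring. rewrite Cnorm_C0; ring.
    - replace (Cadd (f s) (Copp C0)) with (f s) by cring. rewrite Cnorm_C0; ring. }
  assert (Ltl : l1 tl).
  { apply (l1_dominated _ f Hf); intros s; rewrite (Htl s).
    pose proof (Cnorm_ge0 (restrict f F s)); lra. }
  pose proof (l1_restrict f F Hf) as Lr.
  assert (N : norm1 f = norm1 (restrict f F) + norm1 tl).
  { apply tsum_eq; eapply has_sum_ext; [apply has_sum_add; [apply (summable_tsum _ Lr) | apply (summable_tsum _ Ltl)]|].
    intros s; simpl; rewrite (Htl s); auto. }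
  assert (N2 : sumL (fun s => Cnorm (f s)) F <= norm1 (restrict f F)).
  { apply Rle_trans with (sumL (fun s => Cnorm (restrict f F s)) F).
    - apply sumL_le; intros s Hs; unfold restrict.
      destruct excluded_middle_informative; [lra | contradiction].
    - apply has_sum_partial; auto using Cnorm_ge0. apply (summable_tsum _ Lr). }
  apply Rabs_def2 in H0.
  change (sum_list (map (fun s => Cnorm (f s)) F)) with (sumL (fun s => Cnorm (f s)) F) in H0.
  change (tsum (fun s => Cnorm (f s))) with (norm1 f) in H0.
  assert (E : f = Ladd (restrict f F) tl).
  { apply functional_extensionality; intros s; unfold tl, Lsub, Ladd, Lopp; cring. }
  assert (ET : T f = T tl).
  { rewrite E at 1; rewrite T1, T0 by auto; cring. }
  rewrite ET, Rplus_0_l; eapply Rle_trans; [apply T3; auto|].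
  pose proof (norm1_ge0 tl Ltl); pose proof (Rle_abs M); pose proof (Rabs_pos M).
  apply Rle_trans with ((Rabs M + 1) * norm1 tl); [apply Rmult_le_compat_r; lra|].
  apply Rle_trans with ((Rabs M + 1) * (eps / (Rabs M + 1))); [|right; field; lra].
  apply Rmult_le_compat_l; lra.
Qed.

Lemma l1_bounded_sub T T' M M' : l1_bounded T M -> l1_bounded T' M' ->
  l1_bounded (fun f => Csub (T f) (T' f)) (M + M').
Proof.
  intros [H1 [H2 H3]] [I1 [I2 I3]]; split; [|split].
  - intros f g Hf Hg; rewrite H1, I1 by auto; cring.
  - intros c f Hf; rewrite H2, I2 by auto; cring.
  - intros f Hf; specialize (H3 f Hf); specialize (I3 f Hf).
    unfold Csub; eapply Rle_trans; [apply Cnorm_add|]; rewrite Cnorm_opp; lra.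
Qed.

Lemma l1_functional_eq T T' M M' f : l1_bounded T M -> l1_bounded T' M' -> l1 f ->
  (forall s, f s <> C0 -> T (delta S s) = T' (delta S s)) -> T f = T' f.
Proof.
  intros HT HT' Hf H.
  pose proof (l1_functional_zero _ _ f (l1_bounded_sub _ _ _ _ HT HT') Hf) as E.
  assert (E' : Csub (T f) (T' f) = C0) by (apply E; intros s Hs; rewrite (H s Hs); cring).
  injection E' as E1 E2; apply Cpx_eq; lra.
Qed.

Section Bconv.
Context (m : S -> S -> S).

Let fiber (u : S) : Type := {p : S * S | m (fst p) (snd p) = u}.

Lemma product_bound f g (G : list (S * S)) : l1 f -> l1 g -> NoDup G ->
  sumL (fun p => Cnorm (f (fst p)) * Cnorm (g (snd p))) G <= norm1 f * norm1 g.
Proof.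
  intros Hf Hg HG.
  set (A := dedup (map fst G)); set (B := dedup (map snd G)).
  apply Rle_trans with (sumL (fun p => Cnorm (f (fst p)) * Cnorm (g (snd p))) (list_prod A B)).
  - apply sumL_incl; auto.
    + intros p; apply Rmult_le_pos; apply Cnorm_ge0.
    + intros [x y] Hp; apply in_prod; apply dedup_In.
      * apply (in_map fst _ _ Hp).
      * apply (in_map snd _ _ Hp).
  - assert (E : forall A B, sumL (fun p => Cnorm (f (fst p)) * Cnorm (g (snd p))) (list_prod A B) =
      sumL (fun s => Cnorm (f s)) A * sumL (fun s => Cnorm (g s)) B).
    { clear; intros A B; induction A as [|x A IH]; simpl; [unfold sumL; simpl; ring|].
      rewrite sumL_app, IH.
      assert (E : sumL (fun p => Cnorm (f (fst p)) * Cnorm (g (snd p))) (map (fun y => (x, y)) B) =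
        Cnorm (f x) * sumL (fun s => Cnorm (g s)) B).
      { unfold sumL; rewrite map_map; simpl.
        exact (sumL_scal (Cnorm (f x)) (fun s => Cnorm (g s)) B). }
      rewrite E; unfold sumL; simpl; ring. }
    rewrite E; apply Rmult_le_compat.
    + apply sumL_nonneg; intros; apply Cnorm_ge0.
    + apply sumL_nonneg; intros; apply Cnorm_ge0.
    + apply has_sum_partial; auto using Cnorm_ge0; [apply (summable_tsum _ Hf) | apply dedup_NoDup].
    + apply has_sum_partial; auto using Cnorm_ge0; [apply (summable_tsum _ Hg) | apply dedup_NoDup].
Qed.

Lemma map_proj1_NoDup {X : Type} (P : X -> Prop) (G : list {x | P x}) :
  NoDup G -> NoDup (map (@proj1_sig _ _) G).
Proof.
  intros H; induction H as [|x G Hx HG IH]; simpl; constructor; auto.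
  intros Hi; apply in_map_iff in Hi; destruct Hi as [y [E Hy]]; apply Hx.
  replace x with y; auto. destruct x as [x p], y as [y q]; simpl in E; subst y.
  f_equal; apply proof_irrelevance.
Qed.

Lemma fiber_summable f g u : l1 f -> l1 g ->
  abs_summable (fun p : fiber u => Cmul (f (fst (proj1_sig p))) (g (snd (proj1_sig p)))).
Proof.
  intros Hf Hg.
  destruct (nonneg_has_sum (fun p : fiber u =>
    Cnorm (Cmul (f (fst (proj1_sig p))) (g (snd (proj1_sig p))))) (norm1 f * norm1 g)) as [l [Hl _]].
  - intros; apply Cnorm_ge0.
  - intros F HF. eapply Rle_trans; [|apply (product_bound f g (map (@proj1_sig _ _) F)); auto].
    + right; unfold sumL; rewrite map_map; f_equal; apply map_ext; intros p; apply Cnorm_mul.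
    + apply map_proj1_NoDup; auto.
  - exists l; auto.
Qed.

Lemma bconv_norm f g : l1 f -> l1 g -> l1 (bconv m f g) /\ norm1 (bconv m f g) <= 2 * (norm1 f * norm1 g).
Proof.
  intros Hf Hg.
  set (Phi := fun p : S * S => Cnorm (f (fst p)) * Cnorm (g (snd p))).
  assert (Phi0 : forall p, 0 <= Phi p) by (intros; apply Rmult_le_pos; apply Cnorm_ge0).
  destruct (nonneg_has_sum Phi (norm1 f * norm1 g) Phi0) as [l [Hl Hl']];
    [intros; apply product_bound; auto|].
  (* The fibres of [m] become functions on all pairs. Each pair lies in one fibre, so finitely many
     of these functions add up to at most [Phi]. *)
  set (on := fun u (p : S * S) => if excluded_middle_informative (m (fst p) (snd p) = u) then Phi p else 0).
  assert (on0 : forall u p, 0 <= on u p <= Phi p)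
    by (intros u p; unfold on; specialize (Phi0 p); destruct excluded_middle_informative; lra).
  assert (Hon : forall u, summable (on u)).
  { intros u; apply (dominated_summable _ Phi); [exists l; auto | apply on0]. }
  assert (B : forall u, Cnorm (bconv m f g u) <= 2 * tsum (on u)).
  { intros u.
    destruct (nonneg_has_sum (fun p : fiber u => Phi (proj1_sig p)) (tsum (on u))) as [k [Hk Hk']].
    - intros; apply Phi0.
    - intros F HF.
      apply Rle_trans with (sumL (on u) (map (@proj1_sig _ _) F)).
      + right; unfold sumL; rewrite map_map; f_equal; apply map_ext; intros [p Hp]; simpl.
        unfold on; destruct excluded_middle_informative; [auto | contradiction].
      + apply has_sum_partial; [apply on0 | apply summable_tsum; auto | apply map_proj1_NoDup; auto].
    - eapply Rle_trans; [apply (Cnorm_tsumC _ (fun p : fiber u => Phi (proj1_sig p)))|].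
      + exists k; auto.
      + intros p; right; apply Cnorm_mul.
      + rewrite (tsum_eq _ _ Hk); lra. }
  assert (D : forall F, NoDup F ->
    has_sum (fun p => sumL (fun u => on u p) F) (sumL (fun u => tsum (on u)) F)).
  { intros F _; induction F as [|u F IH].
    - unfold sumL; simpl. replace 0 with (0 * l) by ring.
      eapply has_sum_ext; [apply (has_sum_scal 0 _ _ Hl)|]; intros; simpl; ring.
    - exact (has_sum_add _ _ _ _ (summable_tsum _ (Hon u)) IH). }
  destruct (nonneg_has_sum (fun u => Cnorm (bconv m f g u)) (2 * (norm1 f * norm1 g))) as [k [Hk Hk']].
  - intros; apply Cnorm_ge0.
  - intros F HF.
    apply Rle_trans with (sumL (fun u => 2 * tsum (on u)) F); [apply sumL_le; auto|].
    rewrite sumL_scal; apply Rmult_le_compat_l; [lra|].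
    eapply Rle_trans; [|exact Hl'].
    eapply has_sum_le; [apply (D F HF) | exact Hl |].
    intros p; unfold on; specialize (Phi0 p).
    set (v := m (fst p) (snd p)).
    assert (Z : forall F, ~ In v F -> sumL (fun u => if excluded_middle_informative (v = u) then Phi p else 0) F = 0).
    { clear; intros F; induction F as [|x F IH]; intros Hn; unfold sumL in *; simpl; auto.
      destruct excluded_middle_informative; simpl in Hn; [exfalso; intuition|].
      rewrite IH by tauto; ring. }
    destruct (classic (In v F)) as [Hi|Hi]; [|rewrite Z; auto].
    destruct (in_split v F Hi) as [F1 [F2 ->]]; apply NoDup_remove_2 in HF.
    rewrite sumL_app; unfold sumL at 2; simpl.
    match goal with |- context [sum_list (map ?h F2)] => change (sum_list (map h F2)) with (sumL h F2) end.
    rewrite !Z by (intros Hn; apply HF, in_or_app; auto).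
    destruct excluded_middle_informative; lra.
  - split; [exists k; auto|]. unfold norm1; rewrite (tsum_eq _ _ Hk); auto.
Qed.

Lemma bconv_add_l f f' g : l1 f -> l1 f' -> l1 g ->
  bconv m (Ladd f f') g = Ladd (bconv m f g) (bconv m f' g).
Proof.
  intros Hf Hf' Hg; apply functional_extensionality; intros u; unfold bconv, Ladd at 2.
  rewrite <- tsumC_add by (apply fiber_summable; auto).
  f_equal; apply functional_extensionality; intros p; unfold Ladd; cring.
Qed.

Lemma bconv_add_r f g g' : l1 f -> l1 g -> l1 g' ->
  bconv m f (Ladd g g') = Ladd (bconv m f g) (bconv m f g').
Proof.
  intros Hf Hg Hg'; apply functional_extensionality; intros u; unfold bconv, Ladd at 2.
  rewrite <- tsumC_add by (apply fiber_summable; auto).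
  f_equal; apply functional_extensionality; intros p; unfold Ladd; cring.
Qed.

Lemma bconv_scal_l c f g : l1 f -> l1 g -> bconv m (Lscal c f) g = Lscal c (bconv m f g).
Proof.
  intros Hf Hg; apply functional_extensionality; intros u; unfold bconv, Lscal at 2.
  rewrite <- tsumC_scal by (apply fiber_summable; auto).
  f_equal; apply functional_extensionality; intros p; unfold Lscal; cring.
Qed.

Lemma bconv_scal_r c f g : l1 f -> l1 g -> bconv m f (Lscal c g) = Lscal c (bconv m f g).
Proof.
  intros Hf Hg; apply functional_extensionality; intros u; unfold bconv, Lscal at 2.
  rewrite <- tsumC_scal by (apply fiber_summable; auto).
  f_equal; apply functional_extensionality; intros p; unfold Lscal; cring.
Qed.

Lemma bconv_delta s t : bconv m (delta S s) (delta S t) = delta S (m s t).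
Proof.
  apply functional_extensionality; intros u; unfold bconv.
  destruct (classic (u = m s t)) as [->|Hu].
  - rewrite delta_same.
    rewrite (tsumC_single _ (exist (fun p => m (fst p) (snd p) = m s t) (s, t) eq_refl)).
    + simpl; rewrite !delta_same; cring.
    + intros [[x y] Hp] Hn; simpl in *.
      destruct (classic (x = s)) as [->|Hx]; [|rewrite (delta_other s) by auto; cring].
      destruct (classic (y = t)) as [->|Hy]; [|rewrite (delta_other t) by auto; cring].
      exfalso; apply Hn; f_equal; apply proof_irrelevance.
  - rewrite delta_other by auto.
    assert (E : forall p : fiber u, Cmul (delta S s (fst (proj1_sig p))) (delta S t (snd (proj1_sig p))) = C0).
    { intros [[x y] Hp]; simpl in *.
      destruct (classic (x = s)) as [->|Hx]; [|rewrite (delta_other s) by auto; cring].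
      destruct (classic (y = t)) as [->|Hy]; [|rewrite (delta_other t) by auto; cring].
      exfalso; auto. }
    assert (Z : forall I : Type, tsum (fun _ : I => 0) = 0).
    { intros I; apply tsum_eq; intros eps He; exists []; intros F _ _.
      assert (sum_list (map (fun _ : I => 0) F) = 0) as ->
        by (induction F; simpl; [|rewrite IHF]; ring).
      rewrite Rminus_diag, Rabs_R0; auto. }
    transitivity (tsumC (fun _ : fiber u => C0)).
    + f_equal; apply functional_extensionality, E.
    + apply Cpx_eq; simpl; apply Z.
Qed.

End Bconv.

Lemma actEl_delta (e : S) f : actEl (delta S e) f = f.
Proof.
  apply functional_extensionality; intros u; unfold actEl, bconv.
  rewrite (tsumC_single _ (exist (fun p : S * S => snd p = u) (e, u) eq_refl)).
  - simpl; rewrite delta_same; cring.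
  - intros [[x y] Hp] Hn; simpl in *; subst y.
    destruct (classic (x = e)) as [->|Hx]; [exfalso; apply Hn; reflexivity|].
    rewrite delta_other by auto; cring.
Qed.

End L1Space.

(** * The levels of the iterated dual *)


Definition Creal (c : R) : Cpx := mkC c 0.
Definition Cm1 : Cpx := Creal (-1).

Section Levels.
Context {S : InvSemigroup}.

(* Equality as seen by the dual. At level 0 this avoids having to show that an element which all functionals
   on [l1 S / J] annihilate lies in [J]. *)
Definition weqv (V : Lev S) (x y : T V) : Prop := forall F, mem (dual V) F -> F x = F y.

(** Continuity in [act_nle] is tested through functionals. This is the form that passes to the dual,
    and at level 0 it needs only that invariant functionals stay invariant under the action. *)
Record action (V : Lev S) (o : L S -> T V -> T V) : Prop := {
  act_mem : forall a x, l1 a -> mem V x -> mem V (o a x) ;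
  act_add_r : forall a x y, l1 a -> mem V x -> mem V y ->
    weqv V (o a (add V x y)) (add V (o a x) (o a y)) ;
  act_scal_r : forall a c x, l1 a -> mem V x -> weqv V (o a (scal V c x)) (scal V c (o a x)) ;
  act_add_l : forall a b x, l1 a -> l1 b -> mem V x ->
    weqv V (o (Ladd a b) x) (add V (o a x) (o b x)) ;
  act_scal_l : forall a c x, l1 a -> mem V x -> weqv V (o (Lscal c a) x) (scal V c (o a x)) ;
  act_nle : exists C, 0 <= C /\ forall a x s F r, l1 a -> mem V x -> nle V x s ->
    mem (dual V) F -> nle (dual V) F r -> Cnorm (F (o a x)) <= r * (C * norm1 a * s)
}.

Record good (V : Lev S) : Prop := {
  good_add : forall x y, mem V x -> mem V y -> mem V (add V x y) ;
  good_scal : forall c x, mem V x -> mem V (scal V c x) ;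
  good_nle_ge0 : forall x s, mem V x -> nle V x s -> 0 <= s ;
  good_ex : exists x, mem V x /\ nle V x 1 ;
  good_nle_ex : forall x, mem V x -> exists s, nle V x s ;
  good_lS : action V (lS V) ;
  good_rS : action V (fun a x => rS V x a) ;
  good_lE : action V (lE V) ;
  good_rE : action V (fun a x => rE V x a) ;
  good_comm : forall a x, l1E a -> mem V x -> weqv V (lE V a x) (rE V x a) ;
  good_lE1 : forall e x, idempotent S e -> mem V x -> weqv V (lE V (delta S e) x) x
}.

Lemma l1E_delta (e : S) : idempotent S e -> l1E (delta S e).
Proof.
  intros He; split; [apply l1_delta|]. intros s Hs.
  destruct (classic (s = e)) as [->|Hn]; auto. rewrite delta_other in Hs; auto; contradiction.
Qed.

Section DualLevel.
Variable V : Lev S.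
Hypothesis HV : good V.

Lemma dual_add F G : mem (dual V) F -> mem (dual V) G -> mem (dual V) (add (dual V) F G).
Proof.
  intros [F1 [F2 [r F3]]] [G1 [G2 [s G3]]]; simpl; split; [|split].
  - intros x y Hx Hy; rewrite F1, G1 by auto; cring.
  - intros c x Hx; rewrite F2, G2 by auto; cring.
  - exists (r + s); intros x t Hx Ht; specialize (F3 x t Hx Ht); specialize (G3 x t Hx Ht).
    eapply Rle_trans; [apply Cnorm_add | lra].
Qed.

Lemma dual_scal c F : mem (dual V) F -> mem (dual V) (scal (dual V) c F).
Proof.
  intros [F1 [F2 [r F3]]]; simpl; split; [|split].
  - intros x y Hx Hy; rewrite F1 by auto; cring.
  - intros d x Hx; rewrite F2 by auto; cring.
  - exists (Cnorm c * r); intros x t Hx Ht; specialize (F3 x t Hx Ht).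
    rewrite Cnorm_mul, Rmult_assoc; apply Rmult_le_compat_l; auto using Cnorm_ge0.
Qed.

(** [F] and [G] may differ as Coq functions outside the genuine elements of [V]; but their
    difference has norm bound 0, so a bounded functional cannot tell them apart. *)
Lemma eqv_weqv F G : mem (dual V) F -> mem (dual V) G -> eqv (dual V) F G -> weqv (dual V) F G.
Proof.
  intros HF HG E Xi [X1 [X2 [r X3]]].
  pose proof (dual_scal Cm1 G HG) as HG'.
  pose proof (X3 (add (dual V) F (scal (dual V) Cm1 G)) 0 (dual_add _ _ HF HG')) as B.
  rewrite X1, X2 in B by auto.
  assert (Z : Cadd (Xi F) (Cmul Cm1 (Xi G)) = C0).
  { apply Cnorm_eq0; rewrite <- (Rmult_0_r r); apply B.
    intros x s Hx Hs; simpl; rewrite (E x Hx).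
    replace (Cadd (G x) (Cmul Cm1 (G x))) with C0 by (unfold Cm1, Creal; cring).
    rewrite Cnorm_C0; lra. }
  injection Z as Z1 Z2; unfold Cm1, Creal in *; simpl in *; apply Cpx_eq; lra.
Qed.

Lemma dual_action_mem o a F : action V o -> l1 a -> mem (dual V) F ->
  mem (dual V) (fun x => F (o a x)).
Proof.
  intros Ho Ha HF; pose proof HF as [F1 [F2 [r F3]]]; simpl; split; [|split].
  - intros x y Hx Hy; rewrite (act_add_r _ _ Ho a x y Ha Hx Hy F HF).
    apply F1; apply (act_mem _ _ Ho); auto.
  - intros c x Hx; rewrite (act_scal_r _ _ Ho a c x Ha Hx F HF).
    apply F2, (act_mem _ _ Ho); auto.
  - destruct (act_nle _ _ Ho) as [C [HC0 HC]].
    exists (r * (C * norm1 a)); intros x s Hx Hs.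
    rewrite Rmult_assoc; apply HC; auto.
Qed.

Lemma dual_action o : action V o -> action (dual V) (fun a F x => F (o a x)).
Proof.
  intros Ho; pose proof (fun a F => dual_action_mem o a F Ho) as Hm; split.
  - auto.
  - intros a F G Ha HF HG; apply eqv_weqv; auto using dual_add. intros x Hx; reflexivity.
  - intros a c F Ha HF; apply eqv_weqv; auto using dual_scal. intros x Hx; reflexivity.
  - intros a b F Ha Hb HF; apply eqv_weqv; auto using dual_add, l1_add.
    intros x Hx; simpl. rewrite (act_add_l _ _ Ho a b x Ha Hb Hx F HF).
    destruct HF as [F1 _]; apply F1; apply (act_mem _ _ Ho); auto.
  - intros a c F Ha HF; apply eqv_weqv; auto using dual_scal, l1_scal.
    intros x Hx; simpl. rewrite (act_scal_l _ _ Ho a c x Ha Hx F HF).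
    destruct HF as [_ [F2 _]]; apply F2; apply (act_mem _ _ Ho); auto.
  - destruct (act_nle _ _ Ho) as [C [HC0 HC]]; exists C; split; auto.
    intros a F s Xi r Ha HF Hs HXi Hr; apply Hr; auto.
    intros x t Hx Ht. replace (C * norm1 a * s * t) with (s * (C * norm1 a * t)) by ring.
    apply HC; auto.
Qed.

Lemma good_dual : good (dual V).
Proof.
  split.
  - apply dual_add.
  - apply dual_scal.
  - intros F s HF Hs; destruct (good_ex V HV) as [x [Hx Hx1]].
    specialize (Hs x 1 Hx Hx1); pose proof (Cnorm_ge0 (F x)); lra.
  - exists (fun _ => C0); split.
    + split; [|split]; [intros; cring | intros; cring |].
      exists 0; intros; rewrite Cnorm_C0; lra.
    + intros x s Hx Hs; pose proof (good_nle_ge0 V HV x s Hx Hs); rewrite Cnorm_C0; lra.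
  - intros F [_ [_ H]]; exact H.
  - apply (dual_action (fun a x => rS V x a)), good_rS, HV.
  - apply (dual_action (lS V)), good_lS, HV.
  - apply (dual_action (fun a x => rE V x a)), good_rE, HV.
  - apply (dual_action (lE V)), good_lE, HV.
  - intros a F Ha HF; pose proof (proj1 Ha) as Ha1; apply eqv_weqv.
    + apply (dual_action_mem (fun a x => rE V x a)); auto using good_rE.
    + apply (dual_action_mem (lE V)); auto using good_lE.
    + intros x Hx; simpl; symmetry; apply (good_comm V HV a x Ha Hx F HF).
  - intros e F He HF; apply eqv_weqv; auto.
    + apply (dual_action_mem (fun a x => rE V x a)); auto using good_rE, l1_delta.
    (* The left action on the dual is the transposed right action of [V], so commutativity of [V]
       brings back its trivial left action. *)
    + intros x Hx; simpl; rewrite <- (good_comm V HV (delta S e) x (l1E_delta e He) Hx F HF).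
      apply (good_lE1 V HV e x He Hx F HF).
Qed.

End DualLevel.

(** * Level zero: the quotient of [l1(S)] by [J] *)

Lemma norm1_delta (s : S) : norm1 (delta S s) = 1.
Proof.
  unfold norm1; rewrite (tsum_eq _ (Cnorm (delta S s s))).
  - rewrite delta_same; apply Cnorm_C1.
  - apply (has_sum_single (fun u => Cnorm (delta S s u))).
    intros u Hu; rewrite delta_other, Cnorm_C0; auto.
Qed.

Lemma Lopp_scal (f : L S) : Lopp f = Lscal Cm1 f.
Proof. apply functional_extensionality; intros s; unfold Lopp, Lscal, Cm1, Creal; cring. Qed.

Lemma l1_sub (f g : L S) : l1 f -> l1 g -> l1 (Lsub f g).
Proof. intros Hf Hg; unfold Lsub; rewrite Lopp_scal; apply l1_add; auto using l1_scal. Qed.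

Lemma l1_bounded_Lsub (G : L S -> Cpx) M f g : l1_bounded G M -> l1 f -> l1 g ->
  G (Lsub f g) = Csub (G f) (G g).
Proof.
  intros [H1 [H2 _]] Hf Hg; unfold Lsub; rewrite Lopp_scal, H1, H2 by auto using l1_scal.
  unfold Cm1, Creal; cring.
Qed.

Lemma l1_zero : @l1 S (fun _ => C0).
Proof.
  exists (0 * 0). apply (has_sum_ext (fun _ : S => 0 * 0)); [|intros; rewrite Cnorm_C0; ring].
  apply has_sum_scal; intros eps He; exists []; intros F _ _.
  change (Rabs (sumL (fun _ : S => 0) F - 0) < eps).
  replace (sumL (fun _ : S => 0) F) with 0 by (unfold sumL; induction F; simpl; [|rewrite <- IHF]; ring).
  rewrite Rminus_diag, Rabs_R0; auto.
Qed.

Lemma norm1_Lsub_diag (f : L S) : norm1 (Lsub f f) = 0.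
Proof.
  assert (E : Lsub f f = Lscal C0 (fun _ => C0)).
  { apply functional_extensionality; intros s; unfold Lsub, Ladd, Lopp, Lscal; cring. }
  rewrite E, norm1_scal, Cnorm_C0 by apply l1_zero; ring.
Qed.

Lemma in_span_inJ (g : L S) : l1 g -> in_span g -> inJ g.
Proof.
  intros Hg H; split; auto. intros eps He; exists g; split; auto. rewrite norm1_Lsub_diag; auto.
Qed.

Lemma Jgen_inJ s e t : idempotent S e -> inJ (Jgen S s e t).
Proof.
  intros He; apply in_span_inJ; [apply l1_sub; apply l1_delta|].
  exists [(C1, (s, e, t))]; split.
  - intros x [<-|[]]; exact He.
  - simpl; apply functional_extensionality; intros u; unfold Ladd, Lscal; cring.
Qed.

Lemma zero_inJ : @inJ S (fun _ => C0).
Proof.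
  apply in_span_inJ; [apply l1_zero|]. exists []; split; [intros x [] | reflexivity].
Qed.

Lemma l1_bounded_inJ G M (j : L S) : 0 <= M -> l1_bounded G M ->
  invariant S (fun s => G (delta S s)) -> inJ j -> G j = C0.
Proof.
  intros HM HG HI [Hj Happ]; pose proof HG as [G1 [G2 G3]].
  assert (span0 : forall g, in_span g -> l1 g /\ G g = C0).
  { intros g [l [Hl ->]]; induction l as [|[c [[s e] t]] l IH]; simpl.
    - split; [apply l1_zero|].
      replace (fun _ : S => C0) with (Lscal C0 (fun _ : S => C0))
        by (apply functional_extensionality; intros; unfold Lscal; cring).
      rewrite G2 by apply l1_zero; cring.
    - destruct IH as [IH1 IH2]; [intros x Hx; apply Hl; right; auto|].
      assert (He : idempotent S e) by (apply (Hl (c, (s, e, t))); left; auto).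
      assert (HJ : l1 (Jgen S s e t)) by (apply l1_sub; apply l1_delta).
      split; [apply l1_add; auto using l1_scal|].
      rewrite G1, G2, IH2 by auto using l1_scal.
      unfold Jgen; rewrite (l1_bounded_Lsub G M) by (auto using l1_delta).
      rewrite (HI s e t He); cring. }
  apply Cnorm_eq0, le_epsilon; intros eps He.
  destruct (Happ (eps / (M + 1))) as [g [Hg Hn]]; [apply Rdiv_lt_0_compat; lra|].
  destruct (span0 g Hg) as [Lg Gg].
  assert (E : G j = G (Lsub j g)).
  { rewrite (l1_bounded_Lsub G M), Gg by auto; cring. }
  rewrite E, Rplus_0_l; eapply Rle_trans; [apply G3, l1_sub; auto|].
  apply Rle_trans with (M * (eps / (M + 1))); [apply Rmult_le_compat_l; lra|].
  apply Rle_trans with ((M + 1) * (eps / (M + 1))); [|right; field; lra].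
  apply Rmult_le_compat_r; [|lra]. apply Rlt_le, Rdiv_lt_0_compat; lra.
Qed.

(** An invariant functional kills [J], so [x] may be replaced by a representative nearly attaining
    the quotient norm, with no loss in the constant. *)
Lemma X0_dual_intro G M : 0 <= M -> l1_bounded G M -> invariant S (fun s => G (delta S s)) ->
  mem (dual (X0 S)) G /\ nle (dual (X0 S)) G M.
Proof.
  intros HM HG HI.
  assert (N : nle (dual (X0 S)) G M).
  { intros x s Hx Hs; apply le_epsilon; intros eps He.
    destruct (Hs (eps / (M + 1))) as [j [Hj Hn]]; [apply Rdiv_lt_0_compat; lra|].
    assert (E : G x = G (Lsub x j)).
    { rewrite (l1_bounded_Lsub G M), (l1_bounded_inJ G M j) by (auto; apply Hj); cring. }
    rewrite E; destruct HG as [_ [_ G3]].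
    eapply Rle_trans; [apply G3, l1_sub; [exact Hx | apply Hj]|].
    apply Rle_trans with (M * (s + eps / (M + 1))); [apply Rmult_le_compat_l; auto|].
    rewrite Rmult_plus_distr_l; apply Rplus_le_compat_l.
    apply Rle_trans with ((M + 1) * (eps / (M + 1))); [|right; field; lra].
    apply Rmult_le_compat_r; [|lra]. apply Rlt_le, Rdiv_lt_0_compat; lra. }
  split; auto. destruct HG as [G1 [G2 _]]; split; [exact G1|]; split; [exact G2|].
  exists M; exact N.
Qed.

Lemma nle_norm1 (f : L S) : l1 f -> nle (X0 S) f (norm1 f).
Proof.
  intros Hf eps He; exists (fun _ => C0); split; [apply zero_inJ|].
  replace (Lsub f (fun _ => C0)) with f; [lra|].
  apply functional_extensionality; intros s; unfold Lsub, Ladd, Lopp; cring.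
Qed.

(** The generators of [J] have quotient norm 0, so [F] kills them; on point masses this says
    invariance. *)
Lemma X0_dual_elim F r : mem (dual (X0 S)) F -> nle (dual (X0 S)) F r ->
  l1_bounded F r /\ invariant S (fun s => F (delta S s)).
Proof.
  intros [F1 [F2 _]] Hr.
  assert (HF : l1_bounded F r).
  { split; [exact F1|]; split; [exact F2|]. intros f Hf; apply Hr; auto using nle_norm1. }
  split; auto. intros s e t He.
  assert (HJ : l1 (Jgen S s e t)) by (apply l1_sub; apply l1_delta).
  assert (E : F (Jgen S s e t) = C0).
  { apply Cnorm_eq0; rewrite <- (Rmult_0_r r); apply Hr; auto.
    intros eps Heps; exists (Jgen S s e t); split; [apply Jgen_inJ; auto|].
    rewrite norm1_Lsub_diag; lra. }
  unfold Jgen in E; rewrite (l1_bounded_Lsub F r) in E by auto using l1_delta.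
  injection E as E1 E2; apply Cpx_eq; lra.
Qed.

Record bilinear (B : L S -> L S -> L S) (m : S -> S -> S) : Prop := {
  bil_norm : forall f g, l1 f -> l1 g -> l1 (B f g) /\ norm1 (B f g) <= 2 * (norm1 f * norm1 g) ;
  bil_add_l : forall f f' g, l1 f -> l1 f' -> l1 g -> B (Ladd f f') g = Ladd (B f g) (B f' g) ;
  bil_add_r : forall f g g', l1 f -> l1 g -> l1 g' -> B f (Ladd g g') = Ladd (B f g) (B f g') ;
  bil_scal_l : forall c f g, l1 f -> l1 g -> B (Lscal c f) g = Lscal c (B f g) ;
  bil_scal_r : forall c f g, l1 f -> l1 g -> B f (Lscal c g) = Lscal c (B f g) ;
  bil_delta : forall s t, B (delta S s) (delta S t) = delta S (m s t)
}.

Lemma bilinear_bconv m : bilinear (bconv m) m.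
Proof.
  split; auto using bconv_norm, bconv_add_l, bconv_add_r, bconv_scal_l, bconv_scal_r, bconv_delta.
Qed.

Lemma bilinear_flip B m : bilinear B m -> bilinear (fun f g => B g f) (fun s t => m t s).
Proof.
  intros [H1 H2 H3 H4 H5 H6]; split; auto.
  intros f g Hf Hg; rewrite (Rmult_comm (norm1 f)); auto.
Qed.

Lemma X0_zero_nle : nle (X0 S) (fun _ => C0) 1.
Proof.
  intros eps He; exists (fun _ => C0); split; [apply zero_inJ|].
  rewrite norm1_Lsub_diag; lra.
Qed.

Lemma X0_dual_nle_ge0 F r : nle (dual (X0 S)) F r -> 0 <= r.
Proof.
  intros Hr; specialize (Hr (fun _ => C0) 1 l1_zero X0_zero_nle).
  pose proof (Cnorm_ge0 (F (fun _ => C0))); lra.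
Qed.

Lemma bilinear_compose_l F r B m f : 0 <= r -> l1_bounded F r -> bilinear B m -> l1 f ->
  l1_bounded (fun g => F (B f g)) (r * (2 * norm1 f)).
Proof.
  intros Hr [F1 [F2 F3]] HB Hf; split; [|split].
  - intros g g' Hg Hg'; rewrite (bil_add_r B m HB) by auto; apply F1; apply (bil_norm B m HB); auto.
  - intros c g Hg; rewrite (bil_scal_r B m HB) by auto; apply F2; apply (bil_norm B m HB); auto.
  - intros g Hg; destruct (bil_norm B m HB f g Hf Hg) as [H1 H2].
    eapply Rle_trans; [apply F3; auto|].
    rewrite Rmult_assoc; apply Rmult_le_compat_l; lra.
Qed.

Lemma bilinear_compose_r F r B m g : 0 <= r -> l1_bounded F r -> bilinear B m -> l1 g ->
  l1_bounded (fun f => F (B f g)) (r * (2 * norm1 g)).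
Proof.
  intros Hr HF HB Hg.
  exact (bilinear_compose_l F r _ _ g Hr HF (bilinear_flip B m HB) Hg).
Qed.

(** For fixed [a], the functional sending [x] to [F (B a x)] is invariant, first for a point mass
    [a] and then by density for all. [X0_dual_intro] then gives its bound for the quotient norm. *)
Lemma action_X0 B m : bilinear B m ->
  (forall X (h : S -> X) v, invariant S h -> invariant S (fun s => h (m v s))) ->
  action (X0 S) B.
Proof.
  intros HB Hm; split.
  - intros a x Ha Hx; apply (bil_norm B m HB); auto.
  - intros a x y Ha Hx Hy F HF; simpl; rewrite (bil_add_r B m HB); auto.
  - intros a c x Ha Hx F HF; simpl; rewrite (bil_scal_r B m HB); auto.
  - intros a b x Ha Hb Hx F HF; simpl; rewrite (bil_add_l B m HB); auto.
  - intros a c x Ha Hx F HF; simpl; rewrite (bil_scal_l B m HB); auto.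
  - exists 2; split; [lra|]. intros a x s F r Ha Hx Hs HF Hr.
    pose proof (X0_dual_nle_ge0 F r Hr) as Hr0.
    destruct (X0_dual_elim F r HF Hr) as [HB1 HI].
    pose proof (bilinear_compose_l F r B m a Hr0 HB1 HB Ha) as HL.
    rewrite <- Rmult_assoc.
    apply (X0_dual_intro (fun x => F (B a x)) (r * (2 * norm1 a))); auto.
    + pose proof (norm1_ge0 a Ha); apply Rmult_le_pos; lra.
    + intros u e v He.
      apply (l1_functional_eq _ _ _ _ a
        (bilinear_compose_r F r B m (delta S (op S (op S u e) v)) Hr0 HB1 HB (l1_delta _))
        (bilinear_compose_r F r B m (delta S (op S u v)) Hr0 HB1 HB (l1_delta _)) Ha).
      intros w _; rewrite !(bil_delta B m HB).
      exact (Hm _ _ w HI u e v He).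
Qed.

Lemma good_X0 : good (X0 S).
Proof.
  split.
  - exact l1_add.
  - exact l1_scal.
  - intros x s Hx Hs; apply le_epsilon; intros eps He.
    destruct (Hs eps He) as [j [Hj Hn]].
    pose proof (norm1_ge0 (Lsub x j) (l1_sub x j Hx (proj1 Hj))); lra.
  - exists (fun _ => C0); split; [apply l1_zero | apply X0_zero_nle].
  - intros x Hx; exists (norm1 x); apply nle_norm1; auto.
  - apply (action_X0 (bconv (op S)) (op S) (bilinear_bconv _)).
    intros X h v Hh s e t He; rewrite !op_assoc, (Hh (op S v s) e t He); auto.
  - apply (action_X0 (fun f g => bconv (op S) g f) (fun s t => op S t s) (bilinear_flip _ _ (bilinear_bconv _))).
    intros X h v Hh s e t He; rewrite <- (op_assoc S _ t v), (Hh s e (op S t v) He), op_assoc; auto.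
  - apply (action_X0 (bconv (fun _ s => s)) (fun _ s => s) (bilinear_bconv _)).
    intros X h v Hh; exact Hh.
  - apply (action_X0 (fun f g => bconv (op S) g f) (fun s t => op S t s) (bilinear_flip _ _ (bilinear_bconv _))).
    intros X h v Hh s e t He; rewrite <- (op_assoc S _ t v), (Hh s e (op S t v) He), op_assoc; auto.
  (* Both sides are bounded and linear in [a] and in [x]. On point masses, with [e] in the support
     of [a] and so idempotent, they compare [s] with the product of [s] and [e]. *)
  - intros a x [Ha HaE] Hx F HF; pose proof HF as [_ [_ [r Hr]]].
    pose proof (X0_dual_nle_ge0 F r Hr) as Hr0.
    destruct (X0_dual_elim F r HF Hr) as [HB HI].
    apply (l1_functional_eq (fun a => F (bconv (fun _ s => s) a x)) (fun a => F (bconv (op S) x a)) _ _ a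
      (bilinear_compose_r F r _ _ x Hr0 HB (bilinear_bconv _) Hx)
      (bilinear_compose_l F r _ _ x Hr0 HB (bilinear_bconv _) Hx) Ha).
    intros e He; specialize (HaE e He).
    change (bconv (fun _ s => s) (delta S e) x) with (actEl (delta S e) x); rewrite actEl_delta.
    apply (l1_functional_eq F (fun x => F (bconv (op S) x (delta S e))) _ _ x HB
      (bilinear_compose_r F r _ _ (delta S e) Hr0 HB (bilinear_bconv _) (l1_delta _)) Hx).
    intros s _; rewrite bconv_delta; symmetry.
    exact (invariant_r S (fun s => F (delta S s)) s e HI HaE).
  - intros e x He Hx F HF; simpl; rewrite actEl_delta; auto.
Qed.

End Levels.

(** * Derivations *)


(* [dual W] is the complexification of [A], a functional [F] corresponding to the function [F o j]. *)
Record represents {S : InvSemigroup} (W : Lev S) (A : fspace S) (j : ix A -> T W) : Prop := {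
  rep_mem : forall i, mem W (j i) ;
  rep_nb : exists C, 0 <= C /\ forall F r, mem (dual W) F -> nle (dual W) F r ->
    nb A (fun i => re (F (j i))) (C * r) /\ nb A (fun i => im (F (j i))) (C * r) ;
  rep_inj : forall F G, mem (dual W) F -> mem (dual W) G -> (forall i, F (j i) = G (j i)) ->
    forall x, mem W x -> F x = G x ;
  rep_surj : exists C, 0 <= C /\ forall a r, nb A a r -> exists F, mem (dual W) F /\
    nle (dual W) F (C * r) /\ forall i, F (j i) = Creal (a i) ;
  rep_la : forall s i F, mem (dual W) F -> F (j (la A s i)) = F (lS W (delta S s) (j i)) ;
  rep_ra : forall s i F, mem (dual W) F -> F (j (ra A s i)) = F (rS W (j i) (delta S s))
}.

Lemma represents_X0 (S : InvSemigroup) : represents (X0 S) (base S) (delta S).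
Proof.
  split.
  - apply l1_delta.
  - exists 1; split; [lra|]. intros F r HF Hr.
    pose proof (X0_dual_nle_ge0 F r Hr) as Hr0.
    destruct (X0_dual_elim F r HF Hr) as [[_ [_ B]] HI].
    assert (N : forall s, Cnorm (F (delta S s)) <= 1 * r)
      by (intros s; specialize (B _ (l1_delta s)); rewrite norm1_delta in B; lra).
    split; (split; [lra|]; split; [intros s; eapply Rle_trans; [|apply (N s)] |]).
    + apply re_le_Cnorm.
    + intros s e t He; f_equal; apply (HI s e t He).
    + apply im_le_Cnorm.
    + intros s e t He; f_equal; apply (HI s e t He).
  - intros F G HF HG E x Hx; pose proof HF as [_ [_ [r Hr]]]; pose proof HG as [_ [_ [r' Hr']]].
    destruct (X0_dual_elim F r HF Hr) as [B _]; destruct (X0_dual_elim G r' HG Hr') as [B' _].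
    apply (l1_functional_eq F G r r' x B B' Hx); auto.
  - exists 2; split; [lra|]. intros a r [Hr [Ha HI]].
    (* The usual pairing of summable with bounded functions. *)
    set (F := fun f : L S => tsumC (fun s => Cmul (f s) (Creal (a s)))).
    assert (Bd : forall (f : L S) s, Cnorm (Cmul (f s) (Creal (a s))) <= r * Cnorm (f s)).
    { intros f s; rewrite Cnorm_mul, Rmult_comm; apply Rmult_le_compat_r; [apply Cnorm_ge0|].
      eapply Rle_trans; [apply Cnorm_le_sum|]; simpl; rewrite Rabs_R0; specialize (Ha s); lra. }
    assert (Sg : forall f : L S, l1 f -> has_sum (fun s => r * Cnorm (f s)) (r * norm1 f))
      by (intros f Hf; apply has_sum_scal, (summable_tsum _ Hf)).
    assert (Sm : forall f : L S, l1 f -> abs_summable (fun s => Cmul (f s) (Creal (a s)))).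
    { intros f Hf; apply (dominated_summable _ (fun s => r * Cnorm (f s))).
      - eexists; apply Sg; auto.
      - intros s; split; [apply Cnorm_ge0 | apply Bd]. }
    assert (Fd : forall s, F (delta S s) = Creal (a s)).
    { intros s; unfold F; rewrite (tsumC_single _ s).
      - rewrite delta_same; cring.
      - intros t Ht; rewrite delta_other by auto; cring. }
    assert (HF : l1_bounded F (2 * r)).
    { split; [|split].
      - intros f g Hf Hg; unfold F; rewrite <- tsumC_add by auto.
        f_equal; apply functional_extensionality; intros s; unfold Ladd; cring.
      - intros c f Hf; unfold F; rewrite <- tsumC_scal by auto.
        f_equal; apply functional_extensionality; intros s; unfold Lscal; cring.
      - intros f Hf; unfold F; rewrite Rmult_assoc, <- (tsum_eq _ _ (Sg f Hf)).
        apply Cnorm_tsumC; [eexists; apply Sg; auto | apply Bd]. }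
    exists F; destruct (X0_dual_intro F (2 * r)) as [H1 H2]; auto; [lra|].
    intros s e t He; rewrite !Fd, (HI s e t He); auto.
  - intros s i F _; simpl; unfold conv; rewrite bconv_delta; auto.
  - intros s i F _; simpl; unfold conv; rewrite bconv_delta; auto.
Qed.

Section Step.
Context {S : InvSemigroup} (W : Lev S) (A : fspace S) (j : ix A -> T W).
Hypothesis HW : good W.
Hypothesis HR : represents W A j.

Local Notation K := (poscone A).

(** The lift of [p] is chosen with one norm bound, yet must respect all of them: [rep_inj]
    identifies it with the lift chosen for any other bound. *)
Lemma lift_exists : exists C (j' : pt K -> T (dual W)), 0 <= C /\ forall p, mem (dual W) (j' p) /\
  (forall i, j' p (j i) = Creal (val A p i)) /\ forall c, bd p c -> nle (dual W) (j' p) (C * c).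
Proof.
  destruct (rep_surj _ _ _ HR) as [C [HC0 HC]].
  assert (E : forall p : pt K, exists F, mem (dual W) F /\
    (forall i, F (j i) = Creal (val A p i)) /\ forall c, bd p c -> nle (dual W) F (C * c)).
  { intros p; destruct (val_nb A p) as [r Hr].
    destruct (HC _ r Hr) as [F [H1 [_ H3]]]; exists F; split; [|split]; auto.
    intros c Hc x s Hx Hs; destruct (HC _ c Hc) as [F' [I1 [I2 I3]]].
    rewrite (rep_inj _ _ _ HR F F' H1 I1); auto. intros i; rewrite H3, I3; auto. }
  exists C, (fun p => proj1_sig (constructive_indefinite_description _ (E p))); split; auto.
  intros p; destruct constructive_indefinite_description as [F HF]; exact HF.
Qed.

Definition difference_value (w : pt K -> R) (a : ix A -> R) (v : R) : Prop :=
  exists p q : pt K, (forall i, a i = val A p i - val A q i) /\ v = w p - w q.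

Definition extend (w : pt K -> R) (a : ix A -> R) : R := epsilon (inhabits 0) (difference_value w a).

Section Extend.
Variable w : pt K -> R.
Hypothesis Hw : lin w.

(** Two representations as differences give equal cross sums in the cone, on which [w] is additive;
    so the value does not depend on the choice. *)
Lemma extend_eq a (p q : pt K) : (forall i, a i = val A p i - val A q i) -> extend w a = w p - w q.
Proof.
  intros E.
  assert (H : difference_value w a (extend w a)).
  { unfold extend; apply epsilon_spec; exists (w p - w q), p, q; auto. }
  destruct H as [p' [q' [E' ->]]].
  assert (Es : plus p' q = plus p q').
  { apply (val_inj A); intros i; simpl. specialize (E i); specialize (E' i); lra. }
  destruct Hw as [C [H1 _]].
  pose proof (H1 p' q) as X; rewrite Es, H1 in X; lra.
Qed.

Lemma parts (a : ix A -> R) r : nb A a r -> exists p q : pt K, bd p r /\ bd q r /\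
  forall i, a i = val A p i - val A q i.
Proof.
  intros Ha; destruct (nb_parts S A a r Ha) as [p [q [Hp [Hq [P [Q E]]]]]].
  exists (mkpos A p (conj (ex_intro _ r Hp) P)), (mkpos A q (conj (ex_intro _ r Hq) Q)).
  split; [|split]; auto.
Qed.

Lemma extend_add a b r s : nb A a r -> nb A b s ->
  extend w (fun i => a i + b i) = extend w a + extend w b.
Proof.
  intros Ha Hb; destruct (parts a r Ha) as [p [q [_ [_ E]]]].
  destruct (parts b s Hb) as [p' [q' [_ [_ E']]]].
  rewrite (extend_eq a p q), (extend_eq b p' q') by auto.
  rewrite (extend_eq _ (plus p p') (plus q q')).
  - destruct Hw as [C [H1 _]]; rewrite !H1; ring.
  - intros i; simpl; rewrite E, E'; ring.
Qed.

Lemma extend_scal k a r : nb A a r -> extend w (fun i => k * a i) = k * extend w a.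
Proof.
  intros Ha; destruct (parts a r Ha) as [p [q [_ [_ E]]]].
  rewrite (extend_eq a p q) by auto; destruct Hw as [C [_ [H2 _]]].
  destruct (Rle_dec 0 k) as [Hk|Hk].
  - rewrite (extend_eq _ (sc k p) (sc k q)).
    + rewrite !H2 by auto; ring.
    + intros i; simpl; rewrite E, Rabs_right by lra; ring.
  - rewrite (extend_eq _ (sc (- k) q) (sc (- k) p)).
    + rewrite !H2 by lra; ring.
    + intros i; simpl; rewrite E, Rabs_right by lra; ring.
Qed.

Lemma extend_bd a r M : lin_bd w M -> nb A a r -> Rabs (extend w a) <= 2 * M * r.
Proof.
  intros [_ [_ [_ HM]]] Ha; destruct (parts a r Ha) as [p [q [Hp [Hq E]]]].
  rewrite (extend_eq a p q) by auto.
  specialize (HM p r Hp) as H1; specialize (HM q r Hq).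
  unfold Rminus; eapply Rle_trans; [apply Rabs_triang|]; rewrite Rabs_Ropp; lra.
Qed.

End Extend.

(** [next A] is indexed by the positive elements of [A] alone. These suffice, since every element of
    [dual W] is a complex combination of four of them. *)
Lemma represents_dual : exists j', represents (dual W) (next A) j'.
Proof.
  pose proof (good_dual W HW) as HW'; pose proof (good_dual _ HW') as HW''.
  destruct lift_exists as [C [j' [HC0 Hj]]]; exists j'.
  assert (jm : forall p, mem (dual W) (j' p)) by (intros p; apply Hj).
  assert (jv : forall p i, j' p (j i) = Creal (val A p i)) by (intros p; apply Hj).
  assert (jn : forall p c, bd p c -> nle (dual W) (j' p) (C * c)) by (intros p; apply Hj).
  destruct (rep_nb _ _ _ HR) as [C2 [HC20 HC2]].
  assert (weq : forall F G, mem (dual W) F -> mem (dual W) G -> (forall i, F (j i) = G (j i)) ->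
    weqv (dual W) F G).
  { intros F G HF HG E; apply eqv_weqv; auto. intros x Hx; apply (rep_inj _ _ _ HR); auto. }
  split.
  - exact jm.
  - exists C; split; auto. intros Xi r HXi Hr; pose proof HXi as [X1 [X2 _]].
    assert (Hr0 : 0 <= r) by (eapply (good_nle_ge0 _ HW''); eauto).
    assert (A1 : forall p q : pt K, Xi (j' (plus p q)) = Cadd (Xi (j' p)) (Xi (j' q))).
    { intros p q; rewrite <- X1 by auto; apply weq; auto; [apply dual_add; auto|].
      intros i; simpl; rewrite !jv; unfold Creal; cring. }
    assert (A2 : forall c (p : pt K), 0 <= c -> Xi (j' (sc c p)) = Cmul (Creal c) (Xi (j' p))).
    { intros c p Hc; rewrite <- X2 by auto; apply weq; auto; [apply dual_scal; auto|].
      intros i; simpl; rewrite !jv; unfold Creal; simpl; rewrite Rabs_right by lra; cring. }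
    assert (A3 : forall (p : pt K) c, bd p c -> Cnorm (Xi (j' p)) <= C * r * c).
    { intros p c Hc; replace (C * r * c) with (r * (C * c)) by ring; apply Hr; auto. }
    assert (P : 0 <= C * r) by (apply Rmult_le_pos; auto).
    split; (split; [|split; [|split; [exact P|]]]).
    + intros p q; rewrite A1; auto.
    + intros c p Hc; rewrite A2 by auto; simpl; ring.
    + intros p c Hc; eapply Rle_trans; [apply re_le_Cnorm | auto].
    + intros p q; rewrite A1; auto.
    + intros c p Hc; rewrite A2 by auto; simpl; ring.
    + intros p c Hc; eapply Rle_trans; [apply im_le_Cnorm | auto].
  - intros Xi Xi' HXi HXi' E F HF; pose proof HF as [_ [_ [r Hr]]].
    destruct (HC2 F r HF Hr) as [Hre Him].
    destruct (parts _ _ Hre) as [p [q [_ [_ E1]]]]; destruct (parts _ _ Him) as [p' [q' [_ [_ E2]]]].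
    (* The four positive parts of [F] reassembled from lifts; [F'] agrees with [F] on all [j i],
       hence for every functional. *)
    set (F' := add (dual W) (add (dual W) (j' p) (scal (dual W) Cm1 (j' q)))
      (scal (dual W) (mkC 0 1) (add (dual W) (j' p') (scal (dual W) Cm1 (j' q'))))).
    assert (M : forall x y, mem (dual W) x -> mem (dual W) y -> mem (dual W) (add (dual W) x y))
      by apply dual_add.
    assert (M' : forall c x, mem (dual W) x -> mem (dual W) (scal (dual W) c x)) by apply dual_scal.
    assert (HF' : mem (dual W) F') by (unfold F'; auto 10).
    assert (Q : weqv (dual W) F F').
    { apply weq; auto. intros i; unfold F'; simpl; rewrite !jv; specialize (E1 i); specialize (E2 i).
      apply Cpx_eq; simpl; simpl in E1, E2; rewrite ?E1, ?E2; ring. }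
    rewrite (Q Xi HXi), (Q Xi' HXi').
    destruct HXi as [X1 [X2 _]]; destruct HXi' as [Y1 [Y2 _]].
    unfold F'; rewrite !X1, !X2, !X1, !X2, !Y1, !Y2, !Y1, !Y2, !E by auto 10; auto.
  (* [extend_bd] loses a factor 2 for positive and negative parts, and adding real and imaginary
     parts another. *)
  - exists (4 * C2); split; [lra|]. intros w r Hr.
    assert (Hw : lin w) by (exists r; auto).
    set (Xi := fun F : T (dual W) => mkC (extend w (fun i => re (F (j i)))) (extend w (fun i => im (F (j i))))).
    assert (N : nle (dual (dual W)) Xi (4 * C2 * r)).
    { intros F s HF Hs; destruct (HC2 F s HF Hs) as [Hre Him].
      pose proof (extend_bd w Hw _ _ r Hr Hre); pose proof (extend_bd w Hw _ _ r Hr Him).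
      eapply Rle_trans; [apply Cnorm_le_sum|]; simpl. lra. }
    exists Xi; split; [split; [|split]|split]; auto.
    + intros F G HF HG; pose proof HF as [_ [_ [s Hs]]]; pose proof HG as [_ [_ [t Ht]]].
      destruct (HC2 F s HF Hs) as [Hre Him]; destruct (HC2 G t HG Ht) as [Hre' Him'].
      unfold Xi; apply Cpx_eq; simpl; [apply (extend_add w Hw _ _ _ _ Hre Hre') | apply (extend_add w Hw _ _ _ _ Him Him')].
    + intros c F HF; pose proof HF as [_ [_ [s Hs]]]; destruct (HC2 F s HF Hs) as [Hre Him].
      unfold Xi; apply Cpx_eq; simpl.
      * transitivity (extend w (fun i => re c * re (F (j i)) + (- im c) * im (F (j i)))).
        { f_equal; apply functional_extensionality; intros; ring. }
        rewrite (extend_add w Hw _ _ _ _ (nb_scal S A (re c) _ _ Hre) (nb_scal S A (- im c) _ _ Him)).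
        rewrite (extend_scal w Hw _ _ _ Hre), (extend_scal w Hw _ _ _ Him); ring.
      * rewrite (extend_add w Hw _ _ _ _ (nb_scal S A (re c) _ _ Him) (nb_scal S A (im c) _ _ Hre)).
        rewrite (extend_scal w Hw _ _ _ Hre), (extend_scal w Hw _ _ _ Him); ring.
    + exists (4 * C2 * r); exact N.
    + intros p; unfold Xi, Creal; f_equal.
      * rewrite (extend_eq w Hw _ p zero); [rewrite (lin_zero w Hw); ring|].
        intros i; rewrite jv; simpl; ring.
      * rewrite (extend_eq w Hw _ zero zero); [ring|].
        intros i; rewrite jv; simpl; ring.
  - intros s p Xi HXi; apply weq; auto.
    + apply (act_mem _ _ (good_lS _ HW')); auto using l1_delta.
    + intros i; simpl; rewrite jv; rewrite <- (rep_ra _ _ _ HR), jv by auto; auto.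
  - intros s p Xi HXi; apply weq; auto.
    + apply (act_mem _ _ (good_rS _ HW')); auto using l1_delta.
    + intros i; simpl; rewrite jv; rewrite <- (rep_la _ _ _ HR), jv by auto; auto.
Qed.

End Step.

Lemma tower (S : InvSemigroup) (n : nat) : exists A j,
  good (Xn S (2 * n)) /\ represents (Xn S (2 * n)) A j /\ exists u, is_unit A u.
Proof.
  induction n as [|n [A [j [H1 [H2 [u H3]]]]]].
  - exists (base S), (delta S); split; [apply good_X0|]; split; [apply represents_X0 | apply base_unit].
  - replace (2 * Datatypes.S n)%nat with (Datatypes.S (Datatypes.S (2 * n))) by lia.
    destruct (represents_dual _ _ _ H1 H2) as [j1 H4].
    destruct (represents_dual _ _ _ (good_dual _ H1) H4) as [j2 H5].
    exists (next (next A)), j2; split; [|split]; auto.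
    + apply (good_dual (dual (Xn S (2 * n)))), good_dual, H1.
    + eapply next_next_unit; eauto.
Qed.

Section Derivation.
Context {S : InvSemigroup} (Y : Lev S) (A : fspace S) (j : pt (poscone A) -> T Y) (u : pt (poscone A)).
Hypothesis HY : good Y.
Hypothesis HR : represents Y (next A) j.
Hypothesis Hu : is_unit A u.
Context (D : L S -> T (dual Y)).
Hypothesis HD : module_derivation (dual Y) D.

Local Notation K := (poscone A).
Let D_mem a : l1 a -> mem (dual Y) (D a).
Proof. apply HD. Qed.

Definition conj_act (s : S) (p : pt K) : pt K := pos_la A (star S s) (pos_ra A s p).
Definition conj_inv (s : S) (p : pt K) : pt K := pos_ra A (star S s) (pos_la A s p).
Definition cocycle (s : S) (p : pt K) : Cpx := D (delta S s) (j (pos_la A (star S s) p)).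

Lemma conj_actK s p : conj_act s (conj_inv s p) = p.
Proof.
  unfold conj_act, conj_inv; rewrite pos_ra_ra, pos_ra_idem by apply idempotent_s's.
  rewrite pos_la_la, pos_la_idem; auto using idempotent_s's.
Qed.

Lemma conj_invK s p : conj_inv s (conj_act s p) = p.
Proof.
  unfold conj_act, conj_inv; rewrite pos_la_la, pos_la_idem by apply idempotent_ss.
  rewrite pos_ra_ra, pos_ra_idem; auto using idempotent_ss.
Qed.

Lemma kmap_comp (phi psi : pt K -> pt K) : kmap phi -> kmap psi -> kmap (fun p => phi (psi p)).
Proof.
  intros [P1 [P2 P3]] [Q1 [Q2 Q3]]; split; [|split]; auto.
  - intros; rewrite Q1, P1; auto.
  - intros; rewrite Q2, P2; auto.
Qed.

(** The derivation rule is evaluated at [star t] times [star s] times [p]. In one term [s] is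
    appended on the right, which makes the conjugate of [p]; in the other [t] comes in front and the
    idempotent formed with [star t] disappears. *)
Lemma cocycle_op s t p : cocycle (op S s t) p = Cadd (cocycle t (conj_act s p)) (cocycle s p).
Proof.
  destruct HD as [_ [_ [_ [Hder _]]]].
  unfold cocycle at 1; rewrite <- (bconv_delta (op S)).
  change (bconv (op S) (delta S s) (delta S t)) with (conv (delta S s) (delta S t)).
  rewrite (Hder _ _ (l1_delta s) (l1_delta t) _ (rep_mem _ _ _ HR _)).
  simpl; rewrite <- (rep_ra _ _ _ HR), <- (rep_la _ _ _ HR) by auto using l1_delta.
  simpl; rewrite star_op; f_equal; unfold cocycle, conj_act; f_equal; f_equal.
  - rewrite <- pos_la_la, <- !pos_la_ra; auto.
  - rewrite pos_la_la, op_assoc, <- pos_la_la, pos_la_idem by apply idempotent_ss; auto.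
Qed.

Lemma cocycle_lin_bd : exists C, forall s, lin_bd (fun p => re (cocycle s p)) C /\
  lin_bd (fun p => im (cocycle s p)) C.
Proof.
  destruct HD as [_ [_ [_ [_ [_ [_ [C HC]]]]]]].
  destruct (rep_nb _ _ _ HR) as [C2 [_ HC2]].
  exists (C2 * (C * 1)); intros s.
  pose proof (HC _ (l1_delta s)) as N; rewrite norm1_delta in N.
  destruct (HC2 _ _ (D_mem _ (l1_delta s)) N) as [H1 H2].
  split; [exact (lin_bd_comp (K := poscone A) _ _ _ H1 (kmap_la A (star S s))) |
    exact (lin_bd_comp (K := poscone A) _ _ _ H2 (kmap_la A (star S s)))].
Qed.

Lemma real_fixed_point (b : S -> pt K -> R) C : (forall s, lin_bd (b s) C) ->
  (forall s t p, b (op S s t) p = b t (conj_act s p) + b s p) ->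
  exists w, lin w /\ forall s p, w p = w (conj_act s p) + b s p.
Proof.
  intros Hb Hc.
  (* An [InvSemigroup] may be empty, while the fixed point argument starts from a point. *)
  destruct (classic (inhabited S)) as [[s0]|Hn].
  - destruct Hu as [U1 [U2 U3]].
    apply (bounded_cocycle_trivial (op S) b conj_act conj_inv u C s0); auto.
    + intros s; exact (kmap_comp _ _ (kmap_la A (star S s)) (kmap_ra A s)).
    + intros s; exact (kmap_comp _ _ (kmap_ra A (star S s)) (kmap_la A s)).
    + apply conj_actK.
    + apply conj_invK.
    + intros s; unfold conj_act; destruct (U3 s) as [_ ->]; apply U3.
    (* Left translation by [s] recovers [t] up to an idempotent [e], which is harmless: the cocycle
       identity for [e] times [e] forces [b e] to vanish. *)
    + intros s t; exists (op S (star S s) t); intros p.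
      set (e := op S s (star S s)).
      assert (He : idempotent S e) by apply idempotent_ss.
      assert (Ee : conj_act e p = p).
      { unfold conj_act; rewrite pos_ra_idem, pos_la_idem; auto. rewrite star_idempotent; auto. }
      assert (Z : b e p = 0) by (pose proof (Hc e e p) as H; rewrite He, Ee in H; lra).
      rewrite op_assoc; fold e; rewrite Hc, Ee, Z; ring.
  - exists (fun _ => 0); split; [apply lin_0|]. intros s; exfalso; apply Hn; constructor; auto.
Qed.

Lemma implementing_functional : exists Phi, mem (dual Y) Phi /\
  forall s p, cocycle s p = Cadd (Phi (j (conj_act s p))) (Copp (Phi (j p))).
Proof.
  destruct cocycle_lin_bd as [C HC].
  destruct (real_fixed_point (fun s p => re (cocycle s p)) C) as [w1 [[C1 L1] W1]];
    [apply HC | intros; rewrite cocycle_op; reflexivity |].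
  destruct (real_fixed_point (fun s p => im (cocycle s p)) C) as [w2 [[C2 L2] W2]];
    [apply HC | intros; rewrite cocycle_op; reflexivity |].
  destruct (rep_surj _ _ _ HR) as [C3 [_ HC3]].
  destruct (HC3 w1 C1 L1) as [F1 [M1 [_ E1]]]; destruct (HC3 w2 C2 L2) as [F2 [M2 [_ E2]]].
  (* The sign is reversed because the fixed point equation gives the cocycle as [w] at [p] minus [w]
     at its conjugate. *)
  exists (add (dual Y) (scal (dual Y) Cm1 F1) (scal (dual Y) (mkC 0 (-1)) F2)); split.
  - apply dual_add; apply dual_scal; auto.
  - intros s p; simpl; rewrite !E1, !E2; unfold Cm1, Creal; apply Cpx_eq; simpl.
    + rewrite (W1 s p); ring.
    + rewrite (W2 s p); ring.
Qed.

(** A module derivation is only additive. Homogeneity follows from [c] times [delta e] acting on the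
    left as multiplication by [c], both on [l1(S)] and, up to [weqv], on [Y]. *)
Lemma derivation_l1_bounded x : mem Y x -> exists M, l1_bounded (fun a => D a x) M.
Proof.
  intros Hx; destruct HD as [_ [Hadd [_ [_ [HE [_ [C HC]]]]]]].
  destruct (good_nle_ex Y HY x Hx) as [r Hr].
  exists (C * r); split; [|split].
  - intros a b Ha Hb; apply (Hadd a b Ha Hb x Hx).
  - intros c a Ha; destruct (classic (inhabited S)) as [[s]|Hn].
    + set (e := op S s (star S s)).
      assert (He : idempotent S e) by apply idempotent_ss.
      assert (HcE : l1E (Lscal c (delta S e))).
      { split; [apply l1_scal, l1_delta|]. intros t Ht; apply (proj2 (l1E_delta e He)).
        intros E; apply Ht; unfold Lscal; rewrite E; cring. }
      replace (Lscal c a) with (actEl (Lscal c (delta S e)) a)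
        by (unfold actEl; rewrite bconv_scal_l by auto using l1_delta;
            change (bconv _ (delta S e) a) with (actEl (delta S e) a); rewrite actEl_delta; auto).
      rewrite (HE _ a HcE Ha x Hx); simpl.
      pose proof (D_mem a Ha) as HDa.
      rewrite <- (good_comm Y HY _ x HcE Hx (D a) HDa).
      rewrite (act_scal_l _ _ (good_lE Y HY) (delta S e) c x (l1_delta e) Hx (D a) HDa).
      destruct HDa as [H1 [H2 H3]].
      rewrite H2 by (apply (act_mem _ _ (good_lE Y HY)); auto using l1_delta).
      rewrite (good_lE1 Y HY e x He Hx (D a)) by auto; auto.
    (* Over an empty semigroup there is just one function, and additivity alone gives
       [D a x = C0]. *)
    + assert (E : forall f g : L S, f = g)
        by (intros; apply functional_extensionality; intros s; exfalso; apply Hn; constructor; auto).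
      pose proof (Hadd a a Ha Ha x Hx) as H; rewrite (E (Ladd a a) a) in H; simpl in H.
      assert (Z : D a x = C0) by (pose proof (f_equal re H); pose proof (f_equal im H); simpl in *; apply Cpx_eq; simpl; lra).
      rewrite (E (Lscal c a) a), Z; cring.
  - intros a Ha; replace (C * r * norm1 a) with (C * norm1 a * r) by ring.
    apply (HC a Ha); auto.
Qed.

Lemma action_l1_bounded o F x : action Y o -> mem (dual Y) F -> mem Y x ->
  exists M, l1_bounded (fun a => F (o a x)) M.
Proof.
  intros Ho HF Hx; pose proof HF as [F1 [F2 [r Hr]]].
  destruct (act_nle _ _ Ho) as [C [HC0 HC]]; destruct (good_nle_ex Y HY x Hx) as [s Hs].
  exists (r * C * s); split; [|split].
  - intros a b Ha Hb; rewrite (act_add_l _ _ Ho a b x Ha Hb Hx F HF).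
    apply F1; apply (act_mem _ _ Ho); auto.
  - intros c a Ha; rewrite (act_scal_l _ _ Ho a c x Ha Hx F HF).
    apply F2; apply (act_mem _ _ Ho); auto.
  - intros a Ha; replace (r * C * s * norm1 a) with (r * (C * norm1 a * s)) by ring; auto.
Qed.

Lemma derivation_inner : inner_derivation (dual Y) D.
Proof.
  destruct implementing_functional as [Phi [HPhi E]]; exists Phi; split; auto.
  assert (Hd : forall s x, mem Y x -> D (delta S s) x =
    Csub (Phi (rS Y x (delta S s))) (Phi (lS Y (delta S s) x))).
  { intros s.
    assert (M : mem (dual Y) (fun x => Csub (Phi (rS Y x (delta S s))) (Phi (lS Y (delta S s) x)))).
    { replace (fun x => Csub (Phi (rS Y x (delta S s))) (Phi (lS Y (delta S s) x))) with
        (add (dual Y) (fun x => Phi (rS Y x (delta S s)))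
          (scal (dual Y) Cm1 (fun x => Phi (lS Y (delta S s) x)))).
      - apply dual_add; [|apply dual_scal].
        + apply (dual_action_mem Y (fun a x => rS Y x a)); auto using good_rS, l1_delta.
        + apply (dual_action_mem Y (lS Y)); auto using good_lS, l1_delta.
      - apply functional_extensionality; intros x; simpl; unfold Cm1, Creal; cring. }
    apply (rep_inj _ _ _ HR (D (delta S s)) _ (D_mem _ (l1_delta s)) M).
    intros p; rewrite <- (rep_la _ _ _ HR), <- (rep_ra _ _ _ HR) by auto.
    (* Taking [s] times [p] for the point cancels the factor [star s] built into the cocycle, and
       the conjugate becomes [p] times [s]. *)
    pose proof (E s (pos_la A s p)) as H; unfold cocycle, conj_act in H.
    rewrite <- (pos_la_ra A s s p) in H.
    rewrite !pos_la_la, !pos_la_idem in H by apply idempotent_s's.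
    simpl; rewrite H; auto. }
  intros a Ha x Hx.
  destruct (derivation_l1_bounded x Hx) as [M HM].
  destruct (action_l1_bounded _ Phi x (good_rS Y HY) HPhi Hx) as [M1 HM1].
  destruct (action_l1_bounded _ Phi x (good_lS Y HY) HPhi Hx) as [M2 HM2].
  apply (l1_functional_eq _ _ _ _ a HM (l1_bounded_sub _ _ _ _ HM1 HM2) Ha).
  intros s _; apply Hd; auto.
Qed.

End Derivation.

Theorem mainTheorem1 (S : InvSemigroup) (n : nat) :
  (1 <= n)%nat -> n_weakly_module_amenable S (2 * n).
Proof.
  (* Level [2 * n] is now the dual of the odd level [Y], itself the dual of the even level that
     carries the unit in [tower]. *)
  intros Hn; destruct n as [|n]; [lia|].
  destruct (tower S n) as [A [j [H1 [H2 [u Hu]]]]].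
  replace (2 * Datatypes.S n)%nat with (Datatypes.S (Datatypes.S (2 * n))) by lia.
  set (Y := dual (Xn S (2 * n))).
  assert (HY : good Y) by (apply good_dual; auto).
  destruct (represents_dual _ _ _ H1 H2) as [j' H3].
  split.
  - intros a F Ha HF x Hx; symmetry; exact (good_comm Y HY a x Ha Hx F HF).
  - intros D HD; exact (derivation_inner Y A j' u HY H3 Hu D HD).
Qed.
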